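(* Every complex nilpotent Lie algebra $\mathfrak{n}$ of dimension $\le 7$ is the degeneration of another, non-isomorphic, Lie algebra; that is, there exists a complex Lie algebra $\mathfrak{g}$ of the same dimension as $\mathfrak{n}$ such that $\mathfrak{g}\not\simeq\mathfrak{n}$ and $\mathfrak{g}\rightarrow_{\deg}\mathfrak{n}$.
   Context: All Lie algebras are finite-dimensional over $\mathbb{C}$. Let $\mathcal{L}_n\subseteq\mathbb{C}^{n^3}$ be the algebraic variety of Lie brackets $\mu$ on $\mathbb{C}^n$ (identified with their structure constants). A Lie algebra $(\mathbb{C}^n,\mu)$ is identified with its bracket $\mu$. The group $GL_n(\mathbb{C})$ acts on $\mathcal{L}_n$ by $g\cdot\mu(x,y)=g(\mu(g^{-1}x,g^{-1}y))$, and the orbit $\mathcal{O}(\mu)$ is the isomorphism class of $\mu$. A Lie algebra $\mu$ degenerates to a Lie algebra $\lambda$ (both in $\mathcal{L}_n$), written $\mu\rightarrow_{\deg}\lambda$, if $\lambda\in\overline{\mathcal{O}(\mu)}$, the Zariski closure of the orbit (which coincides with its closure in the usual topology of $\mathbb{C}^{n^3}$); one also says that $\lambda$ is the degeneration of $\mu$.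
   Formalization: The formal theorem assumes 2 ≤ dimension ≤ 7: in dimensions 0 and 1 the only Lie algebra is the abelian one, so no non-isomorphic Lie algebra of the same dimension exists and the claim fails there. *)

(* Defs.v *)
From HB Require Import structures.
From mathcomp Require Import all_boot all_order all_algebra.
From mathcomp Require Import mpoly.
Set Implicit Arguments.
Unset Strict Implicit.
Unset Printing Implicit Defensive.
Import GRing.Theory.
Local Open Scope ring_scope.

(* A point of the affine space K^(n^3); mu (i, j, k) is the coefficient of    *)
(* e_k in mu(e_i, e_j).                                                       *)
Definition strconst (K : fieldType) (n : nat) : Type :=
  {ffun 'I_n * 'I_n * 'I_n -> K}.

Section LieBrackets.
Variables (K : fieldType) (n : nat).
Implicit Types (mu lambda : strconst K n) (x y z : 'cV[K]_n) (g : 'M[K]_n).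
Implicit Types (U V W : {vspace 'cV[K]_n}).

Definition bracket mu x y : 'cV[K]_n :=
  \col_k \sum_i \sum_j x i 0 * y j 0 * mu (i, j, k).

Definition is_lie mu : Prop :=
  (forall x, bracket mu x x = 0) /\
  (forall x y z, bracket mu x (bracket mu y z) + bracket mu y (bracket mu z x)
                 + bracket mu z (bracket mu x y) = 0).

(* The span of all mu(x, y) with x in U and y in V (see bracketvP); the       *)
(* definition follows that of the product of subspaces in falgebra.           *)
Definition bracketv mu U V : {vspace 'cV[K]_n} :=
  <<[seq bracket mu x y | x <- vbasis U, y <- vbasis V]>>%VS.

Definition lower_central mu (k : nat) : {vspace 'cV[K]_n} :=
  iter k (bracketv mu fullv) fullv.

Definition nilpotent_lie mu : Prop := exists k, lower_central mu k = 0%VS.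

Definition lie_isomorphic mu lambda : Prop :=
  exists2 g, g \in unitmx &
    forall x y, g *m bracket mu x y = bracket lambda (g *m x) (g *m y).

Definition gl_act g mu : strconst K n :=
  [ffun t : 'I_n * 'I_n * 'I_n => let: (i, j, k) := t in
     (g *m bracket mu (invmx g *m delta_mx i 0) (invmx g *m delta_mx j 0)) k 0].

Definition orbit mu (nu : strconst K n) : Prop :=
  exists2 g, g \in unitmx & nu = gl_act g mu.

End LieBrackets.

(* The polynomial functions on K^I are those of {mpoly K[#|I|]}, the          *)
(* variables being matched with I by enum_val.                                *)
Definition zariski_closure (K : fieldType) (I : finType)
    (A : {ffun I -> K} -> Prop) (a : {ffun I -> K}) : Prop :=
  forall p : {mpoly K[#|I|]},
    (forall b, A b -> p.@[fun i => b (enum_val i)] = 0) ->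
    p.@[fun i => a (enum_val i)] = 0.

Definition degenerates (K : fieldType) (n : nat) (mu lambda : strconst K n) :=
  zariski_closure (orbit mu) lambda.

Section Sanity.
Variables (K : fieldType) (n : nat).
Implicit Types (mu lambda : strconst K n) (x y z : 'cV[K]_n) (g : 'M[K]_n).
Implicit Types (U V W : {vspace 'cV[K]_n}).

Lemma bracket_is_linearr mu x : linear (bracket mu x).
Proof.
move=> a y z; apply/colP=> k; rewrite !mxE mulr_sumr -big_split /=.
apply: eq_bigr => i _; rewrite mulr_sumr -big_split /=.
by apply: eq_bigr => j _; rewrite !mxE mulrDr mulrDl !mulrA [a * _]mulrC.
Qed.

Lemma bracket_is_linearl mu y : linear (bracket mu ^~ y).
Proof.
move=> a x z; apply/colP=> k; rewrite !mxE mulr_sumr -big_split /=.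
apply: eq_bigr => i _; rewrite mulr_sumr -big_split /=.
by apply: eq_bigr => j _; rewrite !mxE !mulrDl !mulrA.
Qed.

HB.instance Definition _ mu x :=
  GRing.isLinear.Build K 'cV[K]_n 'cV[K]_n _ (bracket mu x)
    (bracket_is_linearr mu x).

Lemma bracket_delta mu i j k :
  bracket mu (delta_mx i 0) (delta_mx j 0) k 0 = mu (i, j, k).
Proof.
rewrite mxE (bigD1 i) //= (bigD1 j) //= !mxE !eqxx !mul1r.
rewrite big1 => [|j' /negPf nj]; last by rewrite !mxE nj mulr0 mul0r.
rewrite addr0 big1 ?addr0 // => i' /negPf ni.
by rewrite big1 // => j' _; rewrite !mxE ni !mul0r.
Qed.

Lemma bracket_suml mu I (r : seq I) (P : pred I) (F : I -> 'cV[K]_n) y :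
  bracket mu (\sum_(i <- r | P i) F i) y = \sum_(i <- r | P i) bracket mu (F i) y.
Proof.
pose f := GRing.isLinear.Build K 'cV[K]_n 'cV[K]_n _ _ (bracket_is_linearl mu y).
pose L : {linear 'cV[K]_n -> 'cV[K]_n} := HB.pack (bracket mu ^~ y) f.
exact: (raddf_sum L).
Qed.

Lemma bracketZl mu a x y : bracket mu (a *: x) y = a *: bracket mu x y.
Proof.
apply/colP=> k; rewrite !mxE mulr_sumr; apply: eq_bigr => i _.
by rewrite mulr_sumr; apply: eq_bigr => j _; rewrite !mxE !mulrA.
Qed.

Lemma bracketvP mu U V W :
  reflect (forall x y, x \in U -> y \in V -> bracket mu x y \in W)
          (bracketv mu U V <= W)%VS.
Proof.
apply: (iffP idP) => [/span_subvP sW x y xU yV | H]; last first.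
  apply/span_subvP => _ /allpairsP[[x y] /= [xU yV ->]].
  by apply: H; apply: vbasis_mem.
rewrite (coord_vbasis xU) (coord_vbasis yV) bracket_suml.
apply: memv_suml => i _; rewrite linear_sum; apply: memv_suml => j _.
rewrite linearZ /= bracketZl !memvZ //; apply: sW.
by apply/allpairsP; exists ((vbasis U)`_i, (vbasis V)`_j);
  rewrite /= !mem_nth ?size_tuple.
Qed.

Lemma bracket_expand mu x y :
  bracket mu x y = \sum_i \sum_j (x i 0 * y j 0) *:
    bracket mu (delta_mx i 0) (delta_mx j 0).
Proof.
apply/colP=> k; rewrite mxE summxE; apply: eq_bigr => i _.
by rewrite summxE; apply: eq_bigr => j _; rewrite [RHS]mxE bracket_delta.
Qed.

Lemma gl_actE g mu x y :
  bracket (gl_act g mu) x y = g *m bracket mu (invmx g *m x) (invmx g *m y).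
Proof.
have Ed v : v = \sum_i v i 0 *: delta_mx i 0 :> 'cV[K]_n.
  by rewrite {1}[v]matrix_sum_delta; apply: eq_bigr => i _; rewrite big_ord1.
rewrite bracket_expand {2}(Ed x) {2}(Ed y) !mulmx_sumr bracket_suml mulmx_sumr.
apply: eq_bigr => i _; rewrite linear_sum mulmx_sumr; apply: eq_bigr => j _.
rewrite -!scalemxAr /= bracketZl !linearZ /= !linearZ /= scalerA [y j 0 * _]mulrC.
congr (_ *: _).
by apply/colP=> k; rewrite bracket_delta ffunE.
Qed.

Lemma orbit_lie_isomorphic mu lambda :
  orbit mu lambda <-> lie_isomorphic mu lambda.
Proof.
split=> [[g gU ->] | [g gU H]]; exists g => //.
  by move=> x y; rewrite gl_actE !mulKmx.
apply/ffunP=> -[[i j] k]; rewrite ffunE H !mulKVmx //.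
by rewrite bracket_delta.
Qed.

End Sanity.

(* Main.v *)
(* Suppose that n has a basis x, v_1, ..., v_m where the span h of the v_i
   is an ideal graded by nonnegative weights of the v_i, not all zero, and
   where ad x strictly raises weights.  Let D multiply v_i by its weight, a
   derivation of h.  For t <> 0 the derivation ad x + t D has the eigenvalues
   of t D, and is conjugate to it by an automorphism of h, so that the
   semidirect product of h by ad x + t D is isomorphic to the one by D, which
   is not nilpotent; it tends to n when t tends to 0.

   It remains to find such bases in dimension at most 7.  If [n,n] is abelian,
   take a maximal abelian ideal a containing it: n/a acts faithfully on a by
   commuting nilpotent operators.  Codimension at most 2 is handled by Jordan
   chains of ad y adapted to ad x; otherwise dim a <= 4, and one discusses the
   largest k for which some (ad x)^k is nonzero on a.  If [n,n] is not abelian,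
   then dim [n,n] >= 4, [n,[n,n]] has codimension 1 in [n,n], and the Jacobi
   identity leaves four families of multiplication tables. *)
Require Import Defs.
From HB Require Import structures.
From mathcomp Require Import all_boot all_order all_algebra.
From mathcomp Require Import mpoly.
From mathcomp Require Import reals complex.
From mathcomp Require boolp.
From mathcomp Require Import ring zify.
Set Implicit Arguments.
Unset Strict Implicit.
Unset Printing Implicit Defensive.
Import GRing.Theory Num.Theory.
Local Open Scope ring_scope.

(** Why only a hyperplane ideal is graded: a nontrivial grading of the whole algebra would give a
    non-nilpotent derivation, and in dimension 7 there are nilpotent Lie algebras all of whose
    derivations are nilpotent. Letting [ad x] merely raise weights absorbs the inhomogeneous
    structure constants.

    The weights in the tables are not canonical. They are some solution in natural numbers of the
    additive equations imposed by the products inside the ideal and of the strict inequalities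
    imposed by [ad x]. The changes of basis before a table remove the products that would make this
    system unsolvable.

    Up to the last statement the field is any [numFieldType]: the nonzero eigenvalues that matter
    are weights, the others vanish by nilpotency, and divisions are by 2, by differences of weights
    or by scalars shown to be nonzero. *)

Section Brackets.
Variables (K : fieldType) (n : nat).
Implicit Types (mu lam : strconst K n) (x y z : 'cV[K]_n).

Lemma cvD x y i : (x + y) i 0 = x i 0 + y i 0. Proof. by rewrite mxE. Qed.
Lemma cvN x i : (- x) i 0 = - x i 0. Proof. by rewrite mxE. Qed.
Lemma cvZ a x i : (a *: x) i 0 = a * x i 0. Proof. by rewrite mxE. Qed.
Lemma cv0 i : (0 : 'cV[K]_n) i 0 = 0. Proof. by rewrite mxE. Qed.
Definition cvE := (cvD, cvN, cvZ, cv0).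

Lemma bracketDr lam x y z : bracket lam x (y + z) = bracket lam x y + bracket lam x z.
Proof. by rewrite linearD. Qed.

Lemma bracketDl lam x y z : bracket lam (x + y) z = bracket lam x z + bracket lam y z.
Proof. by have := bracket_is_linearl lam z 1 x y; rewrite !scale1r. Qed.

Lemma bracketZr lam a x y : bracket lam x (a *: y) = a *: bracket lam x y.
Proof. by rewrite linearZ. Qed.

Lemma bracketNr lam x y : bracket lam x (- y) = - bracket lam x y.
Proof. by rewrite linearN. Qed.

Lemma bracketNl lam x y : bracket lam (- x) y = - bracket lam x y.
Proof. by rewrite -scaleN1r bracketZl scaleN1r. Qed.

Lemma bracketBr lam x y z : bracket lam x (y - z) = bracket lam x y - bracket lam x z.
Proof. by rewrite bracketDr bracketNr. Qed.

Lemma bracketBl lam x y z : bracket lam (x - y) z = bracket lam x z - bracket lam y z.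
Proof. by rewrite bracketDl bracketNl. Qed.

Lemma bracket0r lam x : bracket lam x 0 = 0.
Proof. by rewrite linear0. Qed.

Lemma bracket0l lam x : bracket lam 0 x = 0.
Proof. by have := bracketZl lam 0 0 x; rewrite !scale0r. Qed.

Lemma col_sum_delta x : x = \sum_i x i 0 *: delta_mx i 0.
Proof.
by rewrite {1}[x]matrix_sum_delta; apply: eq_bigr => i _; rewrite big_ord1.
Qed.

Lemma bracket_sumr lam I (r : seq I) (Q : pred I) (F : I -> 'cV[K]_n) x :
  bracket lam x (\sum_(i <- r | Q i) F i) = \sum_(i <- r | Q i) bracket lam x (F i).
Proof. by rewrite linear_sum. Qed.

Lemma bracket_affine lam (delta : strconst K n) t x y :
  bracket [ffun c => lam c + t * delta c] x y =
  bracket lam x y + t *: bracket delta x y.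
Proof.
apply/colP => k; rewrite !mxE mulr_sumr -big_split /=.
apply: eq_bigr => i _; rewrite mulr_sumr -big_split /=; apply: eq_bigr => j _.
by rewrite ffunE mulrDr; congr (_ + _); rewrite mulrCA.
Qed.

Definition bilinear_strconst (M : 'cV[K]_n -> 'cV[K]_n -> 'cV[K]_n) : strconst K n :=
  [ffun t : 'I_n * 'I_n * 'I_n =>
     M (delta_mx t.1.1 0) (delta_mx t.1.2 0) t.2 0].

Lemma bilinear_strconstE M x y :
  (forall y, linear (M ^~ y)) -> (forall x, linear (M x)) ->
  bracket (bilinear_strconst M) x y = M x y.
Proof.
move=> Ml Mr.
pose L z : {linear _ -> _} :=
  HB.pack (M ^~ z) (GRing.isLinear.Build K 'cV[K]_n 'cV[K]_n _ _ (Ml z)).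
pose R z : {linear _ -> _} :=
  HB.pack (M z) (GRing.isLinear.Build K 'cV[K]_n 'cV[K]_n _ _ (Mr z)).
rewrite bracket_expand [in RHS](col_sum_delta x) -[RHS]/(L y _) linear_sum.
apply: eq_bigr => i _; rewrite linearZ /= -[M _ y]/(R _ y).
rewrite [in RHS](col_sum_delta y) linear_sum scaler_sumr.
apply: eq_bigr => j _; rewrite linearZ /= scalerA; congr (_ *: _).
by apply/colP => k; rewrite bracket_delta ffunE.
Qed.

Lemma lie_bracketC lam x y : is_lie lam -> bracket lam x y = - bracket lam y x.
Proof.
move=> [alt _]; apply/eqP; rewrite -addr_eq0; apply/eqP.
by have := alt (x + y); rewrite bracketDl !bracketDr !alt add0r addr0.
Qed.

Lemma jacobi_derivation lam x y z : is_lie lam ->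
  bracket lam x (bracket lam y z) =
  bracket lam (bracket lam x y) z + bracket lam y (bracket lam x z).
Proof.
move=> hl; have [_ /(_ x y z) J] := hl.
rewrite (lie_bracketC (bracket lam x y)) // [bracket lam x z]lie_bracketC //.
by rewrite bracketNr -opprD; apply/eqP; rewrite -addr_eq0 [X in _ + X]addrC addrA J.
Qed.

End Brackets.

Ltac vec_ring := apply/colP => ?; rewrite !cvE; ring.

(** * Deformations attached to a weighted basis *)

Section WeightedCoordinates.
Variables (K : numFieldType) (m : nat) (lam : strconst K m.+1).
Variable (w : 'I_m.+1 -> nat).
Hypothesis lie_lam : is_lie lam.
Hypothesis w0 : w ord0 = 0%N.
Hypothesis graded : forall i j k, i != ord0 -> j != ord0 ->
  lam (i, j, k) != 0 -> (k != ord0) && (w k == w i + w j)%N.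
Hypothesis raising : forall j k,
  lam (ord0, j, k) != 0 -> (k != ord0) && (w j < w k)%N.

Local Notation vec := 'cV[K]_m.+1.
Implicit Types (u v : vec) (Q : pred nat).

(** [e0] is the vector x of the overview. [f] and [P] split a vector into its coordinate along [e0]
    and its part in the ideal; [D] kills [e0] because [w ord0 = 0], so it does not distinguish a
    vector from its projection. *)
Let e0 : vec := delta_mx ord0 0.
Let D v : vec := \col_i ((w i)%:R * v i 0).
Let P v : vec := \col_i (if i == ord0 then 0 else v i 0).
Let f v : K := v ord0 0.

Let D_linear : linear D.
Proof. by move=> a u v; apply/colP => i; rewrite !mxE mulrDr mulrCA. Qed.

Let P_linear : linear P.
Proof.
by move=> a u v; apply/colP => i; rewrite !mxE; case: eqP; rewrite ?mulr0 ?addr0.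
Qed.

Let f_linear a u v : f (a *: u + v) = a * f u + f v.
Proof. by rewrite /f !mxE. Qed.

Let fD v : f (D v) = 0.
Proof. by rewrite /f mxE w0 mul0r. Qed.

Let bracket_coord u v k : bracket lam u v k 0 != 0 ->
  exists i j, [/\ u i 0 != 0, v j 0 != 0 & lam (i, j, k) != 0].
Proof.
move=> uvk.
have [|H] := pickP (fun p => [&& u p.1 0 != 0, v p.2 0 != 0 & lam (p.1, p.2, k) != 0]).
  by case=> i j /and3P[ui vj l]; exists i, j.
case/eqP: uvk; rewrite mxE big1 // => i _; rewrite big1 // => j _.
apply/eqP; move: (H (i, j)) => /= /negbT; rewrite !negb_and !negbK !mulf_eq0.
by case/or3P => ->; rewrite ?orbT.
Qed.

Let supp Q v := forall i, v i 0 != 0 -> (i != ord0) && Q (w i).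

Let suppS Q Q' v : subpred Q Q' -> supp Q v -> supp Q' v.
Proof. by move=> QQ' H i /H /andP[-> /QQ']. Qed.

Let suppD Q u v : supp Q u -> supp Q v -> supp Q (u + v).
Proof.
move=> Hu Hv i; rewrite mxE; have [u0|/Hu //] := eqVneq (u i 0) 0.
by rewrite u0 add0r => /Hv.
Qed.

Let suppZ Q a v : supp Q v -> supp Q (a *: v).
Proof. by move=> Hv i; rewrite mxE mulf_eq0 negb_or => /andP[_ /Hv]. Qed.

Let suppB Q u v : supp Q u -> supp Q v -> supp Q (u - v).
Proof. by move=> Hu Hv; rewrite -scaleN1r; apply/suppD/suppZ. Qed.

Let supp_ord0 Q v : supp Q v -> v ord0 0 = 0.
Proof. by move=> Hv; apply/eqP; apply: contraT => /Hv; rewrite eqxx. Qed.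

Let supp_bracket Q Q1 Q2 u v : (forall a b, Q1 a -> Q2 b -> Q (a + b)%N) ->
  supp Q1 u -> supp Q2 v -> supp Q (bracket lam u v).
Proof.
move=> HQ Hu Hv k /bracket_coord[i [j [/Hu/andP[i0 Qi] /Hv/andP[j0 Qj] l]]].
by case/andP: (graded i0 j0 l) => -> /eqP ->; apply: HQ.
Qed.

Let supp_raise Q Q1 v : (forall a b, Q1 a -> (a < b)%N -> Q b) ->
  supp Q1 v -> supp Q (bracket lam e0 v).
Proof.
move=> HQ Hv k /bracket_coord[i [j [e0i /Hv/andP[j0 Qj] l]]].
have ei : i = ord0 by apply: contraNeq e0i => /negPf ni; rewrite mxE ni.
by move: l; rewrite ei => /raising/andP[-> /HQ]; apply.
Qed.

Let derivD u v : f u = 0 -> f v = 0 ->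
  D (bracket lam u v) = bracket lam (D u) v + bracket lam u (D v).
Proof.
move=> fu fv; apply/colP => k; rewrite !mxE mulr_sumr -big_split /=.
apply: eq_bigr => i _; rewrite mulr_sumr -big_split /=; apply: eq_bigr => j _.
rewrite !mxE.
have [->|i0] := eqVneq i ord0; first by rewrite -/(f u) fu; ring.
have [->|j0] := eqVneq j ord0; first by rewrite -/(f v) fv; ring.
have [->|l] := eqVneq (lam (i, j, k)) 0; first by ring.
by have /andP[_ /eqP ->] := graded i0 j0 l; rewrite natrD; ring.
Qed.

Let bracketPP u v : f (bracket lam (P u) (P v)) = 0.
Proof.
apply/eqP; apply: contraT => /bracket_coord[i [j [Pu Pv l]]].
have nz x l' : P x l' 0 != 0 -> l' != ord0.
  by rewrite mxE; case: (l' =P ord0) => //; rewrite eqxx.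
by have /andP[/eqP] := graded (nz _ _ Pu) (nz _ _ Pv) l.
Qed.

Let fP v : f (P v) = 0.
Proof. by rewrite /f mxE eqxx. Qed.

Let P_id v : f v = 0 -> P v = v.
Proof. by move=> fv; apply/colP => i; rewrite mxE; case: eqP => // ->. Qed.

(** The bracket of the semidirect product of the ideal by [D], with [e0] as acting element. *)
Let M u v := bracket lam (P u) (P v) + f u *: D v - f v *: D u.
Let mu := bilinear_strconst M.

Let muE u v : bracket mu u v = M u v.
Proof.
apply: bilinear_strconstE => [z a x y|z a x y].
  rewrite /M P_linear D_linear f_linear bracketDl bracketZl.
  by vec_ring.
rewrite /M P_linear D_linear f_linear bracketDr bracketZr.
by vec_ring.
Qed.

Let mu_lie : is_lie mu.
Proof.
have [alt jac] := lie_lam.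
split=> [x|x y z]; rewrite !muE; first by rewrite /M alt add0r subrr.
have fM u v : f (M u v) = 0.
  by rewrite /f /M !cvE -!/(f _) bracketPP !fD; ring.
have PM u v : P (M u v) = M u v by apply: P_id; apply: fM.
have DP u : D (P u) = D u.
  by apply/colP => i; rewrite !mxE; case: eqP => // ->; rewrite w0 !mul0r.
have DM u v : D (M u v) =
    f u *: D (D v) - f v *: D (D u) - bracket lam (P v) (D u) + bracket lam (P u) (D v).
  have := derivD (fP u) (fP v); rewrite !DP (lie_bracketC (D u)) // => dP.
  have DD a b : D (a + b) = D a + D b by apply/colP => i; rewrite !mxE; ring.
  have DZ a b : D (a *: b) = a *: D b by apply/colP => i; rewrite !mxE; ring.
  by rewrite /M -scaleNr !DD !DZ dP; vec_ring.
(* [M u v] lies in the ideal, so the outer bracket has no [f (M u v)] term. In the cyclic sum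
   everything cancels except the Jacobi sum of [lam] on the projections. *)
have ME x' u v : M x' (M u v) = bracket lam (P x') (bracket lam (P u) (P v))
    + f u *: bracket lam (P x') (D v) - f v *: bracket lam (P x') (D u)
    + f x' *: (f u *: D (D v) - f v *: D (D u) - bracket lam (P v) (D u)
              + bracket lam (P u) (D v)).
  rewrite {1}/M fM scale0r subr0 DM PM {1}/M bracketBr bracketDr !bracketZr.
  by vec_ring.
by rewrite !ME -[RHS](jac (P x) (P y) (P z)); vec_ring.
Qed.

(* The semidirect product and the deformations differ only by the action of
   [e0] on the ideal: [D] for [mu], and a multiple of [D'] for the latter. *)
Let delta := bilinear_strconst (fun u v => f u *: D v - f v *: D u).

Let deltaE u v : bracket delta u v = f u *: D v - f v *: D u.
Proof.
apply: bilinear_strconstE => [z a x y|z a x y]; rewrite D_linear f_linear.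
  by vec_ring.
by vec_ring.
Qed.

Let e_ (j : 'I_m.+1) : vec := delta_mx j 0.

Let De j : D (e_ j) = (w j)%:R *: e_ j.
Proof.
apply/colP => i; rewrite !mxE; case: (i =P j) => [->|_] //=.
by rewrite !mulr0.
Qed.

Section Conjugation.
Variables (s t : K).
Hypothesis st : s * t = 1.

(** The action of [s *: e0] on the ideal in the bracket deformed by [t]: as [s * t = 1], the summand
    [t D] turns into [D]. *)
Let D' v := D v + s *: bracket lam e0 v.

Let D'_linear : linear D'.
Proof. by move=> a u v; rewrite /D' D_linear bracketDr bracketZr; vec_ring. Qed.

Let D'0 : D' 0 = 0.
Proof. by have := D'_linear (-1) 0 0; rewrite scaler0 addr0 scaleN1r addNr. Qed.

Let D'Z a v : D' (a *: v) = a *: D' v.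
Proof. by have := D'_linear a v 0; rewrite D'0 !addr0. Qed.

Let D'B u v : D' (u - v) = D' u - D' v.
Proof. by have := D'_linear (-1) v u; rewrite !scaleN1r ![- _ + _]addrC. Qed.

Let gt k := supp (fun l => (k < l)%N).

Let gt_max k v : (\max_i w i <= k)%N -> gt k v -> v = 0.
Proof.
move=> kM Hv; apply/colP => i; rewrite mxE; apply/eqP; apply: contraT => /Hv.
by rewrite ltnNge (leq_trans _ kM) ?andbF // (leq_bigmax i).
Qed.

(** On weights above [k], [D'] is triangular with the weights on its diagonal, all different from
    [k]; the component of lowest weight vanishes first, and so on upwards. *)
Let D'_uniq k v : gt k v -> D' v = k%:R *: v -> v = 0.
Proof.
move=> Hv Dv; suff H l : gt (k + l) v.
  by apply: (gt_max _ (H (\max_i w i)%N)); apply: leq_addl.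
elim: l => [|l IHl]; first by rewrite addn0.
move=> i vi; have /andP[i0 kl] := IHl i vi; rewrite i0 /=.
rewrite addnS ltn_neqAle kl andbT; apply: contra vi => /eqP wi.
have /colP/(_ i) := Dv; rewrite !cvE [D v i 0]mxE.
have -> : bracket lam e0 v i 0 = 0.
  apply/eqP; apply: contraT => nz.
  have : supp (fun b => (k + l).+1 < b)%N (bracket lam e0 v).
    by apply: supp_raise IHl => a b; apply: leq_ltn_trans.
  by move=> /(_ i nz); rewrite -wi ltnn andbF.
rewrite mulr0 addr0 => /eqP; rewrite -subr_eq0 -mulrBl mulf_eq0.
rewrite subr_eq0 eqr_nat -wi => /orP[/eqP e|//].
by have := leq_addr l k; rewrite -ltnS e ltnn.
Qed.

(** Inverting the diagonal part of [D' - k] leaves an error of higher weight. The induction variable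
    [d] bounds the weights that remain. *)
Let D'_solve k v : gt k v -> exists2 u, gt k u & D' u - k%:R *: u = v.
Proof.
suff H d : forall l v, (k <= l)%N -> (\max_i w i <= l + d)%N -> gt l v ->
    exists2 u, gt k u & D' u - k%:R *: u = v.
  by move=> Hv; apply: (H (\max_i w i)%N k) => //; apply: leq_addl.
elim: d => [|d IHd] l {}v kl lM Hv.
  exists 0; first by move=> i; rewrite mxE eqxx.
  by rewrite addn0 in lM; rewrite (gt_max lM Hv) D'0 scaler0 subr0.
pose u0 : vec := \col_i (v i 0 / ((w i)%:R - k%:R)).
have gu0 : gt l u0.
  by move=> i; rewrite mxE mulf_eq0 negb_or => /andP[/Hv].
have [||u1 gu1 Eu1] := IHd l.+1 (- (s *: bracket lam e0 u0)) (leqW kl).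
- by rewrite addSnnS.
- rewrite -scaleNr; apply: suppZ; apply: supp_raise gu0 => a b.
  exact: leq_ltn_trans.
exists (u0 + u1).
  by apply: suppD gu1; apply: suppS gu0 => a; apply: leq_ltn_trans.
have -> : D' (u0 + u1) = D' u0 + D' u1 by have := D'_linear 1 u0 u1; rewrite !scale1r.
rewrite scalerDr opprD addrACA Eu1 /D'.
suff -> : v = D u0 - k%:R *: u0 by vec_ring.
apply/colP => i; rewrite !cvE !mxE.
have [->|vi] := eqVneq (v i 0) 0; first by rewrite mul0r !mulr0 subr0.
rewrite -mulrBl mulrCA divff ?mulr1 // subr_eq0 eqr_nat.
have /andP[_ lw] := Hv i vi; apply: contraTneq lw => ->; by rewrite -leqNgt.
Qed.

Let supp_e j : j != ord0 -> supp (pred1 (w j)) (e_ j).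
Proof.
move=> j0 i; rewrite mxE; case: (i =P j) => [->|_] /=; last by rewrite eqxx.
by rewrite j0 eqxx.
Qed.

(** The condition on [j] stands inside the existential so that finite choice yields a function on
    all indices; its value at [ord0] is a dummy. *)
Let eigenvector j : exists v, j != ord0 ->
  gt (w j) (v - e_ j) /\ D' v = (w j)%:R *: v.
Proof.
have [->|j0] := eqVneq j ord0; first by exists 0.
have [|u gu Eu] := @D'_solve (w j) (s *: bracket lam e0 (e_ j)).
  by apply: suppZ; apply: supp_raise (supp_e j0) => a b /eqP ->.
exists (e_ j - u) => _; split.
  by rewrite addrAC subrr add0r -scaleN1r; apply: suppZ.
rewrite D'B {1}/D' De -Eu; vec_ring.
Qed.

(** The isomorphism sends [e0] to [s *: e0] and [e_ j] to the eigenvector of [D'] with leading term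
    [e_ j]. On the ideal it respects brackets because an eigenvector of [D'] is determined by its
    eigenvalue and leading term. *)
Lemma weighted_isomorphism :
  lie_isomorphic mu [ffun c => lam c + t * delta c].
Proof.
have [phi phiP] := fin_all_exists eigenvector.
pose G : 'M[K]_m.+1 := \matrix_(i, j) (if j == ord0 then s * (i == ord0)%:R else phi j i 0).
have GE i j : G i j = if j == ord0 then s * (i == ord0)%:R else phi j i 0.
  by rewrite mxE.
have s0 : s != 0 by apply: contra_eq_neq st => ->; rewrite mul0r eq_sym oner_eq0.
have G0 : G *m e_ ord0 = s *: e0.
  by apply/colP => i; rewrite -colE !mxE eqxx andbT.
have Ge j : j != ord0 -> G *m e_ j = phi j.
  by move=> /negPf j0; apply/colP => i; rewrite -colE !mxE j0.
have lamtE u v : bracket [ffun c => lam c + t * delta c] u v =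
    bracket lam u v + t *: (f u *: D v - f v *: D u).
  by rewrite bracket_affine deltaE.
have phi_gt j : j != ord0 -> gt (w j) (phi j - e_ j) by move=> /phiP[].
have phi_eig j : j != ord0 -> D' (phi j) = (w j)%:R *: phi j by move=> /phiP[].
have phi_ge j : j != ord0 -> supp (fun l => w j <= l)%N (phi j).
  move=> j0; rewrite -[phi j](subrK (e_ j)); apply: suppD.
    by apply: suppS (phi_gt _ j0) => a; apply: ltnW.
  by apply: suppS (supp_e j0) => a /eqP ->.
have f_phi j : j != ord0 -> f (phi j) = 0 by move/phi_ge/supp_ord0.
(* Apart from its column [s *: e0], [G] is unitriangular for the weight filtration, so the
   coordinates of a kernel vector vanish in order of increasing weight. *)
have GU : G \in unitmx.
  rewrite -unitmx_tr -row_free_unit -kermx_eq0; apply/rowV0P => r /sub_kermxP rG.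
  pose v := r^T; have Gv : G *m v = 0 by rewrite -[G]trmxK -trmx_mul rG trmx0.
  suff v0 : v = 0 by rewrite -[r]trmxK -/v v0 trmx0.
  have v00 : v ord0 0 = 0.
    have /colP/(_ ord0) := Gv; rewrite [RHS]mxE mxE (bigD1 ord0) //= big1.
      rewrite GE !eqxx addr0 mulr1 => /eqP; rewrite mulf_eq0 (negPf s0) /=.
      by move/eqP.
    move=> j /negPf j0; rewrite GE j0.
    by rewrite (supp_ord0 (phi_ge _ (negbT j0))) mul0r.
  have vi k i : (w i < k)%N -> v i 0 = 0.
    elim: k i => // k IHk i wk; have [->//|i0] := eqVneq i ord0.
    have /colP/(_ i) := Gv; rewrite [RHS]mxE mxE (bigD1 i) //= big1; last first.
      move=> j ji; rewrite GE; have [->|j0] := eqVneq j ord0.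
        by rewrite v00 mulr0.
      have [->|nz] := eqVneq (phi j i 0) 0; first by rewrite mul0r.
      rewrite (IHk j) ?mulr0 //.
      have := phi_gt _ j0 i; rewrite !cvE [e_ j i 0]mxE [i == j]eq_sym (negPf ji) subr0.
      by move=> /(_ nz)/andP[_ ji']; apply: leq_trans ji' _; rewrite -ltnS.
    rewrite addr0 GE (negPf i0); suff -> : phi i i 0 = 1 by rewrite mul1r.
    have := phi_gt _ i0 i; rewrite !cvE [e_ i i 0]mxE !eqxx ltnn andbF subr_eq0.
    by case: eqP => // _ /(_ isT).
  by apply/colP => i; rewrite (vi (w i).+1) ?mxE.
have Gsum v : G *m v = \sum_i v i 0 *: (G *m e_ i).
  rewrite {1}[v]col_sum_delta mulmx_sumr; apply: eq_bigr => i _.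
  by rewrite -scalemxAr.
have D'D u v : D' (u + v) = D' u + D' v by have := D'_linear 1 u v; rewrite !scale1r.
have G_homog k v : supp (pred1 k) v -> D' (G *m v) = k%:R *: (G *m v) /\ gt k (G *m v - v).
  move=> Hv; split.
    rewrite Gsum; elim/big_ind: _ => [|u1 u2 E1 E2|i _].
    - by rewrite D'0 scaler0.
    - by rewrite D'D E1 E2 scalerDr.
    rewrite D'Z; have [->|/Hv/andP[i0 /eqP <-]] := eqVneq (v i 0) 0.
      by rewrite !scale0r scaler0.
    by rewrite Ge // phi_eig // !scalerA mulrC.
  rewrite Gsum [X in _ - X]col_sum_delta -sumrB; elim/big_ind: _ => [|u1 u2 E1 E2|i _].
  - by move=> i; rewrite mxE eqxx.
  - exact: suppD.
  rewrite -scalerBr; have [->|/Hv/andP[i0 /eqP <-]] := eqVneq (v i 0) 0.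
    by rewrite scale0r => j; rewrite mxE eqxx.
  by rewrite Ge //; apply: suppZ; apply: phi_gt.
have derivD' u v : f u = 0 -> f v = 0 ->
    D' (bracket lam u v) = bracket lam (D' u) v + bracket lam u (D' v).
  move=> fu fv; rewrite /D' derivD // jacobi_derivation // bracketDl bracketDr.
  by rewrite bracketZl bracketZr; vec_ring.
have basis i j : G *m bracket mu (e_ i) (e_ j) =
    bracket [ffun c => lam c + t * delta c] (G *m e_ i) (G *m e_ j).
  have fe k : k != ord0 -> f (e_ k) = 0.
    by rewrite /f mxE eq_sym => /negPf ->.
  have fe0 : f (e_ ord0) = 1 by rewrite /f mxE !eqxx.
  have [alt _] := mu_lie; have [alt' _] := lie_lam.
  have E0 k : k != ord0 -> G *m bracket mu (e_ ord0) (e_ k) =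
      bracket [ffun c => lam c + t * delta c] (G *m e_ ord0) (G *m e_ k).
    move=> k0; rewrite muE /M; have -> : P (e_ ord0) = 0.
      by apply/colP => l; rewrite !mxE; case: eqP.
    rewrite bracket0l (fe k) // scale0r subr0 add0r fe0 scale1r De -scalemxAr G0 Ge //.
    rewrite lamtE f_phi // scale0r subr0 bracketZl -phi_eig // /D'.
    have -> : f (s *: e0) = s by rewrite /f mxE -/(f _) fe0 mulr1.
    by rewrite scalerA [t * s]mulrC st scale1r addrC.
  have [->|i0] := eqVneq i ord0; have [->|j0] := eqVneq j ord0.
  - by rewrite alt mulmx0 lamtE alt' subrr scaler0 addr0.
  - exact: E0.
  - rewrite (lie_bracketC _ _ mu_lie) mulmxN E0 // !lamtE.
    by rewrite (lie_bracketC (G *m e_ i)) //; vec_ring.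
  rewrite muE /M !fe // !scale0r subr0 addr0 !P_id ?fe // !Ge // lamtE !f_phi //.
  rewrite !scale0r subrr scaler0 addr0.
  have [|E1 E2] := G_homog (w i + w j)%N (bracket lam (e_ i) (e_ j)).
    by apply: supp_bracket (supp_e i0) (supp_e j0) => a b /eqP -> /eqP ->; apply/eqP.
  (* Both sides are eigenvectors of [D'] for [w i + w j], since [D'] is a derivation of the ideal,
     and both agree with [bracket lam (e_ i) (e_ j)] up to higher weights. *)
  apply/eqP; rewrite -subr_eq0; apply/eqP; apply: (D'_uniq (k := (w i + w j)%N)).
    have -> : G *m bracket lam (e_ i) (e_ j) - bracket lam (phi i) (phi j) =
        (G *m bracket lam (e_ i) (e_ j) - bracket lam (e_ i) (e_ j)) -
        (bracket lam (phi i - e_ i) (phi j) + bracket lam (e_ i) (phi j - e_ j)).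
      by rewrite bracketBl bracketBr; vec_ring.
    apply: suppB => //; apply: suppD.
      by apply: supp_bracket (phi_gt i i0) (phi_ge j j0) => a b ? ?; rewrite -addSn leq_add.
    by apply: supp_bracket (supp_e i0) (phi_gt j j0) => a b /eqP ->; rewrite ltn_add2l.
  rewrite D'B E1 derivD' ?f_phi // !phi_eig // bracketZl bracketZr natrD.
  by vec_ring.
exists G => // x y.
rewrite bracket_expand mulmx_sumr (Gsum x) (Gsum y) bracket_suml.
apply: eq_bigr => i _; rewrite mulmx_sumr bracketZl linear_sum scaler_sumr.
by apply: eq_bigr => j _; rewrite -scalemxAr basis -scalerA -bracketZr.
Qed.

End Conjugation.

(** The eigenvector [b] is kept in the conclusion as the certificate that [mu] is not nilpotent. *)
Lemma weighted_deformation j : (0 < w j)%N ->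
  exists mu delta : strconst K m.+1, [/\ is_lie mu,
    exists a b c, [/\ c != 0, b != 0 & bracket mu a b = c *: b]
  & forall t, t != 0 -> lie_isomorphic mu [ffun c => lam c + t * delta c]].
Proof.
move=> wj; have j0 : j != ord0 by apply: contraTneq wj => ->; rewrite w0.
exists mu, delta; split; first exact: mu_lie.
  exists (e_ ord0), (e_ j), (w j)%:R; split.
  - by rewrite pnatr_eq0 -lt0n.
  - by apply: contraTneq isT => /colP/(_ j); rewrite !mxE !eqxx => /eqP; rewrite oner_eq0.
  have P0 : P (e_ ord0) = 0 by apply/colP => l; rewrite !mxE; case: eqP.
  rewrite muE /M P0 bracket0l add0r De.
  have -> : f (e_ ord0) = 1 by rewrite /f mxE !eqxx.
  have -> : f (e_ j) = 0 by rewrite /f mxE eq_sym (negPf j0).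
  by rewrite scale1r scale0r subr0.
by move=> t t0; apply: (@weighted_isomorphism t^-1); rewrite mulVf.
Qed.

End WeightedCoordinates.

(** A polynomial vanishing on the orbit restricts to a polynomial in [t] that vanishes off 0, hence
    also at 0. *)
Lemma degenerates_line (K : numFieldType) n (mu lam delta : strconst K n) :
  (forall t, t != 0 -> Defs.orbit mu [ffun c => lam c + t * delta c]) ->
  degenerates mu lam.
Proof.
move=> H p p0.
pose h (i : 'I_#|{: 'I_n * 'I_n * 'I_n}|) : {poly K} :=
  (lam (enum_val i))%:P + delta (enum_val i) *: 'X.
pose q := mmap (@polyC K) h p.
have qE t : q.[t] = p.@[fun i => [ffun c => lam c + t * delta c] (enum_val i)].
  rewrite mevalE /q /mmap horner_sum; apply: eq_bigr => k _.
  rewrite hornerM hornerC /mmap1 horner_prod; congr (_ * _); apply: eq_bigr => i _.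
  by rewrite horner_exp /h !hornerE ffunE mulrC.
have q0 : q = 0.
  (* The sample points 1, ..., [size q] are nonzero, and distinct in characteristic 0: one root more
     than a nonzero [q] could have. *)
  pose rs := [seq k.+1%:R : K | k <- iota 0 (size q)].
  apply: (@roots_geq_poly_eq0 _ q rs); last by rewrite size_map size_iota.
    apply/allP => _ /mapP[k _ ->]; rewrite rootE qE p0 //.
    by apply: H; rewrite pnatr_eq0.
  rewrite map_inj_uniq ?iota_uniq // => a b /eqP.
  by rewrite eqr_nat => /eqP[].
have := qE 0; rewrite q0 horner0 => /esym E; rewrite -[RHS]E.
by apply: meval_eq => i; rewrite ffunE mul0r addr0.
Qed.

Definition nontrivial_degeneration (K : fieldType) n (lam : strconst K n) :=
  exists mu : strconst K n,
    is_lie mu /\ ~ lie_isomorphic mu lam /\ degenerates mu lam.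

Lemma is_lie_gl_act (K : fieldType) n (g : 'M[K]_n) (lam : strconst K n) :
  g \in unitmx -> is_lie lam -> is_lie (gl_act g lam).
Proof.
move=> gU [alt jac]; split=> [x|x y z]; rewrite !gl_actE ?alt ?mulmx0 //.
by rewrite !mulKmx // -!mulmxDr jac mulmx0.
Qed.

Lemma mem_bracketv (K : fieldType) n (lam : strconst K n) (U V : {vspace 'cV[K]_n}) x y :
  x \in U -> y \in V -> bracket lam x y \in bracketv lam U V.
Proof. by move=> xU yV; apply: (bracketvP lam U V _ (subvv _)). Qed.

(** Up to the scalar [c], [b] reproduces itself under bracketing with [a], so it lies in every term
    of the lower central series. *)
Lemma nilpotent_no_eigenvector (K : fieldType) n (lam : strconst K n) a b c :
  nilpotent_lie lam -> c != 0 -> bracket lam a b = c *: b -> b = 0.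
Proof.
move=> [k Lk] c0 abE; suff : b \in lower_central lam k by rewrite Lk memv0 => /eqP.
elim: k {Lk} => [|k IHk]; first exact: memvf.
by have := mem_bracketv lam (memvf a) IHk; rewrite abE rpredZeq (negPf c0).
Qed.

Definition weight_span (K : fieldType) (vT : vectType K) (s : seq (vT * nat)) (Q : pred nat) :
  {vspace vT} := <<[seq p.1 | p <- s & Q p.2]>>%VS.

(** The basis form of the criterion: [lam] is moved to the basis [x :: map fst s], deformed there
    and moved back. Asking only for pairs [i < j] halves the later verifications; antisymmetry
    supplies the rest. *)
Lemma weighted_basis_degeneration (K : numFieldType) n (lam : strconst K n)
    (x : 'cV[K]_n) (s : seq ('cV[K]_n * nat)) (x0 := (0, 0%N) : 'cV[K]_n * nat) :
    is_lie lam -> nilpotent_lie lam ->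
    (size s).+1 = n -> (fullv <= <<x :: map fst s>>)%VS ->
    (forall i j, (i < j < size s)%N ->
       bracket lam (nth x0 s i).1 (nth x0 s j).1 \in
         weight_span s (pred1 ((nth x0 s i).2 + (nth x0 s j).2)%N)) ->
    (forall p, p \in s -> bracket lam x p.1 \in weight_span s (fun k => (p.2 < k)%N)) ->
    has (fun p => 0 < p.2)%N s ->
  nontrivial_degeneration lam.
Proof.
case: n lam x s @x0 => // m lam x s x0 lie_lam nil_lam [szs].
move=> span_s graded raising has_weight.
set S := x :: map fst s in span_s.
have ltS k : (k < size s)%N -> (k.+1 < m.+1)%N by rewrite szs ltnS.
have szS : size S == m.+1 by rewrite /= size_map szs.
pose X := Tuple szS; pose wt (i : 'I_m.+1) := nth 0%N (0%N :: map snd s) i.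
pose B : 'M[K]_m.+1 := \matrix_(i, j) S`_j i 0.
have Bdelta j : B *m delta_mx j 0 = S`_j :> 'cV_m.+1.
  by apply/colP => i; rewrite -colE !mxE.
have BU : B \in unitmx.
  pose C : 'M[K]_m.+1 := \matrix_(i, j) coord X i (delta_mx j 0).
  suff /mulmx1_unit[] : B *m C = 1%:M by [].
  apply/matrixP => i j; have := subvP span_s _ (memvf (delta_mx j 0 : 'cV_m.+1)).
  move/(@coord_span _ _ _ X)/colP/(_ i); rewrite !mxE andbT eq_sym => ->.
  by rewrite summxE; apply: eq_bigr => k _; rewrite !mxE mulrC.
pose iB := invmx B; pose lam' := gl_act iB lam.
have iBU : iB \in unitmx by rewrite unitmx_inv.
have lie' : is_lie lam' by apply: is_lie_gl_act.
have lam'E i j k : lam' (i, j, k) = (iB *m bracket lam S`_i S`_j) k 0.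
  by rewrite -bracket_delta gl_actE /iB invmxK !Bdelta.
(* Translates membership in a weight space into the coordinate conditions of the previous
   section. *)
have span_coord (Q : pred nat) v k : v \in weight_span s Q ->
    (iB *m v) k 0 != 0 -> (k != ord0) && Q (wt k).
  rewrite /weight_span; set Y := [seq _ | _ <- _ & _].
  move/(@coord_span _ _ _ (in_tuple Y)) ->; apply: contraR => nk.
  rewrite mulmx_sumr summxE big1 // => i _; rewrite -scalemxAr mxE.
  have /mapP[p] : (in_tuple Y)`_i \in Y by apply: mem_nth.
  rewrite mem_filter => /andP[Qp ps] ->; have := ps; rewrite -index_mem => ips.
  have ips' := ltS _ ips.
  have -> : p.1 = B *m delta_mx (Ordinal ips') 0.
    by rewrite Bdelta /S /= (nth_map x0) // nth_index.
  rewrite mulKmx // !mxE andbT; case: eqP => [ek|]; last by rewrite mulr0.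
  by move: nk; rewrite ek /wt /= (nth_map x0) // nth_index // Qp.
have [alt _] := lie_lam.
have nthS i : i != ord0 -> S`_i = (nth x0 s i.-1).1 /\ wt i = (nth x0 s i.-1).2.
  case: i => [[|i] im] // _; rewrite /S /wt /=.
  by rewrite !(nth_map x0) // szs -ltnS.
have lt_s (i : 'I_m.+1) : i != ord0 -> (i.-1 < size s)%N.
  by case: i => [[|i] im] // _; rewrite szs -ltnS.
have graded' i j k : i != ord0 -> j != ord0 -> lam' (i, j, k) != 0 ->
    (k != ord0) && (wt k == wt i + wt j)%N.
  move=> i0 j0; rewrite lam'E.
  have [[-> ->] [-> ->]] := (nthS i i0, nthS j j0).
  have [ij|ji|->] := ltngtP i.-1 j.-1.
  - by apply: (@span_coord (pred1 _)); apply: graded; rewrite ij lt_s.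
  - rewrite (lie_bracketC _ _ lie_lam) addnC; apply: (@span_coord (pred1 _)).
    by rewrite memvN; apply: graded; rewrite ji lt_s.
  - by rewrite alt mulmx0 mxE eqxx.
have raising' j k : lam' (ord0, j, k) != 0 -> (k != ord0) && (wt j < wt k)%N.
  rewrite lam'E; have [->|j0] := eqVneq j ord0; first by rewrite alt mulmx0 mxE eqxx.
  have [-> ->] := nthS j j0; apply: (@span_coord (fun l => _ < l)%N).
  by apply: raising; apply: mem_nth; apply: lt_s.
have [j wj] : exists j, (0 < wt j)%N.
  have /hasP[p ps p0] := has_weight; have := ps; rewrite -index_mem => ips.
  have ips' := ltS _ ips.
  by exists (Ordinal ips'); rewrite /wt /= (nth_map x0) // nth_index.
have [mu [delta [mu_lie [a [b [c [c0 b0 abc]]]] iso]]] :=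
  weighted_deformation lie' (erefl : wt ord0 = 0%N) graded' raising' wj.
(* An isomorphism would carry the eigenvector [b] of [mu] to one of the nilpotent [lam]. *)
exists mu; split=> //; split=> [[g gU gE]|].
  have : g *m b = 0.
    by apply: (nilpotent_no_eigenvector nil_lam c0 (a := g *m a)); rewrite -gE abc -scalemxAr.
  by move/(congr1 (mulmx (invmx g))); rewrite mulKmx // mulmx0; apply/eqP.
apply: (@degenerates_line _ _ _ _ (gl_act B delta)) => t t0.
apply/orbit_lie_isomorphic; have [g gU gE] := iso t t0.
exists (B *m g) => [|y z]; first by rewrite unitmx_mul BU.
rewrite -mulmxA gE !bracket_affine !gl_actE /iB invmxK mulmxDr mulKVmx // -!mulmxA.
by rewrite !mulKmx // -scalemxAr.
Qed.

(** * Lower central series *)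

Section SubspaceTools.
Variables (K : fieldType) (vT : vectType K).
Implicit Types (U V : {vspace vT}) (X Y : seq vT).

Lemma span_trans U X Y : (U <= <<X>>)%VS -> all (fun v => v \in <<Y>>%VS) X -> (U <= <<Y>>)%VS.
Proof. by move=> UX /allP XY; apply: subv_trans UX _; apply/span_subvP. Qed.

Lemma sub_add_span U V X Y :
  (U <= <<X>> + V)%VS -> (V <= <<Y>>)%VS -> (U <= <<X ++ Y>>)%VS.
Proof. by move=> UX VY; rewrite span_cat; apply: subv_trans UX _; apply: addvS. Qed.

Lemma generators_mod U V : (V <= U)%VS ->
  exists2 X, size X = (\dim U - \dim V)%N & (U <= <<X>> + V)%VS /\ {subset X <= U}.
Proof.
move=> VU; exists (vbasis (U :\: V)).
  by rewrite size_tuple -(dimv_cap_compl U V) (capv_idPr VU) addKn.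
rewrite (span_basis (vbasisP _)) addv_diff addvSl; split=> // v /vbasis_mem.
by apply/subvP/diffvSl.
Qed.

Lemma span_codim1 U V e : (V <= U)%VS -> (\dim U <= (\dim V).+1)%N ->
  e \in U -> e \notin V -> (U <= <<[:: e]>> + V)%VS.
Proof.
move=> VU dU eU eV; rewrite span_seq1.
have sub : (<[e]> + V <= U)%VS by rewrite subv_add -memvE eU.
suff : (U == <[e]> + V)%VS by move/eqP => {1}->.
rewrite eq_sym eqEdim sub /= (leq_trans dU) // ltn_neqAle dimvS ?addvSr // andbT.
apply: contra eV => /eqP dE; have /eqP -> : (V == <[e]> + V)%VS.
  by rewrite eqEdim addvSr dE leqnn.
by apply: (subvP (addvSl _ _)); apply: memv_line.
Qed.

Lemma span_add1P e V v : reflect (exists a, v - a *: e \in V) (v \in <<[:: e]>> + V)%VS.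
Proof.
rewrite span_seq1; apply: (iffP memv_addP) => [[_ /vlineP[a ->] [w wV ->]]|[a va]].
  by exists a; rewrite addrAC subrr add0r.
by exists (a *: e); [apply/vlineP; exists a | exists (v - a *: e) => //; rewrite addrC subrK].
Qed.

Lemma span_add2P e1 e2 V v :
  reflect (exists a b, v - a *: e1 - b *: e2 \in V) (v \in <<[:: e1; e2]>> + V)%VS.
Proof.
rewrite span_cons -addvA.
apply: (iffP memv_addP) => [[_ /vlineP[a ->] [w /span_add1P[b wb] ->]]|[a [b vab]]].
  by exists a, b; rewrite [_ + w]addrC addrK.
exists (a *: e1); first by apply/vlineP; exists a.
exists (v - a *: e1); last by rewrite addrC subrK.
by apply/span_add1P; exists b.
Qed.

End SubspaceTools.

Section LieTools.
Variables (K : numFieldType) (n : nat) (lam : strconst K n).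
Hypotheses (lie_lam : is_lie lam) (nil_lam : nilpotent_lie lam).
Implicit Types (x y z : 'cV[K]_n) (U V W : {vspace 'cV[K]_n}).
Local Notation "\[ x , y ]" := (bracket lam x y) (at level 0, x, y at level 99).
Local Notation L := (lower_central lam).

Lemma brC x y : \[x, y] = - \[y, x].
Proof. exact: lie_bracketC. Qed.

Lemma brxx x : \[x, x] = 0.
Proof. by have [->] := lie_lam. Qed.

Lemma brJ x y z : \[x, \[y, z]] = \[\[x, y], z] + \[y, \[x, z]].
Proof. exact: jacobi_derivation. Qed.

Lemma bracketv_ind U V (P : 'cV[K]_n -> Prop) :
  P 0 -> (forall a x y, P x -> P y -> P (a *: x + y)) ->
  (forall u v, u \in U -> v \in V -> P \[u, v]) ->
  forall x, x \in bracketv lam U V -> P x.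
Proof.
move=> P0 PD Puv x; rewrite /bracketv; set X := [seq _ | _ <- _, _ <- _] => xX.
rewrite (@coord_span _ _ _ (in_tuple X) x xX); elim/big_rec: _ => // i y _ Py.
apply: PD => //; have : (in_tuple X)`_i \in X by apply: mem_nth.
by case/allpairsP => -[u v] /= [/vbasis_mem uU /vbasis_mem vV ->]; apply: Puv.
Qed.

Lemma mem_L1 k x y : y \in L k -> \[x, y] \in L k.+1.
Proof. by move=> yL; apply: mem_bracketv => //; apply: memvf. Qed.

Lemma LS k : (L k.+1 <= L k)%VS.
Proof.
elim: k => [|k IHk]; first exact: subvf.
by apply/bracketvP => x y _ /(subvP IHk); apply: mem_L1.
Qed.

Lemma L_anti i j : (i <= j)%N -> (L j <= L i)%VS.
Proof.
move=> /subnK <-; elim: (j - i)%N => [|k IHk]; first exact: subvv.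
exact: subv_trans (LS _) IHk.
Qed.

(** Indices start at [L 0], the whole algebra, so the usual additive rule acquires a successor. *)
Lemma mem_LL i j x y : x \in L i -> y \in L j -> \[x, y] \in L (i + j).+1.
Proof.
elim: i j x y => [|i IHi] j x y; first by move=> _; apply: mem_L1.
move=> xL yL; move: x xL; apply: bracketv_ind => [|a x1 x2 H1 H2|u v _ vL].
- by rewrite bracket0l mem0v.
- by rewrite bracketDl bracketZl memvD ?memvZ.
have -> : \[\[u, v], y] = \[u, \[v, y]] - \[v, \[u, y]].
  by rewrite (brJ u v y); vec_ring.
apply: memvB; first by rewrite addSn; apply: mem_L1; apply: IHi.
by rewrite addSn -addnS; apply: IHi => //; apply: mem_L1.
Qed.

(** A term contained in its successor is contained in all later terms, the last of which is zero. *)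
Lemma L_stable k : (L k <= L k.+1)%VS -> L k = 0%VS.
Proof.
move=> Lk; have [c Lc] := nil_lam; apply/eqP; rewrite -subv0 -Lc.
elim: c {Lc} => [|c IHc]; first exact: subvf.
apply: subv_trans Lk _; apply/bracketvP => x y _ /(subvP IHc).
exact: mem_L1.
Qed.

Lemma dim_L_lt k : L k != 0%VS -> (\dim (L k.+1) < \dim (L k))%N.
Proof.
apply: contraNltn => dk; apply/eqP/L_stable.
have /eqP <- : L k.+1 == L k by rewrite eqEdim LS.
exact: subvv.
Qed.

(** Changing a generator by [L 1], or an element of [L k] by [L k.+1], changes the bracket only in
    [L k.+2]. *)
Lemma L_layer k X Y : (fullv <= <<X>> + L 1)%VS -> (L k <= <<Y>> + L k.+1)%VS ->
  (L k.+1 <= <<[seq \[x, y] | x <- X, y <- Y]>> + L k.+2)%VS.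
Proof.
move=> /subvP sX /subvP sY; apply/bracketvP => u v uL vL.
have /memv_addP[u1 u1X [u2 u2L ->]] := sX u (memvf u).
have /memv_addP[v1 v1Y [v2 v2L vE]] := sY v vL; rewrite vE in vL *.
have -> : \[u1 + u2, v1 + v2] = \[u1, v1] + (\[u1, v2] + \[u2, v1 + v2]).
  by rewrite !bracketDl !bracketDr; vec_ring.
apply: memv_add; last first.
  apply: memvD; first exact: mem_L1.
  exact: (@mem_LL 1).
rewrite (@coord_span _ _ _ (in_tuple X) u1 u1X) bracket_suml; apply: memv_suml => i _.
rewrite (@coord_span _ _ _ (in_tuple Y) v1 v1Y) bracket_sumr; apply: memv_suml => j _.
rewrite bracketZl bracketZr !memvZ //; apply: memv_span; apply/allpairsP.
by exists (X`_i, Y`_j); rewrite /= !mem_nth.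
Qed.

End LieTools.

(** * Jordan chains adapted to two commuting operators *)

Section AdaptedChains.
Variables (K : fieldType) (vT : vectType K).
Implicit Types (U V W : {vspace vT}) (A B : 'End(vT)) (u v g : vT).

Definition lfun_iter B k : 'End(vT) := iter k (comp_lfun B) \1%VF.

Lemma lfun_iter0 B u : lfun_iter B 0 u = u.
Proof. by rewrite /lfun_iter /= id_lfunE. Qed.

Lemma lfun_iterS B k u : lfun_iter B k.+1 u = B (lfun_iter B k u).
Proof. by rewrite /lfun_iter /= comp_lfunE. Qed.

Lemma lfun_iterD B i j u : lfun_iter B (i + j) u = lfun_iter B i (lfun_iter B j u).
Proof.
by elim: i => [|i IHi]; rewrite ?lfun_iter0 // addSn !lfun_iterS IHi.
Qed.

Lemma lfun_iterSr B k u : lfun_iter B k.+1 u = lfun_iter B k (B u).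
Proof. by rewrite -addn1 lfun_iterD lfun_iterS lfun_iter0. Qed.

Lemma lfun_iter_stable B U k u :
  (forall v, v \in U -> B v \in U) -> u \in U -> lfun_iter B k u \in U.
Proof.
by move=> BU uU; elim: k => [|k IHk]; rewrite ?lfun_iter0 // lfun_iterS BU.
Qed.

Lemma lfun_iter_comm A B U k u : (forall v, v \in U -> B v \in U) ->
  (forall v, v \in U -> A (B v) = B (A v)) -> u \in U ->
  A (lfun_iter B k u) = lfun_iter B k (A u).
Proof.
move=> BU AB uU; elim: k => [|k IHk]; rewrite ?lfun_iter0 // !lfun_iterS -IHk.
by rewrite AB // lfun_iter_stable.
Qed.

Lemma lfun_iter_ge B k l u : (k <= l)%N -> lfun_iter B k u = 0 -> lfun_iter B l u = 0.
Proof. by move=> /subnK <- Bk; rewrite lfun_iterD Bk linear0. Qed.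

Lemma separating_functional V e : e \notin V ->
  exists phi : {linear vT -> K^o}, phi e = 1 /\ {in V, forall v, phi v = 0}.
Proof.
move=> eV; pose X := in_tuple (e :: vbasis V).
have fX : free X by rewrite free_cons (span_basis (vbasisP V)) eV (basis_free (vbasisP V)).
exists (coord X ord0); split=> [|v vV].
  by have := @coord_free _ _ _ X ord0 ord0 fX; rewrite eqxx.
rewrite (coord_vbasis vV) linear_sum big1 // => i _; rewrite linearZ /=.
have i1 : (i.+1 < size (e :: vbasis V))%N by rewrite /= ltnS size_tuple.
have -> : (vbasis V)`_i = X`_(Ordinal i1) by [].
by rewrite coord_free // scaler0.
Qed.

(* A vector labelled [(i, l, eps)] is [B^i g] with [B^l g = 0], and
   [2 i - l] is its weight for the sl_2-grading attached to [B]; [A] has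
   nonnegative degree for it, and [eps] breaks the ties in degree zero. *)
Definition label_lt (a b : nat * nat * nat) :=
  (b.1.2 + 2 * a.1.1 < 2 * b.1.1 + a.1.2)%N ||
  (b.1.2 + 2 * a.1.1 == 2 * b.1.1 + a.1.2)%N && (a.2 < b.2)%N.

Definition label_span (s : seq (vT * (nat * nat * nat))) (Q : pred (nat * nat * nat)) :=
  <<[seq t.1 | t <- s & Q t.2]>>%VS.

Lemma label_spanS s s' (Q Q' : pred (nat * nat * nat)) :
  (forall t, t \in s -> Q t.2 -> exists2 t', t' \in s' & (t'.1 == t.1) && Q' t'.2) ->
  (label_span s Q <= label_span s' Q')%VS.
Proof.
move=> H; apply/span_subvP => _ /mapP[t + ->]; rewrite mem_filter => /andP[Qt ts].
have [t' t's /andP[/eqP <- Qt']] := H t ts Qt.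
by apply/memv_span/map_f; rewrite mem_filter Qt'.
Qed.

(** Induction on the dimension. A longest chain of [B] is split off together with a [B]-stable
    complement [U'], and the induction applies to the compression of [A] to [U']. That [A ^ M] maps
    [U] into [B U] is the form of nilpotency that passes to the compression. The bound [l0] records
    that later chains are no longer than earlier ones, which keeps [A] from lowering weights. *)
Lemma adapted_chains d A B U l0 :
  (\dim U <= d)%N ->
  (forall u, u \in U -> A u \in U) -> (forall u, u \in U -> B u \in U) ->
  (forall u, u \in U -> A (B u) = B (A u)) ->
  (forall u, u \in U -> lfun_iter B l0 u = 0) ->
  (exists M, forall u, u \in U -> exists2 v, v \in U & lfun_iter A M u = B v) ->
  exists s : seq (vT * (nat * nat * nat)),
    [/\ basis_of U (map fst s),
        forall t, t \in s -> (t.2.1.2 <= l0)%N /\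
          exists2 g, g \in U & t.1 = lfun_iter B t.2.1.1 g /\ lfun_iter B t.2.1.2 g = 0,
        forall t, t \in s -> B t.1 \in label_span s (pred1 (t.2.1.1.+1, t.2.1.2, t.2.2))
      & forall t, t \in s -> A t.1 \in label_span s (label_lt t.2)].
Proof.
elim: d A U l0 => [|d IHd] A U l0 dU AU BU AB Bl0 [M AM].
  exists [::]; split=> //; move: dU; rewrite leqn0 dimv_eq0 => /eqP ->.
  exact: nil_basis.
have [->|Unz] := eqVneq U 0%VS; first by exists [::]; split=> //; apply: nil_basis.
have ex_l : exists l, (U <= lker (lfun_iter B l))%VS.
  by exists l0; apply/subvP => u /Bl0 Bu; rewrite memv_ker Bu.
case: (ex_minnP ex_l) => l /subvP Ul l_min.
have Bl u : u \in U -> lfun_iter B l u = 0 by move/Ul; rewrite memv_ker => /eqP.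
have ll0 : (l <= l0)%N.
  by apply: l_min; apply/subvP => u /Bl0 Bu; rewrite memv_ker Bu.
have l_gt0 : (0 < l)%N.
  rewrite lt0n; apply: contra Unz => /eqP l0'; rewrite -subv0; apply/subvP => u uU.
  by rewrite memv0 -(lfun_iter0 B u) -l0' Bl.
(* The ends of the longest chains. [A] cannot map [V1] onto itself, since [A ^ M] sends it into
   [B ^ l U = 0]. *)
pose V1 := (lfun_iter B l.-1 @: U)%VS.
have V1nz : V1 != 0%VS.
  rewrite -lkerE; apply/negP => /l_min; rewrite leqNgt prednK //.
  by rewrite leqnn.
have V1AV1 : ~~ (V1 <= A @: V1)%VS.
  apply: contra V1nz => V1A; rewrite -subv0.
  have V1AM k : (V1 <= lfun_iter A k @: V1)%VS.
    elim: k => [|k IHk]; first by rewrite /lfun_iter /= lim1g subvv.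
    by rewrite /lfun_iter /= limg_comp; apply: subv_trans V1A _; apply: limgS.
  apply: subv_trans (V1AM M) _; apply/subvP => _ /memv_imgP[_ /memv_imgP[u uU ->] ->].
  have -> : lfun_iter A M (lfun_iter B l.-1 u) = lfun_iter B l.-1 (lfun_iter A M u).
    elim: (M) => [|k IHk]; rewrite ?lfun_iter0 // !lfun_iterS IHk.
    by apply: (lfun_iter_comm (U := U)) => //; apply: lfun_iter_stable.
  have [v vU ->] := AM u uU.
  by rewrite -lfun_iterSr prednK // Bl // mem0v.
have [e eV1 eA] := subvPn V1AV1.
have [phi [phie phiA]] := separating_functional eA.
have /memv_imgP[g gU eg] := eV1; rewrite eg in phie.
pose f k u : K := phi (lfun_iter B k u).
have f_lin k (a : K) u v : f k (a *: u + v) = a * f k u + f k v.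
  by rewrite /f !linearP.
(* The chain ends outside [A V1], on which [phi] vanishes; this is what later excludes a [c 0]
   component in [A u]. *)
have fA u : u \in U -> f l.-1 (A u) = 0.
  move=> uU; rewrite /f -(lfun_iter_comm (U := U)) // phiA //.
  by apply/memv_img/memv_img.
have f_ge k u : (l <= k)%N -> u \in U -> f k u = 0.
  by move=> lk uU; rewrite /f (lfun_iter_ge lk) ?Bl // linear0.
have fD k j u : f k (lfun_iter B j u) = f (k + j)%N u by rewrite /f -lfun_iterD.
have f0 k : f k 0 = 0 by rewrite /f !linear0.
have f_sum k I (r : seq I) (F : I -> vT) :
    f k (\sum_(i <- r) F i) = \sum_(i <- r) f k (F i).
  by rewrite /f !linear_sum.
have fZ k (a : K) u : f k (a *: u) = a * f k u.
  by rewrite -[_ *: _]addr0 f_lin f0 addr0.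
pose lf k : 'Hom(vT, K^o) := linfun (phi \o lfun_iter B k).
have lfE k u : lf k u = f k u by rewrite lfunE.
(* The largest [B]-stable subspace of [U] on which [phi] vanishes; it is the complement of the
   chain. *)
pose U' := (U :&: \bigcap_(k < l) lker (lf k))%VS.
have U'P u : reflect (u \in U /\ forall k, (k < l)%N -> f k u = 0) (u \in U').
  rewrite memv_cap; apply: (iffP andP) => -[uU Hu]; split=> //.
    move=> k kl; move: Hu; rewrite memvE => /subv_bigcapP/(_ (Ordinal kl) isT).
    by rewrite -memvE memv_ker lfE => /eqP.
  rewrite memvE; apply/subv_bigcapP => k _; rewrite -memvE memv_ker lfE Hu //.
pose c k := lfun_iter B k g.
have cU k : c k \in U by apply: lfun_iter_stable.
have cS k : B (c k) = c k.+1 by rewrite /c lfun_iterS.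
(* The matrix of values [f (l.-1 - k) (c i)] is triangular with ones on its diagonal. *)
have c_tri (a : nat -> K) j : (j <= l)%N ->
    (forall k, (k < j)%N -> f (l.-1 - k)%N (\sum_(i <- iota 0 l) a i *: c i) = 0) ->
    forall k, (k < j)%N -> a k = 0.
  move=> jl H; elim/ltn_ind => k IHk kj; have kl := leq_trans kj jl.
  have := H k kj; rewrite f_sum (bigD1_seq k) ?iota_uniq ?mem_iota //= big1.
    rewrite addr0 fZ fD subnK; last by rewrite -ltnS prednK.
    by rewrite /f phie mulr1.
  move=> i ik; rewrite fZ fD; case: (ltngtP i k) ik => // [ik|ki] _.
    by rewrite IHk ?mul0r // (ltn_trans ik).
  by rewrite f_ge ?mulr0 //; move: ki kl; clear; lia.
pose chain := [seq c k | k <- iota 0 l].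
have extend (k : 'I_l -> K) : {a : nat -> K | forall i : 'I_l, a i = k i}.
  by exists (fun j => oapp k 0 (insub j)) => i; rewrite valK.
have sz_chain : size chain = l by rewrite size_map size_iota.
have nth_chain (i : 'I_l) : chain`_i = c i.
  by rewrite (nth_map 0%N) ?size_iota // nth_iota.
have szc : size chain == l by apply/eqP.
have big_chain (a : nat -> K) : \sum_(i < l) a i *: c i = \sum_(i <- iota 0 l) a i *: c i.
  by rewrite -(big_mkord xpredT (fun i => a i *: c i)) /index_iota subn0.
have chain_sum v : v \in <<chain>>%VS -> exists a : nat -> K, v = \sum_(i <- iota 0 l) a i *: c i.
  move/(@coord_span _ _ _ (Tuple szc)) => vE; have [a aE] := extend (coord (Tuple szc) ^~ v).
  exists a; rewrite -big_chain vE; apply: eq_bigr => i _.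
  by rewrite aE /= nth_chain.
have chainU : (<<chain>> <= U)%VS.
  by apply/span_subvP => _ /mapP[k _ ->].
have chain_free : free chain.
  apply/(@freeP _ _ _ (Tuple szc)) => k k0 i; have [a aE] := extend k.
  rewrite -aE; apply: (@c_tri a l) => // j jl; rewrite -big_chain.
  rewrite (eq_bigr (fun i => k i *: (Tuple szc)`_i)) ?k0 ?f0 // => i' _.
  by rewrite aE /= nth_chain.
have dir : (U' :&: <<chain>> = 0)%VS.
  apply/eqP; rewrite -subv0; apply/subvP => v; rewrite memv_cap => /andP[/U'P[_ fv]].
  move=> /chain_sum[a va]; rewrite memv0 va big_seq big1 // => i; rewrite mem_iota /= => il.
  rewrite (@c_tri a l) ?scale0r // => k kl; rewrite -va fv //.
  by rewrite -[X in (_ < X)%N](prednK l_gt0) ltnS leq_subr.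
have lK k : (k < l)%N -> (l.-1 - (l.-1 - k))%N = k by clear; lia.
have sumU : (U' + <<chain>> = U)%VS.
  apply/eqP; rewrite eqEsubv subv_add capvSl chainU; apply/subvP => v vU.
  have H m : (m <= l)%N -> exists2 w, w \in <<chain>>%VS &
      forall k, (k < m)%N -> f (l.-1 - k)%N (v - w) = 0.
    elim: m => [|m IHm] ml; first by exists 0; rewrite ?mem0v.
    have [w wc Hw] := IHm (ltnW ml); pose b := f (l.-1 - m)%N (v - w).
    exists (w + b *: c m).
      by rewrite memvD // memvZ // memv_span // map_f // mem_iota.
    move=> k; rewrite ltnS leq_eqVlt opprD addrA -scaleNr [_ + (- b) *: _]addrC f_lin fD.
    case/predU1P=> [->|km]; last by rewrite Hw // f_ge ?mulr0 ?add0r //; move: km ml; clear; lia.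
    rewrite subnK; last by rewrite -ltnS prednK.
    by rewrite [f _ g]phie mulr1 addNr.
  have [w wc Hw] := H l (leqnn l); rewrite -(subrK w v); apply: memv_add => //.
  apply/U'P; split=> [|k kl]; first by rewrite memvB // (subvP chainU).
  by rewrite -(lK k kl) Hw //; move: l_gt0; clear; lia.
pose pi := daddv_pi U' <<chain>>; pose rho := daddv_pi <<chain>> U'.
have dir' : (<<chain>> :&: U' = 0)%VS by rewrite capvC.
have pirho u : u \in U -> pi u + rho u = u by rewrite -sumU; apply: daddv_pi_add.
have piU u : pi u \in U' by apply: memv_pi.
have rhoW u : rho u \in <<chain>>%VS by apply: memv_pi.
have U'U u : u \in U' -> u \in U by case/U'P.
have pi_id u : u \in U' -> pi u = u by apply: daddv_pi_id.
have pi_chain u : u \in <<chain>>%VS -> pi u = 0.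
  move=> uc; have := pirho u (subvP chainU _ uc); rewrite (daddv_pi_id dir' uc).
  by move/eqP; rewrite -subr_eq0 addrK => /eqP.
have Bchain u : u \in <<chain>>%VS -> B u \in <<chain>>%VS.
  case/chain_sum => a ->; rewrite linear_sum big_seq; apply: memv_suml => i.
  rewrite mem_iota /= linearZ => il; apply: memvZ => /=; rewrite cS.
  have [il'|il'] := ltnP i.+1 l; first by rewrite memv_span // map_f // mem_iota.
  by rewrite /c (lfun_iter_ge il') ?Bl // mem0v.
have BU' u : u \in U' -> B u \in U'.
  case/U'P=> uU fu; apply/U'P; split=> [|k kl]; first exact: BU.
  rewrite /f -lfun_iterSr -/(f _ _); have [kl'|kl'] := ltnP k.+1 l; first exact: fu.
  exact: f_ge.
have piB u : u \in U -> pi (B u) = B (pi u).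
  move=> uU; rewrite -{1}(pirho u uU) !linearD /=.
  by rewrite (pi_chain (B (rho u))) ?Bchain // addr0 pi_id ?BU'.
have piBk k u : u \in U -> pi (lfun_iter B k u) = lfun_iter B k (pi u).
  move=> uU; elim: k => [|k IHk]; rewrite ?lfun_iter0 // !lfun_iterS piB ?IHk //.
  exact: lfun_iter_stable.
have rho_span v a : v \in U -> (a <= l)%N -> (forall k, (k < a)%N -> f (l.-1 - k)%N v = 0) ->
    rho v \in <<[seq c k | k <- iota 0 l & (a <= k)%N]>>%VS.
  move=> vU al Hv; have [b bE] := chain_sum _ (rhoW v).
  have ba k : (k < a)%N -> b k = 0.
    apply: (@c_tri b a al) => {}k ka; rewrite -bE.
    have -> : rho v = (-1) *: pi v + v.
      by apply/esym/eqP; rewrite scaleN1r addrC subr_eq addrC pirho.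
    rewrite f_lin Hv // addr0; have /U'P[_ ->] := piU v; first by rewrite mulr0.
    by move: l_gt0; clear; lia.
  rewrite bE big_seq; apply: memv_suml => i; rewrite mem_iota /= => il.
  have [ai|/ba ->] := leqP a i; last by rewrite scale0r mem0v.
  by rewrite memvZ // memv_span // map_f // mem_filter ai mem_iota.
pose A' := (pi \o A)%VF.
have dU' : (\dim U' <= d)%N.
  have := dimv_disjoint_sum dir; rewrite sumU (eqP chain_free) sz_chain.
  by move: dU l_gt0; clear; lia.
(* Without a [c 0] component, the chain part of [A u] lies in the image of [B]. So [A] and [A']
   agree modulo [B U], and the nilpotency hypothesis passes to [A']. *)
have rhoA_B u : u \in U -> exists2 v, v \in U & rho (A u) = B v.
  move=> uU; have : rho (A u) \in <<[seq c k | k <- iota 0 l & (1 <= k)%N]>>%VS.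
    by apply: rho_span => // [|k]; [apply: AU | rewrite ltnS leqn0 => /eqP ->; rewrite subn0 fA].
  suff H : (<<[seq c k | k <- iota 0 l & (0 < k)%N]>> <= B @: U)%VS.
    by move/(subvP H)/memv_imgP.
  apply/span_subvP => _ /mapP[k + ->]; rewrite mem_filter => /andP[k0 _].
  by rewrite /c -(prednK k0) lfun_iterS memv_img // cU.
have [|||||s' [s'basis s'lab s'B s'A]] := IHd A' U' l dU'.
- by move=> u _; rewrite comp_lfunE.
- exact: BU'.
- by move=> u uU'; rewrite !comp_lfunE AB ?U'U // piB // AU // U'U.
- by move=> u /U'U; apply: Bl.
- exists M => u uU'; have uU := U'U _ uU'.
  have diff k : exists2 v, v \in U & lfun_iter A k u - lfun_iter A' k u = B v.
    elim: k => [|k [v vU E]]; first by exists 0; rewrite ?mem0v // !lfun_iter0 subrr linear0.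
    have A'kU : lfun_iter A' k u \in U.
      by case: k {E} => [|k]; rewrite ?lfun_iter0 // lfun_iterS comp_lfunE U'U.
    have [v' v'U E'] := rhoA_B _ A'kU.
    exists (A v + v'); first by rewrite memvD // AU.
    rewrite linearD /= -AB // -E -E' linearB /= !lfun_iterS comp_lfunE.
    rewrite -addrA; congr (_ + _).
    by rewrite -[X in _ = - X + _](pirho _ (AU _ A'kU)) opprD addrNK.
  have [v vU E] := AM u uU; have [v' v'U E'] := diff M.
  exists (pi (v - v')); first exact: piU.
  rewrite -piB ?memvB // linearB /= -E -E' opprB addrC subrK pi_id //.
  by case: (M) => [|k]; rewrite ?lfun_iter0 // lfun_iterS comp_lfunE.
(* The new chain receives tie-breaker 0 and those of the complement move up by one: at equal weight
   [A] may pass from the new chain to the older ones, never back. *)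
pose s0 := [seq (c j, (j, l, 0%N)) | j <- iota 0 l].
pose s1 := [seq (t.1, (t.2.1, t.2.2.+1)) | t <- s'].
have s1_span (Q Q' : pred (nat * nat * nat)) : (forall a : nat * nat * nat, Q a -> Q' (a.1, a.2.+1)) ->
    (label_span s' Q <= label_span (s0 ++ s1) Q')%VS.
  move=> QQ; apply: label_spanS => t ts Qt; exists (t.1, (t.2.1, t.2.2.+1)).
    by rewrite mem_cat map_f ?orbT.
  by rewrite eqxx QQ.
have s0_span a (Q : pred (nat * nat * nat)) : (forall k, (a <= k < l)%N -> Q (k, l, 0%N)) ->
    (<<[seq c k | k <- iota 0 l & (a <= k)%N]>> <= label_span (s0 ++ s1) Q)%VS.
  move=> HQ; apply/span_subvP => _ /mapP[k + ->]; rewrite mem_filter mem_iota /= => akl.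
  apply: memv_span; apply/mapP; exists (c k, (k, l, 0%N)) => //.
  rewrite mem_filter HQ //= mem_cat; apply/orP; left; apply/mapP; exists k => //.
  by rewrite mem_iota /=; case/andP: akl.
exists (s0 ++ s1); split.
- rewrite map_cat -!map_comp -sumU addvC; apply: cat_basis.
  + by apply/directv_addP; rewrite capvC.
  + by rewrite /basis_of chain_free andbT.
  + by rewrite (eq_map (g := fst)).
- move=> t; rewrite mem_cat => /orP[/mapP[j _ ->] | /mapP[t' t's ->]] /=.
    by split=> //; exists g => //; rewrite Bl.
  have [ll' [g' g'U Hg']] := s'lab _ t's.
  by split; [apply: leq_trans ll' ll0 | exists g' => //; apply: U'U].
- move=> t; rewrite mem_cat => /orP[/mapP[j jl ->] | /mapP[t' t's ->]] /=.
    rewrite cS; have [jl'|jl'] := ltnP j.+1 l; last first.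
      by rewrite /c (lfun_iter_ge jl') ?Bl // mem0v.
    apply: memv_span; apply/mapP; exists (c j.+1, (j.+1, l, 0%N)) => //.
    rewrite mem_filter /= eqxx mem_cat; apply/orP; left; apply/mapP.
    by exists j.+1; rewrite // mem_iota.
  by apply: (subvP (s1_span _ _ _)) (s'B _ t's) => a /eqP ->; apply/eqP.
(* Only the [c k] with [k > i] and [k >= l + i - l'] can occur. Adding the two bounds gives
   [2 k - l > 2 i - l']. *)
have rhoA i l' eps h : h \in U -> (l' <= l)%N -> lfun_iter B l' h = 0 ->
    rho (A (lfun_iter B i h)) \in label_span (s0 ++ s1) (label_lt (i, l', eps)).
  move=> hU ll' Bh; pose a := minn l (maxn i.+1 (l + i - l')).
  apply: (subvP (@s0_span a _ _)) => [k /andP[ak kl]|].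
    by rewrite /label_lt /=; apply/orP; left; move: ak kl ll'; rewrite /a; clear; lia.
  have BhU k : lfun_iter B k h \in U by apply: lfun_iter_stable.
  apply: rho_span => [||k ka]; [exact: AU | exact: geq_minl |].
  rewrite (lfun_iter_comm (U := U)) // fD.
  have [kl'|kl'] := leqP l' (l.-1 - k + i)%N.
    by rewrite /f -(lfun_iter_comm (U := U)) // (lfun_iter_ge kl') // !linear0.
  have [ki|ki|->] := ltngtP k i.
  - by apply: f_ge; [move: ki; clear; lia | apply: AU].
  - by exfalso; move: ka ki kl' ll' l_gt0; rewrite /a; clear; lia.
  - by rewrite subnK ?fA //; move: kl' ll'; clear; lia.
have s'U' : (U' <= label_span s' (fun a => 0 <= a.1.1)%N)%VS.
  by rewrite /label_span filter_predT (span_basis s'basis) subvv.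
have s'BU' j u : u \in U' -> lfun_iter B j u \in label_span s' (fun a => j <= a.1.1)%N.
  move=> uU'; elim: j => [|j IHj]; first by rewrite lfun_iter0 (subvP s'U').
  rewrite lfun_iterS; have := memv_img B IHj; rewrite limg_span; apply/subvP.
  apply/span_subvP => _ /mapP[_ /mapP[t + ->] ->]; rewrite mem_filter => /andP[jt t's].
  apply: (subvP (label_spanS _)) (s'B t t's) => t' t's' /eqP E.
  by exists t'; rewrite // eqxx E.
(* For [t] in the new chain, the complement part of [A (c j)] is a [B ^ j]-image: its labels have
   first entry at least [j] and length at most [l]. The weight does not drop, and a tie is settled
   by the third entry. *)
move=> t; rewrite mem_cat => /orP[/mapP[j jl ->] | /mapP[t' t's ->]] /=.
  rewrite -(pirho (A (c j))) ?AU //; apply: memvD; last by apply: rhoA => //; apply: Bl.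
  rewrite /c (lfun_iter_comm (U := U)) // piBk ?AU //.
  apply: (subvP (label_spanS _)) (s'BU' j _ (piU _)) => t1 t1s jt.
  exists (t1.1, (t1.2.1, t1.2.2.+1)); first by rewrite mem_cat map_f ?orbT.
  by rewrite eqxx /label_lt /=; have [l1 _] := s'lab t1 t1s; move: jt l1 => /=; clear; lia.
have [ll' [h hU' [t'E Bh]]] := s'lab t' t's; have hU := U'U _ hU'.
have t'U : t'.1 \in U by rewrite t'E lfun_iter_stable.
rewrite -(pirho (A t'.1)) ?AU //; apply: memvD; last first.
  by rewrite {1}t'E; case: (t'.2) ll' Bh => -[i l'] eps /= ll' Bh; apply: rhoA.
have := s'A t' t's; rewrite comp_lfunE; apply/subvP/s1_span => a.
by rewrite /label_lt /= ltnS.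
Qed.

End AdaptedChains.

Section SubspaceDimensions.
Variables (K : fieldType) (vT : vectType K).
Implicit Types (U V W : {vspace vT}).

Lemma dimv_add_line W (e : vT) : e \notin W -> \dim (<[e]> + W) = (\dim W).+1.
Proof.
move=> eW; rewrite -(span_basis (vbasisP W)) -span_cons.
have /eqP -> : free (e :: vbasis W).
  by rewrite free_cons (span_basis (vbasisP W)) eW (basis_free (vbasisP W)).
by rewrite /= size_tuple (span_basis (vbasisP W)).
Qed.

Lemma intermediate_dim U V k : (V <= U)%VS -> (\dim V <= k <= \dim U)%N ->
  exists W, [/\ (V <= W)%VS, (W <= U)%VS & \dim W = k].
Proof.
move=> VU /andP[/subnK <-]; elim: (k - _)%N => [|d IHd] dU.
  by exists V; rewrite subvv.
have [|W [VW WU dW]] := IHd; first exact: ltnW.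
have /subvPn[e eU eW] : ~~ (U <= W)%VS.
  by apply: contraL dU => /dimvS; rewrite dW -leqNgt.
exists (<[e]> + W)%VS; rewrite subv_add -memvE eU WU dimv_add_line // dW.
by split=> //; apply: subv_trans VW (addvSr _ _).
Qed.

End SubspaceDimensions.

(** * Algebras with abelian derived algebra *)

Section AbelianIdeals.
Variables (K : numFieldType) (n : nat) (lam : strconst K n).
Hypotheses (lie_lam : is_lie lam) (nil_lam : nilpotent_lie lam).
Implicit Types (x y z : 'cV[K]_n) (U V W a : {vspace 'cV[K]_n}).
Local Notation "\[ x , y ]" := (bracket lam x y) (at level 0, x, y at level 99).
Local Notation L := (lower_central lam).

Lemma ad_iter_L x u k : lfun_iter (linfun (bracket lam x)) k u \in L k.
Proof.
by elim: k => [|k IHk]; [exact: memvf | rewrite lfun_iterS lfunE mem_L1].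
Qed.

(** With at most one generator the first layer is spanned by a bracket [[x, x] = 0], so [L 1 = L 2],
    which forces [L 1 = 0]. *)
Lemma dim_derived : (1 < n)%N -> (\dim (L 1) + 2 <= n)%N.
Proof.
move=> n1; have [X szX [fX _]] := generators_mod (LS lam 0).
have {}szX : size X = (n - \dim (L 1))%N by rewrite szX [\dim (L 0)]dimvf /dim /= muln1.
case: X szX fX => [|x [|y X]] szX fX; last by move: szX => /=; lia.
  suff L0 : L 1 = 0%VS by move: szX; rewrite L0 dimv0 /=; lia.
  by apply: (L_stable nil_lam); have := L_layer lie_lam (k := 0) fX fX; rewrite /= span_nil add0v.
suff L0 : L 1 = 0%VS by move: szX; rewrite L0 dimv0 /=; lia.
apply: (L_stable nil_lam); have := L_layer lie_lam (k := 0) fX fX.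
by rewrite /= brxx // span_seq1 (_ : <[0]> = 0)%VS ?add0v //; apply/eqP; rewrite -subv0 -memvE mem0v.
Qed.

(** The ideal spanned by [y] and [a] is graded by the chains of [ad y]; [ad x] raises because it
    increases the labels. *)
Lemma abelian_codim2 a : (forall u v, \[u, v] \in a) ->
  {in a &, forall u v, \[u, v] = 0} -> (\dim a).+2 = n -> nontrivial_degeneration lam.
Proof.
move=> br_a ab_a dim_a; have [c Lc] := nil_lam.
have [X szX [fX _]] := generators_mod (subvf a).
have {szX} : size X = 2 by rewrite szX dimvf /dim /= muln1; lia.
case: X fX => [|x [|y []]] // fX _.
pose A := linfun (bracket lam x); pose B := linfun (bracket lam y).
have AE u : A u = \[x, u] by rewrite lfunE.
have BE u : B u = \[y, u] by rewrite lfunE.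
have [|||||s [s_basis s_lab sB sA]] := @adapted_chains _ _ (\dim a) A B a c (leqnn _).
- by move=> u _; rewrite AE.
- by move=> u _; rewrite BE.
- by move=> u ua; rewrite !AE !BE (brJ lie_lam) ab_a // add0r.
- by move=> u _; apply/eqP; rewrite -memv0 -Lc ad_iter_L.
- exists c => u _; exists 0; rewrite ?mem0v // linear0.
  by apply/eqP; rewrite -memv0 -Lc ad_iter_L.
(* [N] exceeds every tie-breaker, so [wt] orders labels lexicographically. A step of [ad y] adds
   [2 N], the weight of [y]. The summand 3 places all of [a] above [y], as needed for [[x, y]]. *)
pose N := (\max_(t <- s) t.2.2).+1.
pose wt (l : nat * nat * nat) := ((c - l.1.2 + 2 * l.1.1 + 3) * N + l.2)%N.
have eps_lt t : t \in s -> (t.2.2 < N)%N.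
  by move=> ts; rewrite ltnS; apply: (leq_bigmax_seq (F := fun t => t.2.2)).
pose s1 := [seq (t.1, wt t.2) | t <- s].
have span_s1 (Q : pred (nat * nat * nat)) (Q' : pred nat) :
    (forall t, t \in s -> Q t.2 -> Q' (wt t.2)) ->
    (label_span s Q <= weight_span ((y, (2 * N)%N) :: s1) Q')%VS.
  move=> QQ; apply/span_subvP => _ /mapP[t + ->]; rewrite mem_filter => /andP[Qt ts].
  apply: memv_span; apply/mapP; exists (t.1, wt t.2) => //.
  by rewrite mem_filter QQ //= inE map_f ?orbT.
have s1_fst : map fst s1 = map fst s by rewrite -map_comp.
have s_a t : t \in s -> t.1 \in a.
  by move=> ts; rewrite (basis_mem s_basis) // map_f.
pose t0 : 'cV[K]_n * (nat * nat * nat) := (0, (0, 0, 0)%N).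
have nth_s1 j (x0 : 'cV[K]_n * nat) : (j < size s)%N -> nth x0 s1 j = ((nth t0 s j).1, wt (nth t0 s j).2).
  exact: nth_map.
have sz_s : size s = \dim a.
  by have := @vector.size_basis _ _ _ _ (in_tuple (map fst s)) s_basis; rewrite size_map.
apply: (@weighted_basis_degeneration _ _ _ x ((y, (2 * N)%N) :: s1)) => //.
- by rewrite /= size_map sz_s.
- rewrite [map _ _]/= s1_fst; apply: (sub_add_span (X := [:: x; y]) fX).
  by rewrite (span_basis s_basis) subvv.
- move=> i j /andP[ij js]; case: j ij js => // j ij; rewrite [size _]/= ltnS => js.
  rewrite size_map in js; rewrite /= nth_s1 //.
  have ts := mem_nth t0 js; set t := nth _ s j in ts *.
  case: i ij => [_|i ij] /=.
    rewrite -BE; apply: (subvP (span_s1 _ _ _)) (sB t ts) => t' t's /eqP t'E.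
    rewrite t'E /wt /=; case: (t.2) => -[i l] e /=.
    by rewrite addnA -mulnDl; apply/eqP; congr (_ * _ + _)%N; rewrite mulnS addnCA -addnA.
  have i_s : (i < size s)%N by apply: ltn_trans js.
  by rewrite nth_s1 //= ab_a ?mem0v ?s_a // mem_nth.
- move=> p; rewrite inE => /predU1P[-> /=|/mapP[t ts ->] /=].
    have : \[x, y] \in label_span s predT.
      by rewrite /label_span filter_predT (span_basis s_basis).
    by apply/subvP/span_s1 => t _ _; apply: leq_trans (leq_addr _ _); rewrite ltn_mul2r /= addn3.
  rewrite -AE; apply: (subvP (span_s1 _ _ _)) (sA t ts) => t' t's.
  have := eps_lt t ts; have := s_lab t ts; have := s_lab t' t's.
  case: t t' {ts t's} => [u [[i l] e]] [u' [[i' l'] e']] /= [l'c _] [lc _] eN.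
  rewrite /label_lt /wt /= => /orP[H|/andP[/eqP H ee]].
    have : ((c - l + 2 * i + 3).+1 * N <= (c - l' + 2 * i' + 3) * N)%N.
      by rewrite leq_mul2r; apply/orP; right; lia.
    by rewrite mulSn; lia.
  have -> : (c - l + 2 * i = c - l' + 2 * i')%N by lia.
  by rewrite ltn_add2l; exact: ee.
Qed.

(** Any subspace between [L 1] and [a] is again an abelian ideal, and [dim_derived] leaves room for
    one of codimension exactly 2. *)
Lemma abelian_codim_le2 a : (1 < n)%N -> (forall u v, \[u, v] \in a) ->
  {in a &, forall u v, \[u, v] = 0} -> (n <= \dim a + 2)%N -> nontrivial_degeneration lam.
Proof.
move=> n1 br_a ab_a dim_a; have dL := dim_derived n1.
have La : (L 1 <= a)%VS by apply/bracketvP => u v _ _.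
have [|b [Lb ba db]] := intermediate_dim (k := (n - 2)%N) La.
  by apply/andP; split; [rewrite leq_subRL // addnC | rewrite leq_subLR addnC].
apply: (@abelian_codim2 b) => [u v|u v ub vb|]; last by rewrite db; lia.
  by apply: (subvP Lb); apply: mem_L1; apply: memvf.
by apply: ab_a; apply: (subvP ba).
Qed.

End AbelianIdeals.

(** * Membership in weight spaces *)

Section WeightSpanTools.
Variables (K : fieldType) (vT : vectType K).
Implicit Types (s : seq (vT * nat)) (Q : pred nat).

Lemma mem_weight_span s Q p : p \in s -> Q p.2 -> p.1 \in weight_span s Q.
Proof. by move=> ps Qp; apply/memv_span/mapP; exists p; rewrite // mem_filter Qp. Qed.

Lemma nth_weight_span s Q i (x0 : vT * nat) :
  (i < size s)%N -> Q (nth x0 s i).2 -> (nth x0 s i).1 \in weight_span s Q.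
Proof. by move=> ilt; apply: mem_weight_span; apply: mem_nth. Qed.

Lemma span_weight_span s Q (X : seq vT) v :
  v \in <<X>>%VS -> all (fun e => e \in weight_span s Q) X -> v \in weight_span s Q.
Proof. by move=> vX /allP XQ; apply: subvP v vX; apply/span_subvP. Qed.

Lemma span_consP e (X : seq vT) v :
  reflect (exists c, v - c *: e \in <<X>>%VS) (v \in <<e :: X>>%VS).
Proof.
rewrite span_cons; apply: (iffP memv_addP) => [[_ /vlineP[c ->] [w wX ->]]|[c vc]].
  by exists c; rewrite addrAC subrr add0r.
by exists (c *: e); [apply/vlineP; exists c | exists (v - c *: e); rewrite // addrC subrK].
Qed.

Lemma span2E (e1 e2 v : vT) : v \in <<[:: e1; e2]>>%VS -> exists a b, v = a *: e1 + b *: e2.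
Proof.
case/span_consP=> a; rewrite span_seq1 => /vlineP[b E]; exists a, b.
by rewrite -E addrC subrK.
Qed.

Lemma span3E (e1 e2 e3 v : vT) : v \in <<[:: e1; e2; e3]>>%VS ->
  exists a b c, v = a *: e1 + (b *: e2 + c *: e3).
Proof.
by case/span_consP=> a /span2E[b [c E]]; exists a, b, c; rewrite -E addrC subrK.
Qed.

Lemma span4E (e1 e2 e3 e4 v : vT) : v \in <<[:: e1; e2; e3; e4]>>%VS ->
  exists a b c d, v = a *: e1 + (b *: e2 + (c *: e3 + d *: e4)).
Proof.
by case/span_consP=> a /span3E[b [c [d E]]]; exists a, b, c, d; rewrite -E addrC subrK.
Qed.

End WeightSpanTools.

Ltac mem_span :=
  repeat first [ solve [apply: memv_span; rewrite !inE ?eqxx ?orbT //] | exact: mem0v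
    | apply: memvD | apply: memvB | apply: memvZ | rewrite memvN ].
Ltac nth_ws k :=
  match goal with |- context [weight_span ?s ?Q] =>
    solve [ exact: (@nth_weight_span _ _ s Q k (0, 0%N) isT isT)
          | apply: (@nth_weight_span _ _ s Q k (0, 0%N) isT); by rewrite /= ]
  end.
(** In dimension at most 7 a table has at most six weighted vectors, hence the indices 0 to 5. *)
Ltac mem_weight :=
  repeat first [ nth_ws 0%N | nth_ws 1%N | nth_ws 2%N | nth_ws 3%N | nth_ws 4%N | nth_ws 5%N
    | exact: mem0v | apply: memvD | apply: memvB | apply: memvZ | rewrite memvN ].
Ltac split_pairs :=
  move=> [|[|[|[|[|[|?]]]]]] [|[|[|[|[|[|?]]]]]] //=; rewrite ?andbF // => _.
Ltac split_all := apply/allP => /=; do ?[apply/andP; split] => //.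

Lemma dim_cV (K : fieldType) n : \dim (fullv : {vspace 'cV[K]_n}) = n.
Proof. by rewrite dimvf /dim /= muln1. Qed.

(** * Abelian ideals on which some (ad x)^3 is nonzero *)

Section Metabelian.
Variables (K : numFieldType) (n : nat) (lam : strconst K n).
Hypotheses (lie_lam : is_lie lam) (nil_lam : nilpotent_lie lam).
Local Notation "\[ x , y ]" := (bracket lam x y) (at level 0, x, y at level 99).
Local Notation L := (lower_central lam).
Variable a : {vspace 'cV[K]_n}.
Hypothesis br_a : forall u v, \[u, v] \in a.
Hypothesis ab_a : {in a &, forall u v, \[u, v] = 0}.
Hypothesis cent_a : forall y, {in a, forall v, \[y, v] = 0} -> y \in a.
Hypothesis codim_a : (\dim a + 3 <= n)%N.
Hypothesis n_le7 : (n <= 7)%N.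
Implicit Types (x y z u v w e : 'cV[K]_n) (U V W : {vspace 'cV[K]_n}).

Let brC := brC lie_lam.

Let dim_full : \dim (fullv : {vspace 'cV[K]_n}) = n.
Proof. by rewrite dimvf /dim /= muln1. Qed.

Lemma ad_comm x y v : v \in a -> \[x, \[y, v]] = \[y, \[x, v]].
Proof. by move=> va; rewrite (brJ lie_lam x y v) ab_a ?add0r. Qed.

Lemma ad_nilpotent y : exists k, forall v, lfun_iter (linfun (bracket lam y)) k v = 0.
Proof.
by have [k Lk] := nil_lam; exists k => v; apply/eqP; rewrite -memv0 -Lk ad_iter_L.
Qed.

(** Modulo [W], the [j]-th power of [ad y] multiplies [e] by [c ^+ j], and some power is zero. *)
Lemma ad_eigenvalue0 W y e c : (forall w, w \in W -> \[y, w] \in W) -> e \notin W ->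
  \[y, e] - c *: e \in W -> c = 0.
Proof.
move=> yW eW yeW; have [k yk] := ad_nilpotent y.
have H j : lfun_iter (linfun (bracket lam y)) j e - c ^+ j *: e \in W.
  elim: j => [|j IHj]; first by rewrite lfun_iter0 expr0 scale1r subrr mem0v.
  rewrite lfun_iterS lfunE /=; set w := lfun_iter _ _ _ in IHj *.
  have -> : \[y, w] - c ^+ j.+1 *: e =
      \[y, w - c ^+ j *: e] + c ^+ j *: (\[y, e] - c *: e).
    by rewrite exprSr bracketBr bracketZr; vec_ring.
  by rewrite memvD ?memvZ ?yW.
move: (H k); rewrite yk sub0r memvN rpredZeq (negPf eW) orbF expf_eq0.
by case/andP=> _ /eqP.
Qed.

Definition adl v : 'End('cV[K]_n) := - linfun (bracket lam v).

Lemma adlE v y : adl v y = \[y, v].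
Proof. by rewrite opp_lfunE lfunE /= -brC. Qed.

(* [fullv] is [ker (adl v)] plus a copy of the image. *)
Lemma dim_adl v : (\dim (lker (adl v)) + \dim (limg (adl v)))%N = n.
Proof. by have := limg_ker_dim (adl v) fullv; rewrite capfv dim_full. Qed.

Lemma free_ad_chain x v k : lfun_iter (linfun (bracket lam x)) k v != 0 ->
  lfun_iter (linfun (bracket lam x)) k.+1 v = 0 ->
  free [seq lfun_iter (linfun (bracket lam x)) j v | j <- iota 0 k.+1].
Proof.
set X := linfun _; elim: k v => [|k IHk] v v0 v1.
  by rewrite /= seq1_free.
rewrite -[iota 0 _]/(0%N :: iota 1 k.+1) map_cons free_cons; apply/andP; split.
  apply: contra v0 => vS; suff : (<<[seq lfun_iter X j v | j <- iota 1 k.+1]>> <=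
      lker (lfun_iter X k.+1))%VS.
    by rewrite lfun_iter0 in vS; move/subvP/(_ v vS); rewrite memv_ker.
  apply/span_subvP => _ /mapP[j + ->]; rewrite mem_iota => /andP[j0 _].
  rewrite memv_ker -lfun_iterD addnC -(prednK j0) addSnnS.
  by rewrite lfun_iterD v1 linear0.
have := IHk (X v); rewrite -!lfun_iterSr => /(_ v0 v1).
rewrite (iotaDl 1 0) -map_comp; congr (is_true (free _)).
by apply: eq_map => j /=; rewrite lfun_iterSr.
Qed.

(** As [dim a <= 4], [ad x] is one Jordan block on [a]. Nilpotent operators commuting with it are
    combinations of its first three powers, and codimension 3 makes all of them occur; [y] and [z]
    act as the square and the cube. *)
Lemma metabelian_cube x v : v \in a -> \[x, \[x, \[x, v]]] != 0 -> nontrivial_degeneration lam.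
Proof.
move=> va v3; pose X := linfun (bracket lam x); pose c j := lfun_iter X j v.
have [k Xk] := ad_nilpotent x.
have cS j : c j.+1 = \[x, c j] by rewrite /c lfun_iterS lfunE.
have c0 : c 0%N = v by rewrite /c lfun_iter0.
have ca j : c j \in a by case: j => [|j]; rewrite ?c0 // cS.
have exN : exists N, c N == 0 by exists k; rewrite /c Xk.
case: (ex_minnP exN) => N /eqP cN N_min.
have N_gt3 : (3 < N)%N.
  rewrite ltnNge; apply: contra v3 => N3; rewrite -c0 -!cS /c.
  by rewrite (lfun_iter_ge (k := N)).
have fr : free [seq c j | j <- iota 0 N].
  case: N cN N_min N_gt3 => // N cN N_min _; apply: free_ad_chain => //.
  by apply/negP => /N_min; rewrite ltnn.
have dim_a : (\dim a <= 4)%N by lia.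
have sub_a : (<<[seq c j | j <- iota 0 N]>> <= a)%VS.
  by apply/span_subvP => _ /mapP[j _ ->].
have N4 : N = 4.
  apply/eqP; rewrite eqn_leq N_gt3 (leq_trans _ dim_a) //.
  by have := dimvS sub_a; rewrite (eqP fr) size_map size_iota.
rewrite {N exN N_min N_gt3}N4 /= in cN fr sub_a.
have a_span : (a <= <<[:: c 0%N; c 1%N; c 2%N; c 3%N]>>)%VS.
  have /eqP <- // : (<<[:: c 0%N; c 1%N; c 2%N; c 3%N]>> == a)%VS.
  by rewrite eqEdim sub_a (eqP fr).
have a_coord w : w \in a -> exists d0 d1 d2 d3,
    w = d0 *: c 0%N + (d1 *: c 1%N + (d2 *: c 2%N + d3 *: c 3%N)).
  by move/(subvP a_span)/span4E.
have Xa w : w \in a -> \[x, w] \in <<[:: c 1%N; c 2%N; c 3%N]>>%VS.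
  case/a_coord=> d0 [d1 [d2 [d3 ->]]]; rewrite !bracketDr !bracketZr -!cS.
  by rewrite [c 4%N]cN scaler0 addr0; mem_span.
have actS y j : \[y, c j.+1] = \[x, \[y, c j]] by rewrite cS ad_comm.
have act y : \[y, c 0%N] \in <<[:: c 1%N; c 2%N; c 3%N]>>%VS.
  have [d0 [d1 [d2 [d3 E]]]] := a_coord _ (br_a y (c 0%N)).
  rewrite E (_ : d0 = 0) ?scale0r ?add0r; first by mem_span.
  apply: (@ad_eigenvalue0 <<[:: c 1%N; c 2%N; c 3%N]>> y (c 0%N)).
  - move=> w /span3E[t1 [t2 [t3 ->]]]; rewrite !bracketDr !bracketZr !actS.
    by apply: memvD; [|apply: memvD]; apply: memvZ; apply: Xa.
  - by move: fr; rewrite free_cons => /andP[].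
  - by rewrite E addrAC subrr add0r; mem_span.
(* [c 0] generates [a] under [ad x], which commutes with [ad y] on [a]; killing [c 0] means killing
   [a]. *)
have ker_a : (lker (adl (c 0%N)) <= a)%VS.
  apply/subvP => y; rewrite memv_ker adlE => /eqP y0; apply: cent_a => w wa.
  have yc j : \[y, c j] = 0.
    by elim: j => [//|j IHj]; rewrite cS ad_comm // IHj bracket0r.
  have : (a <= lker (linfun (bracket lam y)))%VS.
    apply: subv_trans a_span _; apply/span_subvP => u; rewrite !inE.
    by do ![case/predU1P=> [->|] | move/eqP => ->]; rewrite memv_ker lfunE /= yc.
  by move/subvP/(_ w wa); rewrite memv_ker lfunE => /eqP.
have img_act : (limg (adl (c 0%N)) == <<[:: c 1%N; c 2%N; c 3%N]>>)%VS.
  rewrite eqEdim; apply/andP; split.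
    by apply/subvP => _ /memv_imgP[y _ ->]; rewrite adlE.
  have d3 : (\dim <<[:: c 1%N; c 2%N; c 3%N]>> <= 3)%N by apply: dim_span.
  have dk := dimvS ker_a; have dn := dim_adl (c 0%N).
  have nat_le p q r t : (p + q = n -> p <= t -> t + 3 <= n -> r <= 3 -> r <= q)%N by lia.
  exact: nat_le dn dk codim_a d3.
have ex_act w : w \in <<[:: c 1%N; c 2%N; c 3%N]>>%VS -> exists y, \[y, c 0%N] = w.
  by rewrite -(eqP img_act) => /memv_imgP[y _ ->]; exists y; rewrite adlE.
have [y yE] : exists y, \[y, c 0%N] = c 2%N by apply: ex_act; mem_span.
have [z zE] : exists z, \[z, c 0%N] = c 3%N by apply: ex_act; mem_span.
have span_xyz : (fullv <= <<[:: x; y; z]>> + a)%VS.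
  apply/subvP => w _; have := act w.
  case/span3E=> t1 [t2 [t3 E]].
  rewrite -(subrK (t1 *: x + (t2 *: y + t3 *: z)) w) addrC memv_add //; first by mem_span.
  apply: (subvP ker_a); rewrite memv_ker adlE bracketBl !bracketDl !bracketZl.
  by rewrite E yE zE -cS subrr.
have [d0 [d1 [d2 [d3 xyE]]]] := a_coord _ (br_a x y).
(* Cancels the part of [[x, y]] in the image of [ad x]; a multiple of [c 0], of weight 1 + 2,
   remains. *)
pose y' := y - (d1 *: c 0%N + (d2 *: c 1%N + d3 *: c 2%N)).
have xy' : \[x, y'] = d0 *: c 0%N.
  by rewrite /y' bracketBr xyE !bracketDr !bracketZr -!cS; vec_ring.
have y'c j : \[y', c j] = \[y, c j].
  rewrite /y' bracketBl [X in _ - X]ab_a ?subr0 ?ca //.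
  by do ?[apply: memvD | apply: memvZ].
have y'0 : \[y', c 0%N] = c 2%N by rewrite y'c.
(* The acting vector is [z]: it sends [c 0] to [c 3], kills the other [c j], and its brackets with
   [x] and [y'] fall into [a], whose weights are larger. *)
apply: (@weighted_basis_degeneration _ _ _ z
  [:: (x, 1%N); (y', 2%N); (c 0%N, 3%N); (c 1%N, 4%N); (c 2%N, 5%N); (c 3%N, 6%N)]) => //=.
- have nat_eq t : (4 <= t -> t + 3 <= n -> 7 = n)%N by lia.
  by apply: nat_eq _ codim_a; have := dimvS sub_a; rewrite (eqP fr).
- apply: span_trans (sub_add_span span_xyz a_span) _ => /=.
  have -> : y = y' + (d1 *: c 0%N + (d2 *: c 1%N + d3 *: c 2%N)) by rewrite /y' subrK.
  by do ![apply/andP; split] => //; mem_span.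
- have x3 : \[x, c 3%N] = 0 by rewrite -cS [c 4%N]cN.
  have y'1 : \[y', c 1%N] = c 3%N by rewrite actS y'0 -cS.
  have y'2 : \[y', c 2%N] = 0 by rewrite actS y'1.
  have y'3 : \[y', c 3%N] = 0 by rewrite actS y'2 bracket0r.
  split_pairs; rewrite ?xy' ?x3 ?y'0 ?y'1 ?y'2 ?y'3 ?(ab_a (ca _) (ca _)) -?cS; mem_weight.
have z1 : \[z, c 1%N] = 0 by rewrite actS zE -cS [c 4%N]cN.
have zS j : \[z, c j.+1] = 0.
  by elim: j => [//|j IHj]; rewrite actS IHj bracket0r.
have za w (Q : pred nat) : Q 3%N -> Q 4%N -> Q 5%N -> Q 6%N -> \[z, w] \in weight_span
    [:: (x, 1%N); (y', 2%N); (c 0%N, 3%N); (c 1%N, 4%N); (c 2%N, 5%N); (c 3%N, 6%N)] Q.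
  move=> Q3 Q4 Q5 Q6; apply: (span_weight_span (subvP a_span _ (br_a z w))).
  by rewrite /= andbT; do ![apply/andP; split]; mem_weight.
split_all; rewrite ?zE ?zS; by [apply: za | mem_weight].
Qed.

End Metabelian.

(** * Abelian ideals on which all (ad x)^3 vanish and some (ad x)^2 does not *)

Section MetabelianSquare.
Variables (K : numFieldType) (n : nat) (lam : strconst K n).
Hypotheses (lie_lam : is_lie lam) (nil_lam : nilpotent_lie lam).
Local Notation "\[ x , y ]" := (bracket lam x y) (at level 0, x, y at level 99).
Variable a : {vspace 'cV[K]_n}.
Hypothesis br_a : forall u v, \[u, v] \in a.
Hypothesis ab_a : {in a &, forall u v, \[u, v] = 0}.
Hypothesis cent_a : forall y, {in a, forall v, \[y, v] = 0} -> y \in a.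
Hypothesis codim_a : (\dim a + 3 <= n)%N.
Hypothesis n_le7 : (n <= 7)%N.
Hypothesis cube0 : forall x, {in a, forall v, \[x, \[x, \[x, v]]] = 0}.
Implicit Types (x y z u v w e : 'cV[K]_n) (U V W : {vspace 'cV[K]_n}).

Let ad_comm := ad_comm lie_lam br_a ab_a.

Lemma metabelian_square x e0 : e0 \in a -> \[x, \[x, e0]] != 0 -> nontrivial_degeneration lam.
Proof.
move=> va v2; pose X := linfun (bracket lam x).
have [e1 xe0] : exists e1, \[x, e0] = e1 by exists \[x, e0].
have [e2 xe1] : exists e2, \[x, e1] = e2 by exists \[x, e1].
rewrite xe0 xe1 in v2.
have xe2 : \[x, e2] = 0 by rewrite -xe1 -xe0 cube0.
have e1a : e1 \in a by rewrite -xe0.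
have e2a : e2 \in a by rewrite -xe1.
have yE1 y : \[y, e1] = \[x, \[y, e0]] by rewrite -xe0 (ad_comm y x).
have yE2 y : \[y, e2] = \[x, \[y, e1]] by rewrite -xe1 (ad_comm y x).
have fr : free [:: e0; e1; e2].
  have XS k w : lfun_iter X k.+1 w = \[x, lfun_iter X k w] by rewrite lfun_iterS lfunE.
  have := @free_ad_chain _ _ lam x e0 2; rewrite -[iota 0 3]/[:: 0; 1; 2]%N !map_cons.
  by rewrite !XS !lfun_iter0 xe0 xe1 xe2; apply.
have dim_a : (\dim a <= 4)%N by lia.
have sub_a : (<<[:: e0; e1; e2]>> <= a)%VS.
  by apply/span_subvP => w; rewrite !inE => /or3P[] /eqP ->.
have act_ker y : \[y, e0] = 0 -> \[y, e1] = 0 /\ \[y, e2] = 0.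
  by move=> ye0; rewrite yE2 yE1 ye0 !bracket0r.
have e0W : e0 \notin <<[:: e1; e2]>>%VS by move: fr; rewrite free_cons => /andP[].
have dim_a3 : (3 <= \dim a)%N by have := dimvS sub_a; rewrite (eqP fr).
have d2 : (\dim <<[:: e1; e2]>> <= 2)%N by apply: dim_span.
(* If [a] were spanned by [e0, e1, e2], then [y] would be determined modulo
   [a] by [y e0], which lies in the span of [e1] and [e2]. *)
have nsub : ~~ (a <= <<[:: e0; e1; e2]>>)%VS.
  apply/negP => /subvP a_span.
  have Xa w : w \in a -> \[x, w] \in <<[:: e1; e2]>>%VS.
    move/a_span/span3E=> [t0 [t1 [t2 ->]]]; rewrite !bracketDr !bracketZr xe0 xe1 xe2.
    by mem_span.
  have act y : \[y, e0] \in <<[:: e1; e2]>>%VS.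
    have [t0 [t1 [t2 E]]] := span3E (a_span _ (br_a y e0)).
    rewrite E (_ : t0 = 0) ?scale0r ?add0r; first by mem_span.
    apply: (ad_eigenvalue0 nil_lam _ e0W (y := y)).
      move=> w /span2E[s1 [s2 ->]]; rewrite bracketDr !bracketZr !yE2 !yE1.
      by apply: memvD; apply: memvZ; apply: Xa.
    by rewrite E addrAC subrr add0r; mem_span.
  have ker_a : (lker (adl lam e0) <= a)%VS.
    apply/subvP => y; rewrite memv_ker adlE // => /eqP y0; apply: cent_a => w.
    have [y1 y2] := act_ker y y0.
    move/a_span/span3E=> [t0 [t1 [t2 ->]]].
    by rewrite !bracketDr !bracketZr y0 y1 y2 !scaler0 !addr0.
  have img : (limg (adl lam e0) <= <<[:: e1; e2]>>)%VS.
    by apply/subvP => _ /memv_imgP[y _ ->]; rewrite adlE.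
  have nat_lt k p q r t :
    (p + q = k -> p <= t -> q <= r -> r <= 2 -> t + 3 <= k -> False)%N by clear; lia.
  exact: nat_lt (dim_adl lam e0) (dimvS ker_a) (dimvS img) d2 codim_a.
have [u0 u0a u0e] := subvPn nsub.
have a_span0 : (a <= <<[:: u0; e0; e1; e2]>>)%VS.
  have fr' : free [:: u0; e0; e1; e2] by rewrite free_cons u0e fr.
  have /eqP <- // : (<<[:: u0; e0; e1; e2]>> == a)%VS.
  rewrite eqEdim (eqP fr') dim_a andbT; apply/span_subvP => w.
  by rewrite inE => /predU1P[->//|wS]; apply: (subvP sub_a); apply: memv_span.
have dim_a4 : \dim a = 4.
  apply/eqP; rewrite eqn_leq dim_a ltn_neqAle dim_a3 andbT.
  apply: contra nsub => /eqP d3; suff /eqP -> : (<<[:: e0; e1; e2]>> == a)%VS by apply: subvv.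
  by rewrite eqEdim sub_a -d3 (eqP fr).
have [d [t0 [t1 [t2 xu0]]]] := span4E (subvP a_span0 _ (br_a x u0)).
have d0 : d = 0.
  apply: (ad_eigenvalue0 nil_lam _ u0e (y := x)).
    move=> w /span3E[s0 [s1 [s2 ->]]].
    by rewrite !bracketDr !bracketZr xe0 xe1 xe2; mem_span.
  by rewrite xu0 addrAC subrr add0r; mem_span.
rewrite d0 scale0r add0r {d0 d} in xu0.
(* A nonzero [t0] would lengthen the chain and give a nonzero cube of [ad x] at [u0]. *)
have t00 : t0 = 0.
  have := cube0 x u0a; rewrite xu0 !bracketDr !bracketZr xe0 xe1 xe2.
  rewrite !bracket0r !scaler0 !addr0 => /eqP; rewrite scaler_eq0 (negPf v2) orbF.
  by move/eqP.
rewrite t00 scale0r add0r {t00 t0} in xu0.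
(* Now [ad x] has Jordan blocks of sizes 3 and 1 on [a]. *)
pose u := u0 - (t1 *: e0 + t2 *: e1).
have xu : \[x, u] = 0 by rewrite /u bracketBr xu0 bracketDr !bracketZr xe0 xe1 subrr.
have ua : u \in a by rewrite /u; apply: memvB => //; apply: memvD; apply: memvZ.
have a_span : (a <= <<[:: e0; e1; e2; u]>>)%VS.
  apply: span_trans a_span0 _ => /=.
  have -> : u0 = u + (t1 *: e0 + t2 *: e1) by rewrite /u subrK.
  by do ![apply/andP; split] => //; mem_span.
have a_coord w : w \in a -> exists s0 s1 s2 s3,
    w = s0 *: e0 + (s1 *: e1 + (s2 *: e2 + s3 *: u)).
  by move/(subvP a_span)/span4E.
have fr4 : free [:: e0; e1; e2; u].
  rewrite /free eqn_leq dim_span /=; have := dimvS a_span; rewrite dim_a4; exact.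
have xa w : w \in a -> \[x, w] \in <<[:: e1; e2]>>%VS.
  move/a_coord=> [s0 [s1 [s2 [s3 ->]]]].
  by rewrite !bracketDr !bracketZr xe0 xe1 xe2 xu; mem_span.
have ker_x w : w \in a -> \[x, w] = 0 -> w \in <<[:: e2; u]>>%VS.
  move/a_coord=> [s0 [s1 [s2 [s3 ->]]]]; rewrite !bracketDr !bracketZr xe1 xe2 xu.
  rewrite xe0 !scaler0 !addr0 => E.
  have fr12 : free [:: e1; e2] by move: fr; rewrite free_cons => /andP[].
  have [s00 s10] : s0 = 0 /\ s1 = 0.
    have := elimT (@freeP _ _ _ [tuple e1; e2]) fr12 (fun i => nth 0 [:: s0; s1] i).
    rewrite !big_ord_recl big_ord0 /= addr0 => /(_ E) H.
    by split; [apply: (H ord0) | apply: (H (lift ord0 ord0))].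
  by rewrite s00 s10 !scale0r !add0r; mem_span.
have e2W : u \notin <<[:: e2]>>%VS.
  apply: contra nsub; rewrite span_seq1 => /vlineP[q uq]; apply: span_trans a_span _ => /=.
  by rewrite uq; do ![apply/andP; split] => //; mem_span.
(* The nilpotent commutant of [ad x]: [[y, u]] is killed by [ad x], hence in the span of [e2] and
   [u], and the two diagonal coefficients vanish by nilpotency. *)
have act y : exists c1 c2 g d, \[y, e0] = c1 *: e1 + c2 *: e2 + g *: u /\ \[y, u] = d *: e2.
  have e0W' : e0 \notin <<[:: e1; e2; u]>>%VS by move: fr4; rewrite free_cons => /andP[].
  have yu : \[y, u] \in <<[:: e2; u]>>%VS.
    by apply: ker_x => //; rewrite ad_comm // xu bracket0r.
  have [d [r yuE]] := span2E yu.
  have [s0 [s1 [s2 [s3 E]]]] := a_coord _ (br_a y e0).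
  have s00 : s0 = 0.
    apply: (ad_eigenvalue0 nil_lam _ e0W' (y := y)).
      move=> w /span3E[q1 [q2 [q3 ->]]]; rewrite !bracketDr !bracketZr yuE.
      have [y1 y2] : \[y, e1] \in <<[:: e1; e2]>>%VS /\ \[y, e2] \in <<[:: e1; e2]>>%VS.
        by rewrite !yE2 !yE1; split; apply: xa.
      have sub : (<<[:: e1; e2]>> <= <<[:: e1; e2; u]>>)%VS.
        by apply: sub_span => w'; rewrite !inE => /orP[] ->; rewrite ?orbT.
      apply: memvD; first by apply/memvZ/(subvP sub).
      by apply: memvD; [apply/memvZ/(subvP sub) | mem_span].
    by rewrite E addrAC subrr add0r; mem_span.
  have r0 : r = 0.
    apply: (ad_eigenvalue0 nil_lam _ e2W (y := y)).
      move=> w; rewrite span_seq1 => /vlineP[q ->]; rewrite bracketZr !yE2 !yE1.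
      rewrite E s00 scale0r add0r !bracketDr !bracketZr !xe1 xe2 xu.
      by rewrite !bracket0r !scaler0 !addr0 scaler0 mem0v.
    by rewrite yuE addrK; mem_span.
  exists s1, s2, s3, d; rewrite E s00 yuE r0 !scale0r add0r addr0.
  by rewrite addrA.
have cent y : \[y, e0] = 0 -> \[y, u] = 0 -> y \in a.
  move=> y0 yu; have [y1 y2] := act_ker y y0; apply: cent_a => w.
  move/a_coord=> [s0 [s1 [s2 [s3 ->]]]].
  by rewrite !bracketDr !bracketZr y0 y1 y2 yu !scaler0 !addr0.
have n7 : n = 7.
  have nat_eq (k t : nat) : (k <= 7 -> t = 4 -> t + 3 <= k -> k = 7)%N by clear; lia.
  exact: nat_eq n_le7 dim_a4 codim_a.
have xNa : x \notin a.
  by apply: contra v2 => xa'; rewrite -xe1 ab_a.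
have [Z szZ [spanZ _]] := generators_mod (subvf (<[x]> + a)%VS).
have {szZ} : size Z = 2.
  by rewrite szZ dim_cV dimv_add_line // dim_a4; move: n7; clear => ->.
case: Z spanZ => [|p [|q []]] // spanZ _.
have norm y : exists y' c1 c g d, [/\ y' = y - c1 *: x, \[y', e0] = c *: e2 + g *: u
    & \[y', u] = d *: e2].
  have [c1 [c2 [g [d [ye0 yu]]]]] := act y; exists (y - c1 *: x), c1, c2, g, d; split=> //.
    by rewrite bracketBl bracketZl ye0 xe0; vec_ring.
  by rewrite bracketBl bracketZl yu xu; vec_ring.
have act2 y c g : \[y, e0] = c *: e2 + g *: u -> \[y, e2] = 0.
  move=> E; rewrite !yE2 !yE1 E bracketDr !bracketZr xe2 xu.
  by rewrite !scaler0 addr0 bracket0r.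
have [p' [cp [p2 [gp [dp [p'E p'e0 p'u]]]]]] := norm p.
have [q' [cq [q2 [gq [dq [q'E q'e0 q'u]]]]]] := norm q.
(* Commutation of [ad p'] and [ad q'], evaluated at [e0]. *)
have gd : gq * dp = gp * dq.
  have := ad_comm p' q' va; rewrite p'e0 q'e0 !bracketDr !bracketZr.
  rewrite (act2 _ _ _ p'e0) (act2 _ _ _ q'e0) p'u q'u !scaler0 !add0r !scalerA.
  by move/eqP; rewrite -subr_eq0 -scalerBl scaler_eq0 (negPf v2) orbF subr_eq0 => /eqP.
have span_pq : (fullv <= <<[:: x; p'; q']>> + a)%VS.
  have -> : (<<[:: x; p'; q']>> + a)%VS = (<<[:: p'; q'; x]>> + a)%VS.
    by congr (_ + _)%VS; apply: eq_span => w; rewrite !inE orbC orbA.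
  apply: subv_trans spanZ _; rewrite -span_seq1 addvA -span_cat.
  apply: addvS => //; apply/span_subvP => w; rewrite !inE => /or3P[] /eqP ->; last by mem_span.
    by rewrite -(subrK (cp *: x) p) -p'E; mem_span.
  by rewrite -(subrK (cq *: x) q) -q'E; mem_span.
(* By [gd] the pairs [(gp, dp)] and [(gq, dq)] are proportional, so some combination [z0] has
   neither coefficient and acts on [a] as a multiple of the square of [ad x]. *)
have [z0 [y [zeta [c [g [d [span_yz z0e0 z0u [ye0 yu]]]]]]]] :
    exists z0 y zeta c g d, [/\ (fullv <= <<[:: x; y; z0]>> + a)%VS,
      \[z0, e0] = zeta *: e2, \[z0, u] = 0
    & \[y, e0] = c *: e2 + g *: u /\ \[y, u] = d *: e2].
  have combine t : gq = t * gp -> dq = t * dp ->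
      exists z0 y zeta c g d, [/\ (fullv <= <<[:: x; y; z0]>> + a)%VS,
      \[z0, e0] = zeta *: e2, \[z0, u] = 0
    & \[y, e0] = c *: e2 + g *: u /\ \[y, u] = d *: e2].
    move=> gqE dqE; exists (q' - t *: p'), p', (q2 - t * p2), p2, gp, dp; split=> //.
    - apply: subv_trans span_pq _; apply: addvS => //; apply/span_subvP => w.
      rewrite !inE => /or3P[] /eqP ->; [by mem_span | by mem_span |].
      by rewrite -[X in X \in _](subrK (t *: p')); mem_span.
    - by rewrite bracketBl bracketZl p'e0 q'e0 gqE; vec_ring.
    - by rewrite bracketBl bracketZl p'u q'u dqE; vec_ring.
  have [gp0|gp0] := eqVneq gp 0; last first.
    apply: (combine (gq / gp)); first by rewrite divfK.
    by apply: (mulfI gp0); rewrite -gd mulrA mulrCA divff ?mulr1.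
  have [dp0|dp0] := eqVneq dp 0; last first.
    apply: (combine (dq / dp)); last by rewrite divfK.
    by apply: (mulIf dp0); rewrite gd gp0 !(mul0r, mulr0).
  exists p', q', p2, q2, gq, dq; split=> //.
  - apply: subv_trans span_pq _; apply: addvS => //; apply: sub_span => w.
    by rewrite !inE => /or3P[] ->; rewrite ?orbT.
  - by rewrite p'e0 gp0 scale0r addr0.
  - by rewrite p'u dp0 scale0r.
have zeta0 : zeta != 0.
  apply/negP => /eqP zeta0; have z0a : z0 \in a by apply: cent; rewrite ?z0u // z0e0 zeta0 scale0r.
  have : (fullv <= <<[:: x; y]>> + a)%VS.
    apply: subv_trans span_yz _; rewrite subv_add addvSr andbT; apply/span_subvP => w.
    rewrite !inE => /or3P[] /eqP ->.
    - by apply: (subvP (addvSl _ _)); mem_span.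
    - by apply: (subvP (addvSl _ _)); mem_span.
    - exact: (subvP (addvSr _ _)).
  move=> full; have nat_lt k k1 k2 k3 k4 :
    (k = 7 -> k1 = k -> k1 <= k2 -> k2 <= k3 + k4 -> k3 <= 2 -> k4 = 4 -> False)%N by clear; lia.
  exact: nat_lt n7 (dim_cV K n) (dimvS full) (dimv_add_leqif _ _).1 (dim_span _) dim_a4.
pose z := zeta^-1 *: z0.
have ze0 : \[z, e0] = e2 by rewrite bracketZl z0e0 scalerA mulVf // scale1r.
have zu : \[z, u] = 0 by rewrite bracketZl z0u scaler0.
have {}span_yz : (fullv <= <<[:: x; y; z]>> + a)%VS.
  apply: subv_trans span_yz _; apply: addvS => //; apply/span_subvP => w.
  rewrite !inE => /or3P[] /eqP ->; [by mem_span | by mem_span |].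
  by rewrite -[z0]scale1r -(divff zeta0) -scalerA; mem_span.
have [tau [r1 [r2 [om xzE]]]] := a_coord _ (br_a x z).
pose z' := z - (r1 *: e0 + r2 *: e1).
have z'a w : w \in a -> \[z', w] = \[z, w].
  move=> wa; rewrite bracketBl [X in _ - X]ab_a ?subr0 //.
  by apply: memvD; apply: memvZ.
have xz' : \[x, z'] = tau *: e0 + om *: u.
  by rewrite bracketBr xzE bracketDr !bracketZr xe0 xe1; vec_ring.
have z'e0 : \[z', e0] = e2 by rewrite z'a.
have z'e1 : \[z', e1] = 0 by rewrite z'a // yE1 ze0 xe2.
have z'e2 : \[z', e2] = 0 by rewrite z'a // yE2 -(z'a _ e1a) z'e1 bracket0r.
have z'u : \[z', u] = 0 by rewrite z'a.
have ye1 : \[y, e1] = 0 by rewrite yE1 ye0 bracketDr !bracketZr xe2 xu !scaler0 addr0.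
have ye2 := act2 _ _ _ ye0.
have span_all : (fullv <= <<[:: x; y; z'; e0; e1; e2; u]>>)%VS.
  apply: span_trans (sub_add_span span_yz a_span) _ => /=.
  have -> : z = z' + (r1 *: e0 + r2 *: e1) by rewrite /z' subrK.
  by do ![apply/andP; split] => //; mem_span.
(* [[x, z']] must be homogeneous while [ad y] has to raise [e0] to [u]. If [tau] vanishes, only [u]
   is tied to [x] and [z']. Otherwise [[x, z']] itself replaces [e0] as head of the chain, which
   frees the weight of [u]. *)
have [tau0|tau0] := eqVneq tau 0.
  rewrite tau0 scale0r add0r in xz'.
  pose s := [:: (x, 2%N); (z', 4%N); (e0, 5%N); (e1, 7%N); (e2, 9%N); (u, 6%N)].
  apply: (@weighted_basis_degeneration _ _ _ y s) => //=.
  - apply: span_trans span_all _ => /=.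
    by do ![apply/andP; split] => //; mem_span.
  - split_pairs; rewrite ?xz' ?xe0 ?xe1 ?xe2 ?xu ?z'e0 ?z'e1 ?z'e2 ?z'u ?ab_a //; mem_weight.
  have ya w (Q : pred nat) : Q 5%N -> Q 7%N -> Q 9%N -> Q 6%N -> \[y, w] \in weight_span s Q.
    move=> Q5 Q7 Q9 Q6; apply: (span_weight_span (subvP a_span _ (br_a y w))).
    by rewrite /= andbT; do ![apply/andP; split]; mem_weight.
  by split_all; rewrite ?ye0 ?ye1 ?ye2 ?yu; [apply: ya | apply: ya | | | |]; mem_weight.
pose f0 := \[x, z']; pose f1 := tau *: e1; pose f2 := tau *: e2.
have f0a : f0 \in a by apply: br_a.
have f1a : f1 \in a by apply: memvZ.
have f2a : f2 \in a by apply: memvZ.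
have xf0 : \[x, f0] = f1 by rewrite /f0 xz' bracketDr !bracketZr xu xe0 scaler0 addr0.
have xf1 : \[x, f1] = f2 by rewrite bracketZr xe1.
have xf2 : \[x, f2] = 0 by rewrite bracketZr xe2 scaler0.
have z'f0 : \[z', f0] = f2 by rewrite /f0 xz' bracketDr !bracketZr z'u z'e0 scaler0 addr0.
have z'f1 : \[z', f1] = 0 by rewrite bracketZr z'e1 scaler0.
have z'f2 : \[z', f2] = 0 by rewrite bracketZr z'e2 scaler0.
have yf1 : \[y, f1] = 0 by rewrite bracketZr ye1 scaler0.
have yf2 : \[y, f2] = 0 by rewrite bracketZr ye2 scaler0.
have e2f : e2 = tau^-1 *: f2 by rewrite scalerA mulVf // scale1r.
have e1f : e1 = tau^-1 *: f1 by rewrite scalerA mulVf // scale1r.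
have e0f : e0 = tau^-1 *: (f0 - om *: u) by rewrite /f0 xz' addrK scalerA mulVf // scale1r.
have yf0 : \[y, f0] = (tau * g) *: u + (c + om * d / tau) *: f2.
  rewrite /f0 xz' bracketDr !bracketZr yu ye0 e2f.
  by apply/colP => i; rewrite !cvE; field.
have yu' : \[y, u] = (d / tau) *: f2 by rewrite yu e2f scalerA.
have xz'0 : \[x, z'] = f0 by [].
pose s := [:: (x, 2%N); (z', 4%N); (f0, 6%N); (f1, 8%N); (f2, 10%N); (u, 7%N)].
have a_span' : (a <= <<[:: f0; f1; f2; u]>>)%VS.
  apply: span_trans a_span _ => /=.
  by rewrite e0f e1f e2f; do ![apply/andP; split] => //; mem_span.
apply: (@weighted_basis_degeneration _ _ _ y s) => //=.
- apply: span_trans span_all _ => /=.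
  by rewrite e0f e1f e2f; do ![apply/andP; split] => //; mem_span.
- split_pairs; rewrite ?xz'0 ?xf0 ?xf1 ?xf2 ?xu ?z'f0 ?z'f1 ?z'f2 ?z'u ?ab_a //; mem_weight.
have ya w (Q : pred nat) : Q 6%N -> Q 8%N -> Q 10%N -> Q 7%N -> \[y, w] \in weight_span s Q.
  move=> Q6 Q8 Q10 Q7; apply: (span_weight_span (subvP a_span' _ (br_a y w))).
  by rewrite /= andbT; do ![apply/andP; split]; mem_weight.
by split_all; rewrite ?yf0 ?yf1 ?yf2 ?yu'; [apply: ya | apply: ya | | | |]; mem_weight.
Qed.

End MetabelianSquare.

Lemma weighted_basis_degeneration_in (K : numFieldType) n (lam : strconst K n)
    (x : 'cV[K]_n) (s : seq ('cV[K]_n * nat)) :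
    is_lie lam -> nilpotent_lie lam ->
    (size s).+1 = n -> (fullv <= <<x :: map fst s>>)%VS ->
    {in s &, forall p q, bracket lam p.1 q.1 \in weight_span s (pred1 (p.2 + q.2)%N)} ->
    {in s, forall p, bracket lam x p.1 \in weight_span s (fun k => (p.2 < k)%N)} ->
    has (fun p => 0 < p.2)%N s ->
  nontrivial_degeneration lam.
Proof.
move=> lie_lam nil_lam sz_s span_s graded raising has_weight.
apply: (@weighted_basis_degeneration _ _ _ x s) => // i j /andP[ij js].
by apply: graded; apply: mem_nth; rewrite // (ltn_trans ij).
Qed.

(** * Two-step algebras, and abelian ideals on which all (ad x)^2 vanish *)

Section SquareZero.
Variables (K : numFieldType) (n : nat) (lam : strconst K n).
Hypotheses (lie_lam : is_lie lam) (nil_lam : nilpotent_lie lam).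
Local Notation "\[ x , y ]" := (bracket lam x y) (at level 0, x, y at level 99).
Local Notation L := (lower_central lam).
Implicit Types (x y z u v w e : 'cV[K]_n) (U V W : {vspace 'cV[K]_n}).

(** One generator acts; the other generators have weight 1 and the derived algebra weight 2. *)
Lemma two_step_degeneration :
  (1 < n)%N -> (forall u v w, \[u, \[v, w]] = 0) -> nontrivial_degeneration lam.
Proof.
move=> n1 br2; have [X szX [fX _]] := generators_mod (LS lam 0).
have {}szX : size X = (n - \dim (L 1))%N by rewrite szX [\dim (L 0)]dim_cV.
have dL := dim_derived lie_lam nil_lam n1.
have : (1 < size X)%N by rewrite szX ltn_subRL -addn1 -addnA.
case: X szX fX => [|x [|y Y]] szX fX // _.
pose s := [seq (v, 1%N) | v <- y :: Y] ++ [seq (v, 2%N) | v <- vbasis (L 1)].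
have fst1 k (Z : seq 'cV[K]_n) : map fst [seq (v, k : nat) | v <- Z] = Z.
  by rewrite -map_comp map_id.
have L1_span v (Q : pred nat) : v \in L 1 -> Q 2%N -> v \in weight_span s Q.
  move=> vL Q2; apply: (subvP _ v vL); rewrite -{1}(span_basis (vbasisP (L 1))).
  apply/span_subvP => w wL; apply: (@mem_weight_span _ _ _ _ (w, 2%N)) => //.
  by rewrite mem_cat map_f ?orbT.
have kill u v : v \in L 1 -> \[u, v] = 0.
  elim/(@bracketv_ind _ _ lam fullv fullv) => [|c v1 v2 E1 E2|v1 v2 _ _]; last exact: br2.
    exact: bracket0r.
  by rewrite bracketDr bracketZr E1 E2 scaler0 addr0.
have br1 u v : \[u, v] \in L 1 by apply: mem_bracketv; apply: memvf.
have s_case p : p \in s -> p.2 = 1%N \/ p.1 \in L 1.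
  rewrite mem_cat => /orP[] /mapP[v vS ->] /=; first by left.
  by right; apply: vbasis_mem.
apply: (@weighted_basis_degeneration_in _ _ _ x s) => //.
- have nat_eq k d c : (d + 2 <= k -> c.+2 = k - d -> (c.+1 + d).+1 = k)%N by clear; lia.
  by rewrite size_cat !size_map size_tuple; apply: nat_eq dL szX.
- rewrite /s map_cat !fst1; apply: (sub_add_span (X := x :: y :: Y) fX).
  by rewrite (span_basis (vbasisP _)) subvv.
- move=> p q /s_case[p1|pL] /s_case[q1|qL].
  + by rewrite p1 q1; apply: L1_span.
  + by rewrite kill // mem0v.
  + by rewrite brC // kill // oppr0 mem0v.
  + by rewrite kill // mem0v.
move=> p /s_case[p1|pL]; last by rewrite kill // mem0v.
by apply: L1_span => //; rewrite p1.
Qed.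

Variable a : {vspace 'cV[K]_n}.
Hypothesis br_a : forall u v, \[u, v] \in a.
Hypothesis ab_a : {in a &, forall u v, \[u, v] = 0}.
Hypothesis cent_a : forall y, {in a, forall v, \[y, v] = 0} -> y \in a.
Hypothesis codim_a : (\dim a + 3 <= n)%N.
Hypothesis n_le7 : (n <= 7)%N.
Hypothesis square0 : forall x, {in a, forall v, \[x, \[x, v]] = 0}.

Let brC := brC lie_lam.
Let brxx := brxx lie_lam.
Let ad_comm := ad_comm lie_lam br_a ab_a.
Let I := bracketv lam fullv a.

(** Polarization of [square0], the operators commuting on [a]. *)
Let mul0 x y v : v \in a -> \[x, \[y, v]] = 0.
Proof.
move=> va; have := square0 (x + y) va.
rewrite !bracketDl !bracketDr !square0 // add0r addr0 (ad_comm y x) //.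
by rewrite -mulr2n => /eqP; rewrite -scaler_nat scaler_eq0 pnatr_eq0 => /eqP.
Qed.

Let memI x v : v \in a -> \[x, v] \in I.
Proof. by move=> va; apply: mem_bracketv => //; apply: memvf. Qed.

Let killI x v : v \in I -> \[x, v] = 0.
Proof.
elim/(@bracketv_ind _ _ lam fullv a) => [|c v1 v2 E1 E2|y w _ wa]; last exact: mul0.
  exact: bracket0r.
by rewrite bracketDr bracketZr E1 E2 scaler0 addr0.
Qed.

Let Ia : (I <= a)%VS.
Proof. by apply/bracketvP => x v _ _. Qed.

(** Centralizing one more element of [a] cuts the dimension by at most [\dim I], since all its
    brackets lie in [I]. *)
Let centralizer_bound (E : seq 'cV[K]_n) : {subset E <= a} ->
  (forall y, {in E, forall e, \[y, e] = 0} -> y \in a) ->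
  (n <= size E * \dim I + \dim a)%N.
Proof.
move=> Ea centE; pose C := foldr (fun e V => V :&: lker (adl lam e))%VS fullv.
have CE : (C E <= a)%VS.
  apply/subvP => y yC; apply: centE => e eE; elim: E yC eE {Ea} => //= e' E IHE.
  rewrite memv_cap memv_ker adlE // inE => /andP[yC /eqP ye'] /predU1P[->//|].
  exact: IHE.
apply: leq_trans (leq_add (leqnn _) (dimvS CE)).
elim: E Ea {CE centE} => /= [_|e E IHE Ea]; first by rewrite mul0n dim_cV.
have /IHE {}IHE : {subset E <= a} by move=> v vE; apply: Ea; rewrite inE vE orbT.
apply: leq_trans IHE _; rewrite -(limg_ker_dim (adl lam e) (C E)) mulSn.
have : (\dim (adl lam e @: C E) <= \dim I)%N.
  apply: dimvS; apply/subvP => _ /memv_imgP[y _ ->]; rewrite adlE //.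
  by apply: memI; apply: Ea; rewrite inE eqxx.
have nat_le p k d i : (d <= i -> p + (k + d) <= i + p + k)%N by clear; lia.
exact: nat_le.
Qed.

(* [I = [n, a]] satisfies [[n, I] = 0]. If an inner [x3] maps [a] onto [I],
   correcting [x2] by an element of [a] moves [[x2, x3]] into a complement of
   [I], and the ideal gets weights 1, 2, 3. *)
Let onto_degeneration x3 : \dim a = 4 -> n = 7 -> (I <= linfun (bracket lam x3) @: a)%VS ->
  I != 0%VS -> nontrivial_degeneration lam.
Proof.
move=> dim_a4 n7 onto Inz.
have x3a : x3 \notin a.
  apply: contra Inz => x3a; rewrite -subv0; apply: subv_trans onto _.
  by apply/subvP => _ /memv_imgP[v va ->]; rewrite lfunE /= ab_a // mem0v.
have [Z szZ [spanZ _]] := generators_mod (subvf (<[x3]> + a)%VS).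
have {szZ} : size Z = 2.
  by rewrite szZ dim_cV dimv_add_line // dim_a4; move: n7; clear => ->.
case: Z spanZ => [|x1 [|x2 []]] // spanZ _.
have [e [w [ea wI xxE]]] : exists e w, [/\ e \in (a :\: I)%VS, w \in I & \[x2, x3] = e + w].
  have : \[x2, x3] \in (a :\: I + I)%VS by rewrite addv_diff (addv_idPl Ia).
  by case/memv_addP => e eE [w wI ->]; exists e, w.
have /memv_imgP[b ba wE] := subvP onto w wI; rewrite lfunE /= in wE.
pose x2' := x2 + b.
have x23 : \[x2', x3] = e.
  by rewrite /x2' bracketDl xxE (brC b) -wE; vec_ring.
pose E := vbasis (a :\: I)%VS.
pose s := [:: (x2', 1%N); (x3, 1%N)] ++ [seq (v, 2%N) | v <- E] ++ [seq (v, 3%N) | v <- vbasis I].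
have fst1 k (Z : seq 'cV[K]_n) : map fst [seq (v, k : nat) | v <- Z] = Z.
  by rewrite -map_comp map_id.
have Ea : {subset E <= a} by move=> v /vbasis_mem; apply/subvP/diffvSl.
have E_span v (Q : pred nat) : v \in (a :\: I)%VS -> Q 2%N -> v \in weight_span s Q.
  move=> vE Q2; apply: (span_weight_span (X := E)); first by rewrite (span_basis (vbasisP _)).
  apply/allP => v' v'E; apply: (@mem_weight_span _ _ _ _ (v', 2%N)) => //.
  by rewrite !mem_cat map_f ?orbT.
have I_span v (Q : pred nat) : v \in I -> Q 3%N -> v \in weight_span s Q.
  move=> vI Q3; apply: (span_weight_span (X := vbasis I)).
    by rewrite (span_basis (vbasisP _)).
  apply/allP => v' v'I; apply: (@mem_weight_span _ _ _ _ (v', 3%N)) => //.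
  by rewrite !mem_cat map_f ?orbT.
have a_span v (Q : pred nat) : v \in a -> Q 2%N -> Q 3%N -> v \in weight_span s Q.
  move=> va Q2 Q3; have : v \in (a :\: I + I)%VS by rewrite addv_diff (addv_idPl Ia).
  by case/memv_addP => e' e'E [w' w'I ->]; apply: memvD; [apply: E_span | apply: I_span].
have s_case p : p \in s -> [\/ p = (x2', 1%N) \/ p = (x3, 1%N), p.1 \in a /\ p.2 = 2%N | p.1 \in I].
  rewrite !mem_cat !inE => /or3P[/orP[]/eqP ->|/mapP[v vE ->]|/mapP[v vI ->]].
  - by apply: Or31; left.
  - by apply: Or31; right.
  - by apply: Or32; rewrite /= Ea.
  - by apply: Or33; rewrite /= vbasis_mem.
have span_s : (fullv <= <<x1 :: map fst s>>)%VS.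
  have a_E : (a <= <<E ++ vbasis I>>)%VS.
    by rewrite span_cat !(span_basis (vbasisP _)) addv_diff (addv_idPl Ia) subvv.
  have := sub_add_span (X := [:: x1; x2; x3]) (V := a) _ a_E => /(_ fullv) H.
  apply: span_trans (H _) _.
    by rewrite (span_cat [:: x1; x2] [:: x3]) span_seq1 -addvA.
  rewrite /s !map_cat !fst1; apply/allP => v; rewrite mem_cat => /orP[|vEI]; last first.
    by apply: memv_span; rewrite inE mem_cat vEI !orbT.
  rewrite !inE => /or3P[] /eqP ->; [mem_span | | mem_span].
  have -> : x2 = x2' - b by rewrite /x2' addrK.
  apply: memvB; first by mem_span.
  apply: (subvP _ b (subvP a_E b ba)); apply: sub_span => v' vEI.
  by rewrite inE mem_cat vEI !orbT.
apply: (@weighted_basis_degeneration_in _ _ _ x1 s) => //.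
- rewrite !size_cat !size_map !size_tuple /=.
  have := dimv_cap_compl a I; rewrite (capv_idPr Ia) dim_a4 => dE.
  have nat_eq k p q : (k = 7 -> p + q = 4 -> (2 + (q + p)).+1 = k)%N by clear; lia.
  exact: nat_eq n7 dE.
- move=> p q ps qs; case: (s_case p ps) => [p_x|[pa p2]|pI]; last first.
  + by rewrite brC killI ?oppr0 ?mem0v.
  + case: (s_case q qs) => [q_x|[qa q2]|qI]; last by rewrite killI ?mem0v.
      rewrite brC memvN p2; apply: I_span; first exact: memI.
      by case: q_x => ->.
    by rewrite ab_a ?mem0v.
  case: (s_case q qs) => [q_x|[qa q2]|qI]; last by rewrite killI ?mem0v.
    case: p_x q_x => -> [] -> /=.
    - by rewrite brxx mem0v.
    - by rewrite x23; apply: E_span.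
    - by rewrite brC memvN x23; apply: E_span.
    - by rewrite brxx mem0v.
  by rewrite q2; apply: I_span; [apply: memI | case: p_x => ->].
move=> p ps; case: (s_case p ps) => [p_x|[pa p2]|pI]; last by rewrite killI ?mem0v.
  by apply: a_span => //; case: p_x => ->.
by apply: I_span; [apply: memI | rewrite p2].
Qed.

(** Half of the classical fact that a linear space of operators of rank at most 1 has a common image
    line or a common kernel hyperplane; applying the rank bound to [x0 + y] and [x0 - y] isolates
    [[x0, e]]. *)
Let rank1 x0 y e e' : (forall x, {in a &, forall v1 v2, \[x, v2] != 0 -> \[x, v1] \in <[\[x, v2]]>%VS}) ->
  e \in a -> e' \in a -> \[x0, e] != 0 -> \[x0, e'] = 0 -> \[y, e'] \in <[\[x0, e]]>%VS.
Proof.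
move=> dep ea e'a f0 x0e'; have [->|ye'] := eqVneq \[y, e'] 0; first exact: mem0v.
have /vlineP[c1 E1] : \[x0 + y, e] \in <[\[x0 + y, e']]>%VS.
  by apply: dep => //; rewrite bracketDl x0e' add0r.
have /vlineP[c2 E2] : \[x0 - y, e] \in <[\[x0 - y, e']]>%VS.
  by apply: dep => //; rewrite bracketBl x0e' sub0r oppr_eq0.
rewrite !bracketDl x0e' add0r in E1; rewrite !bracketBl x0e' sub0r in E2.
have E : 2%:R *: \[x0, e] = (c1 - c2) *: \[y, e'].
  have -> : 2%:R *: \[x0, e] = (\[x0, e] + \[y, e]) + (\[x0, e] - \[y, e]) by vec_ring.
  by rewrite E1 E2; vec_ring.
have c0 : c1 - c2 != 0.
  apply: contraNneq f0 => c0; move/eqP: E; rewrite c0 scale0r scaler_eq0 pnatr_eq0.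
  by [].
apply/vlineP; exists ((c1 - c2)^-1 * 2%:R).
by rewrite -scalerA E scalerA mulVf // scale1r.
Qed.

Lemma metabelian_flat : nontrivial_degeneration lam.
Proof.
pose E := vbasis (a :\: I)%VS.
have a_EI v : v \in a -> exists e w, [/\ e \in <<E>>%VS, w \in I & v = e + w].
  move=> va; have : v \in (a :\: I + I)%VS by rewrite addv_diff (addv_idPl Ia).
  case/memv_addP => e eE [w wI ->]; exists e, w; split=> //.
  by rewrite (span_basis (vbasisP _)).
have Ea : {subset E <= a} by move=> v /vbasis_mem; apply/subvP/diffvSl.
have centE y : {in E, forall e, \[y, e] = 0} -> y \in a.
  move=> yE; apply: cent_a => v /a_EI[e [w [eE wI ->]]].
  rewrite bracketDr (killI _ wI) addr0 (coord_span eE) bracket_sumr big1 // => i _.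
  by rewrite bracketZr yE ?scaler0 // mem_nth // size_tuple.
have bound := centralizer_bound Ea centE; rewrite size_tuple in bound.
have dimE : (\dim I + \dim (a :\: I) = \dim a)%N.
  by rewrite -(dimv_cap_compl a I) (capv_idPr Ia).
(* With [q = \dim I] and [r] its codimension in [a], the bound gives [r q >= 3] while
   [q + r <= 4]. *)
have [dim_a4 n7 dim_I] : [/\ \dim a = 4, n = 7 & \dim I = 1 \/ \dim I = 2 \/ \dim I = 3]%N.
  have nat_cases k p q r : (k <= r * q + p -> q + r = p -> p + 3 <= k -> k <= 7 ->
      [/\ p = 4, k = 7 & q = 1 \/ q = 2 \/ q = 3])%N.
    clear; case: q => [|[|[|[|[|q]]]]] *; split; lia.
  exact: nat_cases bound dimE codim_a n_le7.
have Inz : I != 0%VS by rewrite -dimv_eq0; case: dim_I => [|[]] ->.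
have full_not2 u v : ~~ (fullv <= <<[:: u; v]>> + a)%VS.
  apply/negP => full; have nat_lt k k1 k2 k3 k4 :
    (k = 7 -> k1 = k -> k1 <= k2 -> k2 <= k3 + k4 -> k3 <= 2 -> k4 = 4 -> False)%N by clear; lia.
  exact: nat_lt n7 (dim_cV K n) (dimvS full) (dimv_add_leqif _ _).1 (dim_span _) dim_a4.
have [x0 [e [ea f0]]] : exists x e, e \in a /\ \[x, e] != 0.
  have [|/subvPn[x _ xa]] := boolP (fullv <= a)%VS.
    move=> full; case/negP: (full_not2 0 0); apply: subv_trans full _; exact: addvSr.
  have [img0|/subvPn[_ /memv_imgP[v va ->]]] := boolP ((linfun (bracket lam x) @: a) <= 0)%VS.
    case/negP: xa; apply: cent_a => v va; apply/eqP; rewrite -memv0.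
    by apply: (subvP img0); have := memv_img (linfun (bracket lam x)) va; rewrite lfunE.
  by rewrite lfunE memv0 => nz; exists x, v.
have imgP x v : v \in a -> \[x, v] \in (linfun (bracket lam x) @: a)%VS.
  by move=> va; have := memv_img (linfun (bracket lam x)) va; rewrite lfunE.
case: dim_I => [I1|[I2|I3]].
- apply: (onto_degeneration (x3 := x0)) => //.
  suff /eqP <- : (<[\[x0, e]]> == I)%VS by rewrite -memvE imgP.
  by rewrite eqEdim -memvE memI // dim_vline f0 I1.
- have [[x onto]|none] := boolp.EM (exists x, I <= linfun (bracket lam x) @: a)%VS.
    exact: onto_degeneration onto Inz.
  (* No operator maps onto the plane [I], so all have rank at most 1. Their images span [I], so
     there is no common image line; a common kernel hyperplane remains, and then the single vector
     [e] violates [centralizer_bound]. *)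
  have dep x : {in a &, forall v1 v2, \[x, v2] != 0 -> \[x, v1] \in <[\[x, v2]]>%VS}.
    move=> v1 v2 v1a v2a v2nz; apply: contraT => nv1; case: none; exists x.
    suff /eqP <- : (<<[:: \[x, v1]; \[x, v2]]>> == I)%VS.
      by apply/span_subvP => w; rewrite !inE => /orP[] /eqP ->; apply: imgP.
    have /eqP fr : free [:: \[x, v1]; \[x, v2]] by rewrite free_cons span_seq1 nv1 seq1_free.
    rewrite eqEdim fr I2 andbT; apply/span_subvP => w.
    by rewrite !inE => /orP[] /eqP ->; apply: memI.
  set f := \[x0, e] in f0.
  have decomp v : v \in a -> exists c h, [/\ h \in a, \[x0, h] = 0 & v = c *: e + h].
    move=> va; have /vlineP[c cE] := dep x0 v e va ea f0.
    exists c, (v - c *: e); split; first by rewrite memvB ?memvZ.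
      by rewrite bracketBr bracketZr cE subrr.
    by rewrite addrC subrK.
  have Hf y h : h \in a -> \[x0, h] = 0 -> \[y, h] \in <[f]>%VS.
    by move=> ha h0; apply: (rank1 y dep).
  have [y1 [v [va y1v]]] : exists y v, v \in a /\ \[y, v] \notin <[f]>%VS.
    have /subvPn[w wI wf] : ~~ (I <= <[f]>)%VS.
      by apply/negP => /dimvS; rewrite I2 dim_vline f0.
    have [[y [v [va H]]]|none'] := boolp.EM (exists y v, v \in a /\ \[y, v] \notin <[f]>%VS).
      by exists y, v.
    case/negP: wf; move: w wI; apply/subvP/bracketvP => y v _ va.
    by apply: contraT => H; case: none'; exists y, v.
  have y1e : \[y1, e] \notin <[f]>%VS.
    have [c [h [ha h0 vE]]] := decomp v va; apply: contra y1v => y1e.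
    by rewrite vE bracketDr bracketZr; apply: memvD; [apply: memvZ | apply: Hf].
  have y1e0 : \[y1, e] != 0 by apply: contraNneq y1e => ->; apply: mem0v.
  have line2 w : w \in <[f]>%VS -> w \in <[\[y1, e]]>%VS -> w = 0.
    move=> wf /vlineP[c wE]; have [c0|c0] := eqVneq c 0; first by rewrite wE c0 scale0r.
    by case/negP: y1e; move: wf; rewrite wE rpredZeq (negPf c0).
  have y1H h : h \in a -> \[x0, h] = 0 -> \[y1, h] = 0.
    by move=> ha h0; apply: line2; [apply: Hf | apply: dep].
  (* [rank1] based at [x0] and at [y1] puts [[y, h]] on two different lines. *)
  have killH y h : h \in a -> \[x0, h] = 0 -> \[y, h] = 0.
    move=> ha h0; apply: line2; first exact: Hf.
    by apply: (rank1 y dep) => //; apply: y1H.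
  have : (n <= size [:: e] * \dim I + \dim a)%N.
    apply: centralizer_bound => [w|y ye]; first by rewrite inE => /eqP ->.
    apply: cent_a => w /decomp[c [h [ha h0 ->]]].
    by rewrite bracketDr bracketZr ye ?mem_head // killH // scaler0 addr0.
  have nat_lt k p q : (k = 7 -> p = 4 -> q = 2 -> k <= 1 * q + p -> False)%N by clear; lia.
  by move/(nat_lt _ _ _ n7 dim_a4 I2).
have szE : size E = 1 by rewrite size_tuple; move: dimE; rewrite I3 dim_a4; clear; lia.
apply: two_step_degeneration => [|w u v]; first by rewrite n7.
have [e1 a_e1 cent_e1] : exists2 e1, (forall v, v \in a -> exists c, v - c *: e1 \in I) &
    forall y, \[y, e1] = 0 -> y \in a.
  have [e1 EE] : exists e1, tval E = [:: e1].
    by case: (tval E) szE => [|e1 []] // _; exists e1.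
  exists e1.
    move=> v' /a_EI[e' [w' [+ w'I ->]]]; rewrite EE span_seq1 => /vlineP[c ->].
    by exists c; rewrite addrAC subrr add0r.
  by move=> y y0; apply: centE => e' e'E; have : e' \in tval E by []; rewrite EE inE => /eqP ->.
apply: killI; have [c cI] := a_e1 _ (br_a u v).
have [c0|c0] := eqVneq c 0; first by rewrite c0 scale0r subr0 in cI.
case/negP: (full_not2 u v); apply/subvP => x _.
have [cu cuI] := a_e1 _ (br_a x u); have [cv cvI] := a_e1 _ (br_a x v).
(* Here [a] is a line [e1] plus [I]. If [[u, v]] had a nonzero [e1] coefficient [c], the Jacobi
   identity would make this element kill [e1], and [u], [v] would generate modulo [a], against
   codimension 3. *)
have key : c *: x + cu *: v - cv *: u \in a.
  apply: cent_e1; rewrite bracketBl bracketDl !bracketZl.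
  have J := brJ lie_lam x u v.
  have := killI x cI; have := killI v cuI; have := killI u cvI.
  rewrite !bracketBr !bracketZr => /eqP; rewrite subr_eq0 => /eqP E1 /eqP.
  rewrite subr_eq0 => /eqP E2 /eqP; rewrite subr_eq0 => /eqP E3.
  by rewrite -E1 -E2 -E3 J (brC \[x, u]); vec_ring.
have -> : x = c^-1 *: ((cv *: u - cu *: v) + (c *: x + cu *: v - cv *: u)).
  have -> : cv *: u - cu *: v + (c *: x + cu *: v - cv *: u) = c *: x by vec_ring.
  by rewrite scalerA mulVf // scale1r.
by apply: memvZ; apply: memv_add => //; mem_span.
Qed.

End SquareZero.

Section MetabelianMain.
Variables (K : numFieldType) (n : nat) (lam : strconst K n).
Hypotheses (lie_lam : is_lie lam) (nil_lam : nilpotent_lie lam).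
Local Notation "\[ x , y ]" := (bracket lam x y) (at level 0, x, y at level 99).
Local Notation L := (lower_central lam).

(** The last clause is the faithfulness of the action on [a], on which all dimension counts above
    rest. *)
Lemma maximal_abelian (U : {vspace 'cV[K]_n}) : {in U &, forall u v, \[u, v] = 0} ->
  exists a, [/\ (U <= a)%VS, {in a &, forall u v, \[u, v] = 0}
    & forall y, {in a, forall v, \[y, v] = 0} -> y \in a].
Proof.
have [d] := ubnP (n - \dim U)%N; elim: d U => // d IHd U ltd abU.
have [[y [yU yc]]|none] := boolp.EM (exists y, y \notin U /\ {in U, forall v, \[y, v] = 0}).
  have ab' : {in (<[y]> + U)%VS &, forall u v, \[u, v] = 0}.
    move=> _ _ /memv_addP[_ /vlineP[c ->] [u uU ->]] /memv_addP[_ /vlineP[d' ->] [v vU ->]].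
    rewrite !bracketDl !bracketDr !bracketZl !bracketZr brxx // (abU u v) // (yc v) //.
    by rewrite brC // (yc u) // oppr0 !scaler0 !addr0.
  have [|a [sub aba ca]] := IHd _ _ ab'.
    have dimU : (\dim (<[y]> + U) <= n)%N by have := dimvS (subvf (<[y]> + U)%VS); rewrite dim_cV.
    rewrite dimv_add_line // in dimU *.
    have nat_lt k p q : (q.+1 <= k -> k - q < p.+1 -> k - q.+1 < p)%N by clear; lia.
    exact: nat_lt.
  by exists a; split=> //; apply: subv_trans sub; apply: addvSr.
exists U; split=> // y yc; apply: contraT => yU; case: none.
by exists y.
Qed.

Lemma metabelian_degeneration : (1 < n <= 7)%N ->
  {in L 1 &, forall u v, \[u, v] = 0} -> nontrivial_degeneration lam.
Proof.
case/andP=> n1 n7 /maximal_abelian[a [La ab_a cent_a]].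
have br_a u v : \[u, v] \in a.
  by apply: (subvP La); apply: mem_bracketv; apply: memvf.
have [|codim_a] := leqP n (\dim a + 2); first exact: abelian_codim_le2.
rewrite -addnS in codim_a.
have [[x [v [va v3]]]|cube0] :=
  boolp.EM (exists x v, v \in a /\ \[x, \[x, \[x, v]]] != 0).
  exact: metabelian_cube va v3.
have {}cube0 x : {in a, forall v, \[x, \[x, \[x, v]]] = 0}.
  by move=> v va; apply/eqP; apply: contraT => nz; case: cube0; exists x, v.
have [[x [v [va v2]]]|square0] := boolp.EM (exists x v, v \in a /\ \[x, \[x, v]] != 0).
  exact: metabelian_square va v2.
have {}square0 x : {in a, forall v, \[x, \[x, v]] = 0}.
  by move=> v va; apply/eqP; apply: contraT => nz; case: square0; exists x, v.
exact: metabelian_flat square0.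
Qed.

End MetabelianMain.

(** * Multiplication tables *)

Section MultiplicationTables.
Variables (K : numFieldType) (n : nat) (lam : strconst K n).
Hypotheses (lie_lam : is_lie lam) (nil_lam : nilpotent_lie lam).
Local Notation "\[ x , y ]" := (bracket lam x y) (at level 0, x, y at level 99).
Implicit Types (x y z u v w e : 'cV[K]_n).

Let expand := (bracketDl, bracketBl, bracketNl, bracketZl, bracketDr, bracketBr, bracketNr, bracketZr).
Let simp := (scaler0, addr0, add0r, subr0, oppr0, bracket0r).
Ltac reduce_span := do ![apply/andP; split] => //; mem_span.

Lemma table_filiform7 x y z e1 e2 f g (k rho sigma tau : K) :
  n = 7 -> (fullv <= <<[:: x; y; z; e1; e2; f; g]>>)%VS ->
  [/\ \[x, y] = z, \[x, z] = e1, \[x, e1] = e2 & \[x, e2] = f] ->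
  \[x, f] = k *: g -> \[x, g] = 0 ->
  [/\ \[y, z] = rho *: e2 + sigma *: f + tau *: g, \[y, e1] = rho *: f + (sigma * k) *: g,
      \[y, e2] = (rho * k - 1) *: g, \[y, f] = 0 & \[y, g] = 0] ->
  [/\ \[z, e1] = g, \[z, e2] = 0, \[z, f] = 0 & \[z, g] = 0] ->
  [/\ \[e1, e2] = 0, \[e1, f] = 0, \[e1, g] = 0, \[e2, f] = 0 & \[e2, g] = 0] ->
  \[f, g] = 0 -> nontrivial_degeneration lam.
Proof.
move=> n7 span [xy xz xe1 xe2] xf xg [yz ye1 ye2 yf yg] [ze1 ze2 zf zg].
move=> [e1e2 e1f e1g e2f e2g] fg.
have [rho0|rho0] := eqVneq rho 0.
  rewrite rho0 !scale0r !add0r ?mul0r ?sub0r ?scaleN1r in yz ye1 ye2.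
  (* Since [[y, e2] = - g], adding multiples of [e2] cancels [[y, e1]], which would force equal
     weights on [e1] and [e2], and the [g] term of [[y, z]], which would compete with [f]. *)
  pose e1' := e1 + (sigma * k) *: e2; pose z' := z + tau *: e2.
  have e1E : e1 = e1' - (sigma * k) *: e2 by rewrite addrK.
  have zE : z = z' - tau *: e2 by rewrite addrK.
  have yz' : \[y, z'] = sigma *: f by rewrite !expand yz ye2; vec_ring.
  have ye1' : \[y, e1'] = 0 by rewrite !expand ye1 ye2; vec_ring.
  have z'e1' : \[z', e1'] = g.
    by rewrite !expand ze1 ze2 (brC lie_lam e2) e1e2 brxx // !simp.
  have z'e2 : \[z', e2] = 0 by rewrite !expand ze2 brxx // !simp.
  have z'f : \[z', f] = 0 by rewrite !expand zf e2f !simp.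
  have z'g : \[z', g] = 0 by rewrite !expand zg e2g !simp.
  have e1'e2 : \[e1', e2] = 0 by rewrite !expand e1e2 brxx // !simp.
  have e1'f : \[e1', f] = 0 by rewrite !expand e1f e2f !simp.
  have e1'g : \[e1', g] = 0 by rewrite !expand e1g e2g !simp.
  have xz' : \[x, z'] = e1' - (sigma * k) *: e2 + tau *: f by rewrite !expand xz xe2 -e1E.
  have xe1' : \[x, e1'] = e2 + (sigma * k) *: f by rewrite !expand xe1 xe2.
  (* The equations are 10 + 12 = 22 for [f] and 10 + 17 = 12 + 15 = 27 for [g]; the weights increase
     along the chain of [ad x]. *)
  pose s := [:: (y, 10%N); (z', 12%N); (e1', 15%N); (e2, 17%N); (f, 22%N); (g, 27%N)].
  apply: (@weighted_basis_degeneration _ _ _ x s) => //=.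
  - by apply: span_trans span _ => /=; rewrite e1E zE; reduce_span.
  - by split_pairs; rewrite ?yz' ?ye1' ?ye2 ?yf ?yg ?z'e1' ?z'e2 ?z'f ?z'g ?e1'e2 ?e1'f ?e1'g
      ?e2f ?e2g ?fg; mem_weight.
  by split_all; rewrite ?xy ?xz' ?xe1' ?xe2 ?xf ?xg ?zE; mem_weight.
(* With [rho] nonzero these brackets can replace [e2] and [f], and consecutive weights become
   consistent. *)
pose e2' := \[y, z]; pose f' := \[y, e1].
have fE : f = rho^-1 *: (f' - (sigma * k) *: g).
  by rewrite /f' ye1 addrK scalerA mulVf // scale1r.
have e2E : e2 = rho^-1 *: (e2' - sigma *: f - tau *: g).
  rewrite /e2' yz (_ : _ - _ - _ = rho *: e2); last by vec_ring.
  by rewrite scalerA mulVf // scale1r.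
have yz' : \[y, z] = e2' by [].
have ye1' : \[y, e1] = f' by [].
have ye2' : \[y, e2'] = (rho * (rho * k - 1)) *: g.
  by rewrite /e2' yz !expand ye2 yf yg !simp scalerA.
have yf' : \[y, f'] = 0 by rewrite /f' ye1 !expand yf yg !simp.
have ze2' : \[z, e2'] = 0 by rewrite /e2' yz !expand ze2 zf zg !simp.
have zf' : \[z, f'] = 0 by rewrite /f' ye1 !expand zf zg !simp.
have e1e2' : \[e1, e2'] = 0 by rewrite /e2' yz !expand e1e2 e1f e1g !simp.
have e1f' : \[e1, f'] = 0 by rewrite /f' ye1 !expand e1f e1g !simp.
have e2f' : \[e2', f'] = 0.
  by rewrite /e2' /f' yz ye1 !expand e2f e2g brxx // fg (brC lie_lam g) fg brxx // !simp.
have e2g' : \[e2', g] = 0 by rewrite /e2' yz !expand e2g fg brxx // !simp.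
have fg' : \[f', g] = 0 by rewrite /f' ye1 !expand fg brxx // !simp.
have xe2' : \[x, e2'] = rho *: f + sigma *: (k *: g).
  by rewrite /e2' yz !expand xe2 xf xg !simp.
have xf' : \[x, f'] = rho *: (k *: g) by rewrite /f' ye1 !expand xf xg !simp.
pose s := [:: (y, 2%N); (z, 3%N); (e1, 4%N); (e2', 5%N); (f', 6%N); (g, 7%N)].
apply: (@weighted_basis_degeneration _ _ _ x s) => //=.
- by apply: span_trans span _ => /=; rewrite e2E fE; reduce_span.
- by split_pairs; rewrite ?yz' ?ye1' ?ye2' ?yf' ?yg ?ze1 ?ze2' ?zf' ?zg ?e1e2' ?e1f' ?e1g
    ?e2f' ?e2g' ?fg'; mem_weight.
by split_all; rewrite ?xy ?xz ?xe1 ?xe2' ?xf' ?xg ?e2E ?fE; mem_weight.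
Qed.

Lemma table_two_branches x y z p r e g (al al' be be' ga ga' : K) :
  n = 7 -> (fullv <= <<[:: x; y; z; p; r; e; g]>>)%VS -> (be != 0) || (ga != 0) ->
  [/\ \[x, y] = z, \[x, z] = p, \[y, z] = r, \[x, e] = g & \[y, e] = 0] ->
  [/\ \[x, p] = al *: e + al' *: g, \[x, r] = be *: e + be' *: g,
      \[y, p] = be *: e + be' *: g & \[y, r] = ga *: e + ga' *: g] ->
  [/\ \[z, p] = be *: g, \[z, r] = ga *: g & \[z, e] = 0] ->
  [/\ \[x, g] = 0, \[y, g] = 0 & \[z, g] = 0] ->
  [/\ \[p, r] = 0, \[p, e] = 0 & \[p, g] = 0] ->
  [/\ \[r, e] = 0, \[r, g] = 0 & \[e, g] = 0] -> nontrivial_degeneration lam.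
Proof.
move=> n7 span nz [xy xz yz xe ye] [xp xr yp yr] [zp zr ze] [xg yg zg] [pr pe pg] [re rg eg].
have [ga0|ga0] := eqVneq ga 0.
  rewrite ga0 eqxx orbF !scale0r ?add0r in nz yr zr; pose e' := \[y, p].
  have yp' : \[y, p] = e' by [].
  have eE : e = be^-1 *: (e' - be' *: g) by rewrite /e' yp addrK scalerA mulVf // scale1r.
  have xr' : \[x, r] = e' by rewrite /e' yp.
  have xe' : \[x, e'] = be *: g by rewrite /e' yp !expand xe xg !simp.
  have ye' : \[y, e'] = 0 by rewrite /e' yp !expand ye yg !simp.
  have ze' : \[z, e'] = 0 by rewrite /e' yp !expand ze zg !simp.
  have pe' : \[p, e'] = 0 by rewrite /e' yp !expand pe pg !simp.
  have re' : \[r, e'] = 0 by rewrite /e' yp !expand re rg !simp.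
  have e'g : \[e', g] = 0 by rewrite /e' yp !expand eg brxx // !simp.
  pose s := [:: (y, 2%N); (z, 3%N); (p, 4%N); (r, 5%N); (e', 6%N); (g, 7%N)].
  apply: (@weighted_basis_degeneration _ _ _ x s) => //=.
  - by apply: span_trans span _ => /=; rewrite eE; reduce_span.
  - by split_pairs; rewrite ?yz ?yp' ?yr ?ye' ?yg ?zp ?zr ?ze' ?zg ?pr ?pe' ?pg ?re' ?rg
      ?e'g; mem_weight.
  by split_all; rewrite ?xy ?xz ?xp ?xr' ?xe' ?xg ?eE; mem_weight.
(* [[z, p]] and [[z, r]] are both multiples of [g]; [p'] kills the first, so that [p'] and [r] may
   have different weights. *)
pose e' := \[y, r]; pose p' := p - (be / ga) *: r.
have yr' : \[y, r] = e' by [].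
have eE : e = ga^-1 *: (e' - ga' *: g) by rewrite /e' yr addrK scalerA mulVf // scale1r.
have pE : p = p' + (be / ga) *: r by rewrite subrK.
have yp' : \[y, p'] = (be' - be / ga * ga') *: g.
  rewrite !expand yp yr; apply/colP => i; rewrite !cvE; field; exact: ga0.
have zp' : \[z, p'] = 0 by rewrite !expand zp zr scalerA divfK // subrr.
have xe' : \[x, e'] = ga *: g by rewrite /e' yr !expand xe xg !simp.
have ye' : \[y, e'] = 0 by rewrite /e' yr !expand ye yg !simp.
have ze' : \[z, e'] = 0 by rewrite /e' yr !expand ze zg !simp.
have pr' : \[p', r] = 0 by rewrite !expand pr brxx // !simp.
have pe' : \[p', e'] = 0 by rewrite /e' yr !expand pe pg re rg !simp.
have pg' : \[p', g] = 0 by rewrite !expand pg rg !simp.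
have re' : \[r, e'] = 0 by rewrite /e' yr !expand re rg !simp.
have e'g : \[e', g] = 0 by rewrite /e' yr !expand eg brxx // !simp.
have xp' : \[x, p'] = al *: e + al' *: g - (be / ga) *: (be *: e + be' *: g).
  by rewrite !expand xp xr.
pose s := [:: (y, 2%N); (z, 3%N); (p', 6%N); (r, 5%N); (e', 7%N); (g, 8%N)].
apply: (@weighted_basis_degeneration _ _ _ x s) => //=.
- by apply: span_trans span _ => /=; rewrite eE pE; reduce_span.
- by split_pairs; rewrite ?yz ?yp' ?yr' ?ye' ?yg ?zp' ?zr ?ze' ?zg ?pr' ?pe' ?pg' ?re' ?rg
    ?e'g; mem_weight.
by split_all; rewrite ?xy ?xz ?xp' ?xr ?xe' ?xg ?eE ?pE; mem_weight.
Qed.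

Lemma table_filiform6 x y z e1 e2 g (phi rho sigma : K) :
  n = 6 -> (fullv <= <<[:: x; y; z; e1; e2; g]>>)%VS ->
  [/\ \[x, y] = z, \[x, z] = e1, \[x, e1] = e2, \[x, e2] = phi *: g & \[x, g] = 0] ->
  [/\ \[y, z] = rho *: e2 + sigma *: g, \[y, e1] = (rho * phi) *: g, \[y, e2] = - g
    & \[y, g] = 0] ->
  [/\ \[z, e1] = g, \[z, e2] = 0 & \[z, g] = 0] ->
  [/\ \[e1, e2] = 0, \[e1, g] = 0 & \[e2, g] = 0] -> nontrivial_degeneration lam.
Proof.
move=> n6 span [xy xz xe1 xe2 xg] [yz ye1 ye2 yg] [ze1 ze2 zg] [e1e2 e1g e2g].
pose e1' := e1 + (rho * phi) *: e2; pose z' := z + sigma *: e2.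
have e1E : e1 = e1' - (rho * phi) *: e2 by rewrite addrK.
have zE : z = z' - sigma *: e2 by rewrite addrK.
have yz' : \[y, z'] = rho *: e2 by rewrite !expand yz ye2; vec_ring.
have ye1' : \[y, e1'] = 0 by rewrite !expand ye1 ye2; vec_ring.
have z'e1' : \[z', e1'] = g.
  by rewrite !expand ze1 ze2 (brC lie_lam e2) e1e2 brxx // !simp.
have z'e2 : \[z', e2] = 0 by rewrite !expand ze2 brxx // !simp.
have z'g : \[z', g] = 0 by rewrite !expand zg e2g !simp.
have e1'e2 : \[e1', e2] = 0 by rewrite !expand e1e2 brxx // !simp.
have e1'g : \[e1', g] = 0 by rewrite !expand e1g e2g !simp.
have xz' : \[x, z'] = e1' - (rho * phi) *: e2 + sigma *: (phi *: g).
  by rewrite !expand xz xe2 -e1E.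
have xe1' : \[x, e1'] = e2 + (rho * phi) *: (phi *: g) by rewrite !expand xe1 xe2.
pose s := [:: (y, 2%N); (z', 3%N); (e1', 4%N); (e2, 5%N); (g, 7%N)].
apply: (@weighted_basis_degeneration _ _ _ x s) => //=.
- by apply: span_trans span _ => /=; rewrite e1E zE; reduce_span.
- by split_pairs; rewrite ?yz' ?ye1' ?ye2 ?yg ?z'e1' ?z'e2 ?z'g ?e1'e2 ?e1'g ?e2g; mem_weight.
by split_all; rewrite ?xy ?xz' ?xe1' ?xe2 ?xg ?zE; mem_weight.
Qed.

Lemma table_three_generators x y w z e1 e2 g (phi rho sigma eta v2 v3 : K) :
  n = 7 -> (fullv <= <<[:: x; y; w; z; e1; e2; g]>>)%VS ->
  [/\ \[x, y] = z, \[x, z] = e1, \[x, e1] = e2, \[x, e2] = phi *: g & \[x, g] = 0] ->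
  [/\ \[y, z] = rho *: e2 + sigma *: g, \[y, e1] = (rho * phi) *: g, \[y, e2] = - g
    & \[y, g] = 0] ->
  [/\ \[z, e1] = g, \[z, e2] = 0 & \[z, g] = 0] ->
  [/\ \[e1, e2] = 0, \[e1, g] = 0 & \[e2, g] = 0] ->
  [/\ \[x, w] = eta *: g, \[y, w] = v2 *: e2 + v3 *: g & \[z, w] = (v2 * phi) *: g] ->
  [/\ \[e1, w] = 0, \[e2, w] = 0 & \[g, w] = 0] -> nontrivial_degeneration lam.
Proof.
move=> n7 span [xy xz xe1 xe2 xg] [yz ye1 ye2 yg] [ze1 ze2 zg] [e1e2 e1g e2g].
move=> [xw yw zw] [e1w e2w gw].
pose e1' := e1 + (rho * phi) *: e2; pose z' := z + sigma *: e2.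
(* The [e1] correction in [w'] cancels [[z, w]]; [c] then cancels the [g] terms of [[y, w]],
   including the one this correction creates. *)
pose c := v3 - v2 * phi * (rho * phi).
pose w' := w - (v2 * phi) *: e1 + c *: e2.
have e1E : e1 = e1' - (rho * phi) *: e2 by rewrite addrK.
have zE : z = z' - sigma *: e2 by rewrite addrK.
have wE : w = w' + (v2 * phi) *: (e1' - (rho * phi) *: e2) - c *: e2.
  by rewrite -e1E /w'; vec_ring.
have yz' : \[y, z'] = rho *: e2 by rewrite !expand yz ye2; vec_ring.
have ye1' : \[y, e1'] = 0 by rewrite !expand ye1 ye2; vec_ring.
have yw' : \[y, w'] = v2 *: e2 by rewrite !expand yw ye1 ye2 /c; vec_ring.
have z'e1' : \[z', e1'] = g.
  by rewrite !expand ze1 ze2 (brC lie_lam e2) e1e2 brxx // !simp.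
have z'e2 : \[z', e2] = 0 by rewrite !expand ze2 brxx // !simp.
have z'g : \[z', g] = 0 by rewrite !expand zg e2g !simp.
have z'w' : \[z', w'] = 0.
  by rewrite !expand zw ze1 ze2 e2w (brC lie_lam e2 e1) e1e2 brxx // !simp subrr.
have e1'e2 : \[e1', e2] = 0 by rewrite !expand e1e2 brxx // !simp.
have e1'g : \[e1', g] = 0 by rewrite !expand e1g e2g !simp.
have w'e1' : \[w', e1'] = 0.
  by rewrite brC // !expand e1w e2w (brC lie_lam e2 e1) e1e2 !brxx // !simp.
have w'e2 : \[w', e2] = 0.
  by rewrite brC // !expand e2w (brC lie_lam e2 e1) e1e2 !brxx // !simp.
have w'g : \[w', g] = 0.
  by rewrite brC // !expand gw (brC lie_lam g e1) (brC lie_lam g e2) e1g e2g !simp.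
have xz' : \[x, z'] = e1' - (rho * phi) *: e2 + sigma *: (phi *: g).
  by rewrite !expand xz xe2 -e1E.
have xe1' : \[x, e1'] = e2 + (rho * phi) *: (phi *: g) by rewrite !expand xe1 xe2.
have xw' : \[x, w'] = eta *: g - (v2 * phi) *: e2 + c *: (phi *: g).
  by rewrite !expand xw xe1 xe2.
pose s := [:: (y, 2%N); (z', 3%N); (w', 3%N); (e1', 4%N); (e2, 5%N); (g, 7%N)].
apply: (@weighted_basis_degeneration _ _ _ x s) => //=.
- by apply: span_trans span _ => /=; rewrite wE e1E zE; reduce_span.
- by split_pairs; rewrite ?yz' ?ye1' ?yw' ?ye2 ?yg ?z'e1' ?z'w' ?z'e2 ?z'g ?w'e1' ?w'e2 ?w'g
    ?e1'e2 ?e1'g ?e2g; mem_weight.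
by split_all; rewrite ?xy ?xz' ?xw' ?xe1' ?xe2 ?xg ?zE; mem_weight.
Qed.

End MultiplicationTables.

(** * Algebras with nonabelian derived algebra *)

Section NonMetabelian.
Variables (K : numFieldType) (n : nat) (lam : strconst K n).
Hypotheses (lie_lam : is_lie lam) (nil_lam : nilpotent_lie lam).
Local Notation "\[ x , y ]" := (bracket lam x y) (at level 0, x, y at level 99).
Local Notation L := (lower_central lam).
Implicit Types (x y z u v w e : 'cV[K]_n).
Hypothesis n_le7 : (1 < n <= 7)%N.
Variables u0 v0 : 'cV[K]_n.
Hypotheses (u0L : u0 \in L 1) (v0L : v0 \in L 1) (uv0 : \[u0, v0] != 0).

Let brC := brC lie_lam.
Let brxx := brxx lie_lam.
Let brJ := brJ lie_lam.
Let LL := mem_LL lie_lam.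
Let layer := L_layer lie_lam.

Lemma bracket_L_eq0 k i j x y : L k = 0%VS -> x \in L i -> y \in L j -> (k <= (i + j).+1)%N ->
  \[x, y] = 0.
Proof.
move=> Lk xL yL kij; apply/eqP; rewrite -memv0 -Lk.
exact: (subvP (L_anti lam kij)) (LL xL yL).
Qed.

Lemma dim_span_add (X : seq 'cV[K]_n) (U V : {vspace 'cV[K]_n}) :
  (U <= <<X>> + V)%VS -> (\dim U <= size X + \dim V)%N.
Proof.
move/dimvS => dU; apply: leq_trans dU _; apply: leq_trans (dimv_add_leqif _ _).1 _.
by rewrite leq_add2r dim_span.
Qed.

Let L3nz : L 3 != 0%VS.
Proof.
apply: contra uv0 => /eqP L30; apply/eqP; exact: (bracket_L_eq0 L30 u0L v0L).
Qed.

Let dL k : L k != 0%VS -> (\dim (L k.+1) < \dim (L k))%N.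
Proof. exact: dim_L_lt. Qed.

Let Lnz i j : (i <= j)%N -> L j != 0%VS -> L i != 0%VS.
Proof.
move=> ij; apply: contra => /eqP Li; rewrite -subv0 -Li.
exact: L_anti.
Qed.

Let dL1 : (\dim (L 1) + 2 <= n)%N.
Proof. by case/andP: n_le7 => n1 _; apply: dim_derived. Qed.

(* Otherwise the layers of the lower central series have dimensions
   3, 2, 1, 1, and the Jacobi identity makes [[x, b], [x, b']] symmetric. *)
Lemma derived_layer : (\dim (L 1) <= (\dim (L 2)).+1)%N.
Proof.
rewrite leqNgt; apply/negP => d12.
have d3 : (0 < \dim (L 3))%N by rewrite lt0n dimv_eq0.
have d23 : (\dim (L 3) < \dim (L 2))%N by apply/dL/(@Lnz 2 3).
(* With two generators the layer [L 1 / L 2] is at most the line of [[x, y]]. *)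
have d0 : (n <> (\dim (L 1)).+2)%N.
  move=> nE; have [X szX [fX _]] := generators_mod (LS lam 0).
  have {szX} : size X = 2.
    rewrite szX [\dim (L 0)]dim_cV; move: nE; move: (\dim _) => d; clear; lia.
  case: X fX => [|x [|y []]] // fX _.
  have := layer (k := 0) fX fX; rewrite /= !brxx (brC y x) => L12.
  have : (L 1 <= <<[:: \[x, y]]>> + L 2)%VS.
    apply: subv_trans L12 _; apply: addvS => //; apply/span_subvP => w.
    by rewrite !inE => /or4P[] /eqP ->; mem_span.
  by move/dim_span_add; rewrite /= add1n leqNgt d12.
have [nE [d1E [d2E d3E]]] : [/\ n = 7 & \dim (L 1) = 4 /\ \dim (L 2) = 2 /\ \dim (L 3) = 1]%N.
  have nat_eq k k1 k2 k3 : (k <= 7 -> k1 + 2 <= k -> k <> k1.+2 -> k2.+1 < k1 -> k3 < k2 ->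
    0 < k3 -> k = 7 /\ k1 = 4 /\ k2 = 2 /\ k3 = 1)%N by clear; lia.
  by case/andP: n_le7 => _ n7; have [? [? [? ?]]] := nat_eq _ _ _ _ n7 dL1 d0 d12 d23 d3.
have L4 : L 4 = 0%VS.
  by apply/eqP; apply: contraT => L4nz; have := dL L3nz; rewrite d3E ltnS leqn0 dimv_eq0 (negPf L4nz).
have zeroL := bracket_L_eq0 L4.
have [e eL eL3] : exists2 e, e \in L 2 & e \notin L 3.
  by apply/subvPn; apply: contraL d23 => /dimvS; rewrite -leqNgt.
have L2e : (L 2 <= <<[:: e]>> + L 3)%VS.
  by apply: span_codim1 => //; [apply: LS | rewrite d2E d3E].
have [x xe] : exists x, \[x, e] != 0.
  have [//|none] := boolp.EM (exists x, \[x, e] != 0).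
  have ke w : \[w, e] = 0 by apply/eqP; apply: contraT => nz; case: none; exists w.
  case/negP: L3nz; rewrite -subv0; apply/bracketvP => w v _ /(subvP L2e)/span_add1P[c vc].
  rewrite -(subrK (c *: e) v) bracketDr bracketZr ke scaler0 addr0.
  by rewrite (zeroL 0 3) ?mem0v ?memvf.
have L3xe : (L 3 <= <[\[x, e]]>)%VS.
  have sub : (<[\[x, e]]> <= L 3)%VS by rewrite -memvE mem_L1.
  by rewrite -(eqP (_ : <[\[x, e]]> == L 3)%VS) ?subvv // eqEdim sub dim_vline xe d3E.
have xL1 : x \notin L 1 by apply: contra xe => xL; rewrite (zeroL 1 2).
have [Z szZ [spanZ _]] := generators_mod (subvf (<[x]> + L 1)%VS).
have {szZ} : size Z = 2.
  by rewrite szZ dim_cV dimv_add_line // d1E; move: nE; clear => ->.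
case: Z spanZ => [|p [|q []]] // spanZ _.
(* [L 3] is the line of [[x, e]]; so the other two generators can be corrected to kill [e], and with
   it all of [L 2]. *)
have th y : exists c, \[y - c *: x, e] = 0.
  have /vlineP[c yE] := subvP L3xe _ (mem_L1 y eL : \[y, e] \in L 3).
  by exists c; rewrite bracketBl bracketZl yE subrr.
have [cp] := th p; have [cq] := th q; set b' := q - _; set b := p - _ => b'e be.
have spanX : (fullv <= <<[:: x; b; b']>> + L 1)%VS.
  apply: subv_trans spanZ _; rewrite -span_seq1 addvA -span_cat.
  apply: addvS => //; apply/span_subvP => w; rewrite !inE => /or3P[] /eqP ->; last by mem_span.
    by rewrite -(subrK (cp *: x) p) -/b; mem_span.
  by rewrite -(subrK (cq *: x) q) -/b'; mem_span.
pose p1 := \[x, b]; pose p2 := \[x, b']; pose p3 := \[b, b'].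
have L1p : (L 1 <= <<[:: p1; p2; p3]>> + L 2)%VS.
  have := layer (k := 0) spanX spanX; rewrite /= !brxx (brC b x) (brC b' x) (brC b' b).
  move/subv_trans; apply; apply: addvS => //; apply/span_subvP => w.
  by rewrite !inE; do ![case/predU1P=> [->|] | move/eqP => ->]; rewrite -?/p1 -?/p2 -?/p3; mem_span.
have brL1 y z : \[y, z] \in L 1 by apply: mem_L1; apply: memvf.
have kill_b c w : \[c, e] = 0 -> w \in L 2 -> \[c, w] = 0.
  move=> ce /(subvP L2e)/span_add1P[k wk].
  rewrite -(subrK (k *: e) w) bracketDr bracketZr ce scaler0 addr0.
  by rewrite (zeroL 0 3) ?memvf.
(* [b] and [b'] map [L 1] into [L 2], which both kill. So only [[p1, p2]] can make [L 1]
   nonabelian. *)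
have p3L w : w \in L 1 -> \[p3, w] = 0.
  move=> wL; have -> : \[p3, w] = \[b, \[b', w]] - \[b', \[b, w]].
    by rewrite (brJ b b' w); vec_ring.
  have mL c : \[c, w] \in L 2 by apply: mem_L1.
  by rewrite (kill_b b _ be (mL b')) (kill_b b' _ b'e (mL b)) subrr.
have p12 : \[p1, p2] != 0.
  apply: contra uv0 => /eqP p12; apply/eqP.
  have kill w v : w \in [:: p1; p2; p3] -> v \in L 1 -> \[w, v] = 0.
    have wp p' : p' \in [:: p1; p2; p3] -> p' \in L 1.
      by rewrite !inE => /or3P[] /eqP ->; apply: brL1.
    move=> wX /(subvP L1p)/memv_addP[v1 v1X [v2 v2L ->]].
    rewrite bracketDr (zeroL 1 2 w v2) ?wp // addr0.
    rewrite (@coord_span _ _ _ [tuple p1; p2; p3] v1 v1X) bracket_sumr big1 // => i _.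
    rewrite bracketZr; suff -> : \[w, [:: p1; p2; p3]`_i] = 0 by rewrite scaler0.
    have : [:: p1; p2; p3]`_i \in [:: p1; p2; p3] by apply: mem_nth.
    move: wX; rewrite !inE => /or3P[] /eqP -> /or3P[] /eqP ->;
      rewrite ?brxx // ?p12 // ?p3L ?brL1 //; rewrite brC ?p12 ?p3L ?brL1 ?oppr0 //.
  have /(subvP L1p)/memv_addP[w1 w1X [w2 w2L ->]] := u0L.
  rewrite bracketDl (zeroL 2 1 w2 v0) // addr0.
  rewrite (@coord_span _ _ _ [tuple p1; p2; p3] w1 w1X) bracket_suml big1 // => i _.
  by rewrite bracketZl kill ?scaler0 //; apply: mem_nth.
have p2L2 : p2 \notin L 2 by apply: contra p12 => pL; rewrite (zeroL 1 2 p1 p2) ?brL1.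
have p1L2 : p1 \notin (<[p2]> + L 2)%VS.
  apply: contra p12; rewrite -span_seq1 => /span_add1P[c pL].
  rewrite -(subrK (c *: p2) p1) bracketDl bracketZl brxx scaler0 addr0.
  by rewrite (zeroL 2 1 _ p2 pL) ?brL1.
have L1E : (L 1 <= <<[:: p1; p2]>> + L 2)%VS.
  have sub : (<[p1]> + (<[p2]> + L 2) <= L 1)%VS by rewrite !subv_add -!memvE !brL1 LS.
  rewrite span_cons span_seq1 -addvA.
  suff /eqP -> : (<[p1]> + (<[p2]> + L 2) == L 1)%VS by apply: subvv.
  by rewrite eqEdim sub !dimv_add_line // d1E d2E.
have p3L2 : p3 \in L 2.
  have /(subvP L1E)/span_add2P[c1 [c2 pL]] := brL1 b b'; rewrite -/p3 in pL.
  have p3p c p' : p' \in L 1 -> \[c *: p3, p'] = 0 by move=> ?; rewrite bracketZl p3L ?scaler0.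
  have c10 : c1 = 0.
    have := zeroL 2 1 _ p2 pL (brL1 _ _) isT; rewrite !bracketBl !bracketZl brxx p3L ?brL1 //.
    rewrite scaler0 subr0 sub0r => /eqP; rewrite oppr_eq0 scaler_eq0 (negPf p12) orbF.
    by move/eqP.
  have c20 : c2 = 0.
    have := zeroL 2 1 _ p1 pL (brL1 _ _) isT; rewrite !bracketBl !bracketZl brxx p3L ?brL1 //.
    rewrite scaler0 !sub0r oppr0 add0r (brC p2) => /eqP.
    by rewrite oppr_eq0 scaler_eq0 oppr_eq0 (negPf p12) orbF => /eqP.
  by rewrite c10 c20 !scale0r !subr0 in pL.
have bp2 : \[b, p2] = \[b', p1] + \[x, p3].
  by rewrite {1}/p2 (brJ b x b') (brC b x) -/p1 -/p3 bracketNl -(brC b').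
have xp3 : \[x, \[x, p3]] = 0.
  by apply: (zeroL 0 3); [apply: memvf | apply: mem_L1 |].
have xL w c : \[c, e] = 0 -> w \in L 1 -> \[c, \[x, w]] = 0.
  by move=> ce wL; apply: kill_b => //; apply: mem_L1.
(* With [E21], the same element equals both [[p1, p2]] and [[p2, p1]], hence is zero. *)
have E12 : \[p1, p2] = \[x, \[b', p1]].
  have := brJ x b p2; rewrite -/p1 (xL p2 b be (brL1 _ _)) addr0 => <-.
  by rewrite bp2 bracketDr xp3 addr0.
have E21 : \[p2, p1] = \[x, \[b', p1]].
  by have := brJ x b' p1; rewrite -/p2 (xL p1 b' b'e (brL1 _ _)) addr0 => <-.
case/negP: p12; have := brC p1 p2; rewrite E21 -E12 => /eqP.
by rewrite -addr_eq0 -mulr2n -scaler_nat scaler_eq0 pnatr_eq0.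
Qed.

End NonMetabelian.

(** * Case division by the dimensions of the lower central series *)

Section NonMetabelianCases.
Variables (K : numFieldType) (n : nat) (lam : strconst K n).
Hypotheses (lie_lam : is_lie lam) (nil_lam : nilpotent_lie lam).
Local Notation "\[ x , y ]" := (bracket lam x y) (at level 0, x, y at level 99).
Local Notation L := (lower_central lam).
Implicit Types (x y z u v w e f g r : 'cV[K]_n).
Hypothesis n_le7 : (1 < n <= 7)%N.
Variables u0 v0 : 'cV[K]_n.
Hypotheses (u0L : u0 \in L 1) (v0L : v0 \in L 1) (uv0 : \[u0, v0] != 0).

Let brC := brC lie_lam.
Let brxx := brxx lie_lam.
Let brJ := brJ lie_lam.
Let LL := mem_LL lie_lam.
Let layer := L_layer lie_lam.
Let zeroL := bracket_L_eq0 lie_lam.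

Let dL k : L k != 0%VS -> (\dim (L k.+1) < \dim (L k))%N.
Proof. exact: dim_L_lt. Qed.

Let Lnz i j : (i <= j)%N -> L j != 0%VS -> L i != 0%VS.
Proof.
move=> ij; apply: contra => /eqP Li; rewrite -subv0 -Li.
exact: L_anti.
Qed.

Let dL1 : (\dim (L 1) + 2 <= n)%N.
Proof. by case/andP: n_le7 => n1 _; apply: dim_derived. Qed.

Let brL1 y z : \[y, z] \in L 1.
Proof. by apply: mem_L1; apply: memvf. Qed.

Let expand_uv z u v a b : \[a *: z + u, b *: z + v] = a *: \[z, v] - b *: \[z, u] + \[u, v].
Proof.
rewrite !bracketDl !bracketDr !bracketZl !bracketZr brxx (brC u z) !scaler0 add0r.
by vec_ring.
Qed.

(** The form in which [[u0, v0] != 0] is used below: it makes structure constants such as [g =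
    [z, e1]] nonzero. *)
Let ad_z_nonzero z : (L 1 <= <<[:: z]>> + L 2)%VS -> {in L 2, forall v, \[z, v] = 0} ->
  {in L 2 &, forall u v, \[u, v] = 0} -> False.
Proof.
move=> /subvP Lz kz k2; case/negP: uv0.
have /span_add1P[a ua] := Lz _ u0L; have /span_add1P[b vb] := Lz _ v0L.
rewrite -(subrK (a *: z) u0) -(subrK (b *: z) v0) ![_ - _ + _]addrC expand_uv.
by rewrite !kz // k2 // !scaler0 subrr addr0.
Qed.

(** [L 1 / L 2] being a line, brackets within [L 1] reduce to brackets with [L 2], which lie in
    [L 4]. *)
Let L4nz : L 4 != 0%VS.
Proof.
apply/negP => /eqP L4; have d12 := derived_layer lie_lam nil_lam n_le7 u0L v0L uv0.
have /subvPn[z zL zL2] : ~~ (L 1 <= L 2)%VS.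
  apply/negP => L12; case/negP: uv0; have L1 := L_stable nil_lam L12.
  by move: u0L; rewrite L1 memv0 => /eqP ->; rewrite bracket0l.
apply: (@ad_z_nonzero z).
- by apply: span_codim1 => //; apply: LS.
- by move=> v vL; apply: (zeroL L4 zL vL).
- by move=> u v uL vL; apply: (zeroL L4 uL vL).
Qed.

Lemma nonmetabelian_dims : [/\ (\dim (L 1) = (\dim (L 2)).+1)%N, (\dim (L 3) < \dim (L 2))%N,
  (\dim (L 4) < \dim (L 3))%N & (0 < \dim (L 4))%N].
Proof.
split; [|by apply/dL/(@Lnz 2 4)|by apply/dL/(@Lnz 3 4)|by rewrite lt0n dimv_eq0].
apply/eqP; rewrite eqn_leq (derived_layer lie_lam nil_lam n_le7 u0L v0L uv0).
by apply/dL/(@Lnz 1 4).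
Qed.

Let L_eq0 k : (\dim (L k) <= 1)%N -> L k.+1 = 0%VS.
Proof.
move=> dk; apply/eqP; apply: contraT => nz; have := dL (Lnz (leqnSn k) nz).
move/leq_trans/(_ dk); rewrite ltnS leqn0 dimv_eq0.
by rewrite (negPf nz).
Qed.

Let line_L k g : (\dim (L k) <= 1)%N -> g \in L k -> g != 0 -> (L k <= <<[:: g]>>)%VS.
Proof.
move=> dk gL g0; rewrite span_seq1; suff /eqP -> : (<[g]> == L k)%VS by apply: subvv.
by rewrite eqEdim -memvE gL dim_vline g0.
Qed.

(** The bounds force dimensions 7, 5, 4, 2, 1 along the lower central series. *)
Lemma two_branches x y : (fullv <= <<[:: x; y]>> + L 1)%VS -> (\dim (L 3) + 2 <= \dim (L 2))%N ->
  nontrivial_degeneration lam.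
Proof.
move=> span_xy d23; have [d12 _ d34 d4] := nonmetabelian_dims.
have [n7 [d3E d4E]] : n = 7 /\ \dim (L 3) = 2 /\ \dim (L 4) = 1%N.
  have nat_eq k k1 k2 k3 k4 : (k <= 7 -> k1 + 2 <= k -> k1 = k2.+1 -> k3 + 2 <= k2 -> k4 < k3 ->
    0 < k4 -> k = 7 /\ k3 = 2 /\ k4 = 1)%N by clear; lia.
  by case/andP: n_le7 => _ n7; apply: nat_eq n7 dL1 d12 d23 d34 d4.
have L5 : L 5 = 0%VS by apply: L_eq0; rewrite d4E.
have zero5 := zeroL L5.
have /subvPn[e eL eL4] : ~~ (L 3 <= L 4)%VS.
  by apply: contraL d34 => /dimvS; rewrite -leqNgt.
have L3e : (L 3 <= <<[:: e]>> + L 4)%VS.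
  by apply: span_codim1 => //; [apply: LS | rewrite d3E d4E].
have brL4 w : \[w, e] \in L 4 by apply: mem_L1.
have [x' [y' [span_xy' x'e y'e]]] : exists x' y', [/\ (fullv <= <<[:: x'; y']>> + L 1)%VS,
    \[x', e] != 0 & \[y', e] = 0].
  have [xe|xe] := eqVneq \[x, e] 0; last first.
    have L4x := line_L _ (brL4 x) xe; rewrite d4E in L4x.
    have := subvP (L4x isT) _ (brL4 y); rewrite span_seq1 => /vlineP[c yE].
    exists x, (y - c *: x); split=> //; last by rewrite bracketBl bracketZl yE subrr.
    apply: subv_trans span_xy _; apply: addvS => //; apply/span_subvP => w.
    rewrite !inE => /orP[] /eqP ->; first by mem_span.
    by rewrite -[X in X \in _](subrK (c *: x)); mem_span.
  exists y, x; split=> //.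
    apply: subv_trans span_xy _; apply: addvS => //; apply: sub_span => w.
    by rewrite !inE orbC.
  apply: contraNneq L4nz => ye; have L4s : (L 4 <= <<[:: \[x, e]; \[y, e]]>> + L 5)%VS := layer span_xy L3e.
  rewrite xe ye L5 addv0 in L4s.
  rewrite -subv0; apply: subv_trans L4s _; apply/span_subvP => w.
  by rewrite !inE orbb memv0.
move: x' y' span_xy' x'e y'e => {span_xy} {}x {}y span_xy g0 ye.
pose g := \[x, e]; pose z := \[x, y]; pose p := \[x, z]; pose r := \[y, z].
have L4g : (L 4 <= <<[:: g]>>)%VS by apply: line_L (brL4 x) g0; rewrite d4E.
have L3eg : (L 3 <= <<[:: e; g]>>)%VS by apply: (sub_add_span (X := [:: e]) L3e).
have L1z : (L 1 <= <<[:: z]>> + L 2)%VS.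
  have := layer (k := 0) span_xy span_xy; rewrite /= !brxx (brC y x) -/z.
  move/subv_trans; apply; apply: addvS => //; apply/span_subvP => w.
  by rewrite !inE => /or4P[] /eqP ->; mem_span.
have L2pr : (L 2 <= <<[:: p; r]>> + L 3)%VS by apply: (layer span_xy L1z).
have L2E : (L 2 <= <<[:: p; r; e; g]>>)%VS by apply: (sub_add_span (X := [:: p; r]) L2pr).
have L1E : (L 1 <= <<[:: z; p; r; e; g]>>)%VS by apply: (sub_add_span (X := [:: z]) L1z).
have span_all : (fullv <= <<[:: x; y; z; p; r; e; g]>>)%VS.
  exact: (sub_add_span (X := [:: x; y]) span_xy).
have zL : z \in L 1 by apply: brL1.
have pL : p \in L 2 by apply: mem_L1.
have rL : r \in L 2 by apply: mem_L1.
have gL : g \in L 4 by apply: brL4.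
have L3_coord w : w \in L 3 -> exists a b, w = a *: e + b *: g.
  by move/(subvP L3eg)/span2E.
have xr : \[x, r] = \[y, p].
  by rewrite /r (brJ x y z) brxx add0r.
have [al [al' xp]] := L3_coord _ (mem_L1 x pL : \[x, p] \in L 3).
have [be [be' yp]] := L3_coord _ (mem_L1 y pL : \[y, p] \in L 3).
have [ga [ga' yr]] := L3_coord _ (mem_L1 y rL : \[y, r] \in L 3).
have xg : \[x, g] = 0 by apply: (zero5 0 4); rewrite ?memvf.
have yg : \[y, g] = 0 by apply: (zero5 0 4); rewrite ?memvf.
have adz w : \[z, w] = \[x, \[y, w]] - \[y, \[x, w]] by rewrite (brJ x y w) -/z addrK.
have zp : \[z, p] = be *: g.
  by rewrite adz xp yp !bracketDr !bracketZr xg yg ye -/g !scaler0 !addr0 subr0.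
have zr : \[z, r] = ga *: g.
  by rewrite adz xr yp yr !bracketDr !bracketZr xg yg ye -/g !scaler0 !addr0 subr0.
have ze : \[z, e] = 0 by apply: (zero5 1 3).
have zg : \[z, g] = 0 by apply: (zero5 1 4).
have nz : (be != 0) || (ga != 0).
  apply: contraT; rewrite negb_or !negbK => /andP[/eqP be0 /eqP ga0]; exfalso.
  apply: (ad_z_nonzero L1z) => [v|u v uL vL]; last by apply: (zero5 2 2).
  move/(subvP L2E)/span4E=> [a [b [c [d ->]]]].
  by rewrite !bracketDr !bracketZr zp zr be0 ga0 ze zg !scale0r !scaler0 !addr0.
apply: (@table_two_branches _ _ _ lie_lam nil_lam x y z p r e g al al' be be' ga ga') => //.
- by split=> //; rewrite xr yp.
- by split; [apply: (zero5 2 2) | apply: (zero5 2 3) | apply: (zero5 2 4)].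
- by split; [apply: (zero5 2 3) | apply: (zero5 2 4) | apply: (zero5 3 4)].
Qed.

Let derived_line x y : (fullv <= <<[:: x; y]>> + L 1)%VS -> (L 1 <= <<[:: \[x, y]]>> + L 2)%VS.
Proof.
move=> span_xy; have := layer (k := 0) span_xy span_xy; rewrite /= !brxx (brC y x).
move/subv_trans; apply; apply: addvS => //; apply/span_subvP => w.
by rewrite !inE => /or4P[] /eqP ->; mem_span.
Qed.

(** [L 2 / L 3] is a line, so some combination of the generators sends [z] into [L 3]; it becomes
    [y']. *)
Let orient x y (z := \[x, y]) : (L 1 <= <<[:: z]>> + L 2)%VS ->
  (L 2 <= <<[:: \[x, z]; \[y, z]]>> + L 3)%VS -> (\dim (L 2) <= (\dim (L 3)).+1)%N ->
  exists x' y', [/\ {subset [:: x; y] <= <<[:: x'; y']>>%VS},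
    {subset [:: x'; y'] <= <<[:: x; y]>>%VS}, (L 1 <= <<[:: \[x', y']]>> + L 2)%VS,
    \[y', \[x', y']] \in L 3 & (L 2 <= <<[:: \[x', \[x', y']]]>> + L 3)%VS].
Proof.
move=> L1z L2xy d23.
have brL2 w : \[w, z] \in L 2 by apply: mem_L1; apply: brL1.
have [xz|xz] := boolP (\[x, z] \in L 3).
  have yz : \[y, z] \notin L 3.
    have [_ lt32 _ _] := nonmetabelian_dims; apply/negP => yz; move: lt32; rewrite ltnNge dimvS //.
    apply: subv_trans L2xy _; rewrite subv_add subvv andbT; apply/span_subvP => w.
    by rewrite !inE => /orP[] /eqP ->.
  exists y, x; rewrite (brC y x) -/z !bracketNr; split.
  - by move=> w; rewrite !inE => /orP[] /eqP ->; mem_span.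
  - by move=> w; rewrite !inE => /orP[] /eqP ->; mem_span.
  - apply: subv_trans L1z _; apply: addvS => //; apply/span_subvP => w; rewrite inE => /eqP ->.
    by rewrite -memvN; mem_span.
  - by rewrite memvN.
  have L2y := span_codim1 (LS lam 2) d23 (brL2 y) yz.
  apply: subv_trans L2y _; apply: addvS => //; apply/span_subvP => w; rewrite inE => /eqP ->.
  by rewrite -memvN; mem_span.
have L2x := span_codim1 (LS lam 2) d23 (brL2 x) xz.
have /span_add1P[c yz] := subvP L2x _ (brL2 y).
have xy' : \[x, y - c *: x] = z by rewrite bracketBr bracketZr brxx scaler0 subr0.
exists x, (y - c *: x); rewrite xy'; split=> //.
- move=> w; rewrite !inE => /orP[] /eqP ->; first by mem_span.
  by rewrite -[X in X \in _](subrK (c *: x)); mem_span.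
- by move=> w; rewrite !inE => /orP[] /eqP ->; mem_span.
- by rewrite bracketBl bracketZl.
Qed.

Let ad_y_e1 x y : \[y, \[x, \[x, y]]] = \[x, \[y, \[x, y]]].
Proof. by rewrite (brJ y x) (brC y x) bracketNl brxx oppr0 add0r. Qed.

Let ad_z_e1 x y (z := \[x, y]) (e1 := \[x, z]) :
  \[z, e1] = \[x, \[x, \[y, z]]] - \[y, \[x, e1]].
Proof. by rewrite -(ad_y_e1 x y) (brJ x y e1) addrK. Qed.

(** As [L 5 = 0], Jacobi reduces [[y, e2]] to [- [z, e1]]. The vector [g = [z, e1]] is nonzero
    because [L 1] is not abelian, so it spans [L 4]. *)
Let short_table x y (z := \[x, y]) (e1 := \[x, z]) (e2 := \[x, e1]) :
  (\dim (L 4) <= 1)%N -> (L 1 <= <<[:: z]>> + L 2)%VS -> (L 2 <= <<[:: e1]>> + L 3)%VS ->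
  (L 3 <= <<[:: e2]>> + L 4)%VS -> \[y, z] \in L 3 ->
  exists g (phi rho sigma : K), [/\ g != 0, (L 4 <= <<[:: g]>>)%VS, \[x, e2] = phi *: g,
    [/\ \[y, z] = rho *: e2 + sigma *: g, \[y, e1] = (rho * phi) *: g, \[y, e2] = - g &
    \[z, e1] = g] & g \in L 4].
Proof.
move=> d4 L1z L2e1 L3e2 yz3; have L5 : L 5 = 0%VS by apply: L_eq0.
have zero5 := zeroL L5.
have zL : z \in L 1 by apply: brL1.
have e1L : e1 \in L 2 by apply: mem_L1.
have e2L : e2 \in L 3 by apply: mem_L1.
pose g := \[z, e1].
have xxyz : \[x, \[x, \[y, z]]] = 0.
  by apply: (zero5 0 4); [apply: memvf | apply: mem_L1 |].
have ye2 : \[y, e2] = - g by rewrite /g ad_z_e1 -/z -/e1 -/e2 xxyz sub0r opprK.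
have gL : g \in L 4 by rewrite -memvN -ye2; apply: mem_L1.
have g0 : g != 0.
  apply/negP => /eqP g0; apply: (ad_z_nonzero L1z) => [v|u v uL vL]; last by apply: (zero5 2 2).
  move/(subvP L2e1)/span_add1P=> [c vL]; rewrite -(subrK (c *: e1) v) bracketDr bracketZr -/g.
  by rewrite g0 scaler0 addr0; apply: (zero5 1 3).
have L4g : (L 4 <= <<[:: g]>>)%VS by apply: line_L.
have xe2L : \[x, e2] \in L 4 by apply: mem_L1.
have := subvP L4g _ xe2L; rewrite span_seq1 => /vlineP[phi xe2].
have /span_add1P[rho rL] := subvP L3e2 _ yz3.
have := subvP L4g _ rL; rewrite span_seq1 => /vlineP[sigma rE].
have yzE : \[y, z] = rho *: e2 + sigma *: g by rewrite -rE addrC subrK.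
have xg : \[x, g] = 0 by apply: (zero5 0 4); rewrite ?memvf.
exists g, phi, rho, sigma; split=> //; split=> //.
by rewrite ad_y_e1 -/z yzE bracketDr !bracketZr xe2 xg scaler0 addr0 scalerA.
Qed.

(** The dimensions of the series are 6, 4, 3, 2, 1. *)
Lemma filiform6_case x y : n = 6 -> (fullv <= <<[:: x; y]>> + L 1)%VS ->
  nontrivial_degeneration lam.
Proof.
move=> n6 span0; have [d12 d32 d43 d4] := nonmetabelian_dims.
have d4' : (\dim (L 4) <= 1)%N /\ (\dim (L 2) <= (\dim (L 3)).+1)%N /\
    (\dim (L 3) <= (\dim (L 4)).+1)%N.
  have nat_le k k1 k2 k3 k4 : (k = 6 -> k1 + 2 <= k -> k1 = k2.+1 -> k3 < k2 -> k4 < k3 -> 0 < k4 ->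
    k4 <= 1 /\ k2 <= k3.+1 /\ k3 <= k4.+1)%N by clear; lia.
  exact: nat_le n6 dL1 d12 d32 d43 d4.
have [{}d4 [d23 d34]] := d4'.
have [x' [y' [sub1 _ L1z yz L2e1]]] := orient (derived_line span0) (layer span0 (derived_line span0)) d23.
have {}span0 : (fullv <= <<[:: x'; y']>> + L 1)%VS.
  by apply: subv_trans span0 _; apply: addvS => //; apply/span_subvP.
move: x' y' span0 L1z yz L2e1 {sub1} => {}x {}y span_xy L1z yz L2e1.
have L3e2 : (L 3 <= <<[:: \[x, \[x, \[x, y]]]]>> + L 4)%VS.
  apply: subv_trans (layer span_xy L2e1) _; rewrite subv_add addvSr andbT.
  apply/span_subvP => w; rewrite !inE => /orP[] /eqP ->; first by apply: (subvP (addvSl _ _)); mem_span.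
  by apply: (subvP (addvSr _ _)); rewrite ad_y_e1 mem_L1.
have [g [phi [rho [sigma [g0 L4g xe2 [yzE ye1 ye2 ze1] gL]]]]] := short_table d4 L1z L2e1 L3e2 yz.
have L5 : L 5 = 0%VS by apply: L_eq0.
have zero5 := zeroL L5.
have zL : \[x, y] \in L 1 by apply: brL1.
have e1L : \[x, \[x, y]] \in L 2 by apply: mem_L1.
have e2L : \[x, \[x, \[x, y]]] \in L 3 by apply: mem_L1.
apply: (@table_filiform6 _ _ _ lie_lam nil_lam x y \[x, y] \[x, \[x, y]]
  \[x, \[x, \[x, y]]] g phi rho sigma n6) => //.
- have L3s := sub_add_span L3e2 L4g; have L2s := sub_add_span L2e1 L3s.
  by have L1s := sub_add_span L1z L2s; exact: (sub_add_span (X := [:: x; y]) span_xy L1s).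
- by split=> //; apply: (zero5 0 4); rewrite ?memvf.
- by split=> //; apply: (zero5 0 4); rewrite ?memvf.
- by split=> //; [apply: (zero5 1 3) | apply: (zero5 1 4)].
- by split; [apply: (zero5 2 3) | apply: (zero5 2 4) | apply: (zero5 3 4)].
Qed.

Let oriented_three_generators x y w : n = 7 -> (\dim (L 4) <= 1)%N ->
  (fullv <= <<[:: x; y; w]>> + L 1)%VS -> (L 1 <= <<[:: \[x, y]]>> + L 2)%VS ->
  \[y, \[x, y]] \in L 3 -> (L 2 <= <<[:: \[x, \[x, y]]]>> + L 3)%VS ->
  \[x, w] \in L 2 -> \[y, w] \in L 2 -> \[w, \[x, y]] \in L 3 -> nontrivial_degeneration lam.
Proof.
move=> n7 d4 span0 L1z yz L2e1 xw yw wz.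
pose z := \[x, y]; pose e1 := \[x, z]; pose e2 := \[x, e1].
have zL : z \in L 1 by apply: brL1.
have e1L : e1 \in L 2 by apply: mem_L1.
have e2L : e2 \in L 3 by apply: mem_L1.
have we1 : \[w, e1] \in L 4.
  rewrite /e1 brJ memvD //; last by apply: mem_L1.
  by apply: (LL (i := 2) (j := 1)) => //; rewrite brC memvN.
have L3e2 : (L 3 <= <<[:: e2]>> + L 4)%VS.
  apply: subv_trans (layer span0 L2e1) _; rewrite subv_add addvSr andbT.
  apply/span_subvP => v; rewrite !inE => /or3P[] /eqP ->.
  - by apply: (subvP (addvSl _ _)); mem_span.
  - by apply: (subvP (addvSr _ _)); rewrite ad_y_e1 mem_L1.
  - exact: (subvP (addvSr _ _)).
have [g [phi [rho [sigma [g0 L4g xe2 [yzE ye1 ye2 ze1] gL]]]]] := short_table d4 L1z L2e1 L3e2 yz.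
have L5 : L 5 = 0%VS by apply: L_eq0.
have zero5 := zeroL L5.
have L3s : (L 3 <= <<[:: e2; g]>>)%VS := sub_add_span L3e2 L4g.
have L2s : (L 2 <= <<[:: e1; e2; g]>>)%VS := sub_add_span L2e1 L3s.
have L1s : (L 1 <= <<[:: z; e1; e2; g]>>)%VS := sub_add_span L1z L2s.
have [a [b [eta xwE]]] := span3E (subvP L2s _ xw).
(* Brings [[x, w]] down to its [g] component. *)
pose w' := w - (a *: z + b *: e1).
have wE : w = w' + (a *: z + b *: e1) by rewrite subrK.
have xw' : \[x, w'] = eta *: g.
  by rewrite /w' bracketBr bracketDr !bracketZr xwE -/e1 -/e2; vec_ring.
have yw'L : \[y, w'] \in L 2.
  rewrite /w' bracketBr; apply: memvB => //; rewrite bracketDr !bracketZr.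
  by apply: memvD; apply: memvZ; apply: mem_L1 => //; apply: (subvP (LS lam 1)).
have [v1 [v2 [v3 yw']]] := span3E (subvP L2s _ yw'L).
have xg : \[x, g] = 0 by apply: (zero5 0 4); rewrite ?memvf.
have yg : \[y, g] = 0 by apply: (zero5 0 4); rewrite ?memvf.
have gw' : \[g, w'] = 0 by rewrite brC (zero5 0 4) ?oppr0 ?memvf.
have zg : \[z, g] = 0 by apply: (zero5 1 4).
have ze2 : \[z, e2] = 0 by apply: (zero5 1 3).
have zw' : \[z, w'] = v1 *: e2 + (v2 * phi) *: g.
  have := brJ x y w'; rewrite -/z xw' yw' bracketZr yg scaler0 addr0 => <-.
  by rewrite !bracketDr !bracketZr -/e2 xe2 xg !scaler0 addr0 scalerA.
have e1w' : \[e1, w'] = (v1 * phi) *: g.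
  have := brJ x z w'; rewrite xw' bracketZr zg scaler0 addr0 -/e1 => <-.
  by rewrite zw' bracketDr !bracketZr xe2 xg scaler0 addr0 scalerA.
have e2w' : \[e2, w'] = 0.
  have e1g : \[e1, g] = 0 by apply: (zero5 2 4).
  have := brJ x e1 w'; rewrite xw' e1w' !bracketZr xg e1g !scaler0 addr0 -/e2.
  by move=> <-.
(* Jacobi for [y], [z], [w'] reads [- v1 g = v1 g]. *)
have v10 : v1 = 0.
  have := brJ y z w'; rewrite yzE bracketDl !bracketZl e2w' gw' !scaler0 !add0r.
  rewrite yw' zw' !bracketDr !bracketZr ye2 yg ze1 ze2 zg !scaler0 !addr0 scalerN => /eqP.
  rewrite eq_sym -addr_eq0 -mulr2n -scaler_nat !scaler_eq0 pnatr_eq0 (negPf g0) orbF.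
  by move/eqP.
rewrite v10 mul0r !scale0r !add0r in zw' yw' e1w'.
apply: (@table_three_generators _ _ _ lie_lam nil_lam x y w' z e1 e2 g
  phi rho sigma eta v2 v3 n7) => //.
- have span_all : (fullv <= <<[:: x; y; w; z; e1; e2; g]>>)%VS.
    exact: (sub_add_span (X := [:: x; y; w]) span0 L1s).
  by apply: span_trans span_all _ => /=; rewrite wE; do ![apply/andP; split] => //; mem_span.
- by split; [apply: (zero5 2 3) | apply: (zero5 2 4) | apply: (zero5 3 4)].
Qed.

Let three_generators_core x y w : n = 7 -> (\dim (L 1) <= 4)%N ->
  (fullv <= <<[:: x; y; w]>> + L 1)%VS -> \[x, y] \notin L 2 -> nontrivial_degeneration lam.
Proof.
move=> n7 d1 span0 xyL; have [d12 d32 d43 d4] := nonmetabelian_dims.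
have d4' : (\dim (L 4) <= 1)%N /\ (\dim (L 2) <= (\dim (L 3)).+1)%N /\
    (\dim (L 3) <= (\dim (L 4)).+1)%N.
  have nat_le k1 k2 k3 k4 : (k1 <= 4 -> k1 = k2.+1 -> k3 < k2 -> k4 < k3 -> 0 < k4 ->
    k4 <= 1 /\ k2 <= k3.+1 /\ k3 <= k4.+1)%N by clear; lia.
  exact: nat_le d1 d12 d32 d43 d4.
have [{}d4 [d23 d34]] := d4'.
have d12' : (\dim (L 1) <= (\dim (L 2)).+1)%N by rewrite d12.
have L1z := span_codim1 (LS lam 1) d12' (brL1 x y) xyL.
have /span_add1P[c xw] := subvP L1z _ (brL1 x w).
have /span_add1P[d yw] := subvP L1z _ (brL1 y w).
(* The bracket modulo [L 2] is an alternating form with values in a line on a three-dimensional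
   space; [w1] spans its radical. *)
pose w1 := w - c *: y + d *: x.
have xw1 : \[x, w1] \in L 2.
  by rewrite /w1 bracketDr bracketBr !bracketZr brxx scaler0 addr0.
have yw1 : \[y, w1] \in L 2.
  by rewrite /w1 bracketDr bracketBr !bracketZr brxx scaler0 subr0 (brC y x) scalerN.
have rad u v : \[u, w1] \in L 2 -> \[v, w1] \in L 2 -> \[w1, \[u, v]] \in L 3.
  move=> uL vL; rewrite brJ memvD //.
    by rewrite brC memvN mem_L1 // brC memvN.
  by rewrite mem_L1 // brC memvN.
have {}span0 : (fullv <= <<[:: x; y; w1]>> + L 1)%VS.
  apply: subv_trans span0 _; apply: addvS => //; apply/span_subvP => v.
  rewrite !inE => /or3P[] /eqP ->; [by mem_span | by mem_span |].
  have -> : w = w1 + c *: y - d *: x by rewrite /w1; vec_ring.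
  by mem_span.
have L2xy : (L 2 <= <<[:: \[x, \[x, y]]; \[y, \[x, y]]]>> + L 3)%VS.
  apply: subv_trans (layer span0 L1z) _; rewrite subv_add addvSr andbT; apply/span_subvP => v.
  rewrite !inE => /or3P[] /eqP ->; last by apply: (subvP (addvSr _ _)); apply: rad.
    by apply: (subvP (addvSl _ _)); mem_span.
  by apply: (subvP (addvSl _ _)); mem_span.
have [x' [y' [sub1 sub2 L1z' yz' L2e1]]] := orient L1z L2xy d23.
have rad' v : v \in [:: x'; y'] -> \[v, w1] \in L 2.
  by move/sub2/span2E=> [a [b ->]]; rewrite bracketDl !bracketZl memvD ?memvZ.
have {}span0 : (fullv <= <<[:: x'; y'; w1]>> + L 1)%VS.
  apply: subv_trans span0 _; apply: addvS => //; apply/span_subvP => v.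
  have sub : (<<[:: x'; y']>> <= <<[:: x'; y'; w1]>>)%VS.
    by apply: sub_span => u; rewrite !inE => /orP[] ->; rewrite ?orbT.
  rewrite !inE => /or3P[] /eqP ->; last by mem_span.
    by apply/(subvP sub)/sub1; rewrite inE eqxx.
  by apply/(subvP sub)/sub1; rewrite !inE eqxx orbT.
have {}xw1 : \[x', w1] \in L 2 by apply: rad'; rewrite inE eqxx.
have {}yw1 : \[y', w1] \in L 2 by apply: rad'; rewrite !inE eqxx orbT.
have wz : \[w1, \[x', y']] \in L 3 by apply: rad.
exact: (oriented_three_generators n7 d4 span0 L1z' yz' L2e1 xw1 yw1 wz).
Qed.

Lemma three_generators x y w : n = 7 -> (\dim (L 1) <= 4)%N ->
  (fullv <= <<[:: x; y; w]>> + L 1)%VS -> nontrivial_degeneration lam.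
Proof.
move=> n7 d1 span0; have [d12 _ _ _] := nonmetabelian_dims.
have perm_span (X : seq 'cV[K]_n) : {subset [:: x; y; w] <= X} -> (fullv <= <<X>> + L 1)%VS.
  by move=> sub; apply: subv_trans span0 _; apply: addvS => //; apply: sub_span.
have [xy|] := boolP (\[x, y] \in L 2); last exact: (three_generators_core n7 d1 span0).
have [xw|] := boolP (\[x, w] \in L 2); last first.
  move=> nL; apply: (@three_generators_core x w y n7 d1 _ nL); apply: perm_span => v.
  by rewrite !inE => /or3P[] ->; rewrite ?orbT ?orbT.
have [yw|] := boolP (\[y, w] \in L 2); last first.
  move=> nL; apply: (@three_generators_core y w x n7 d1 _ nL); apply: perm_span => v.
  by rewrite !inE => /or3P[] ->; rewrite ?orbT ?orbT.
have : (L 1 <= L 2)%VS.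
  apply: subv_trans (layer (k := 0) span0 span0) _; rewrite subv_add subvv andbT.
  apply/span_subvP => v; rewrite /= !brxx (brC y x) (brC w x) (brC w y) !inE.
  by do ![case/predU1P=> [->|] | move/eqP => ->]; rewrite ?memvN ?mem0v.
by move/dimvS; rewrite d12 ltnn.
Qed.

(** Common end of the cases [L 5 = 0], where [k = 0], and [L 5] a line spanned by [g]. *)
Let filiform7_core x y g (k : K) (z := \[x, y]) (e1 := \[x, z]) (e2 := \[x, e1])
    (f := \[x, e2]) :
  n = 7 -> L 6 = 0%VS -> (fullv <= <<[:: x; y]>> + L 1)%VS -> (L 1 <= <<[:: z]>> + L 2)%VS ->
  (L 2 <= <<[:: e1]>> + L 3)%VS -> (L 3 <= <<[:: e2]>> + L 4)%VS -> \[y, z] \in L 3 ->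
  (L 4 <= <<[:: f; g]>>)%VS -> g \in L 4 -> \[x, f] = k *: g ->
  [/\ \[x, g] = 0, \[y, f] = 0, \[y, g] = 0, \[z, e1] = g & \[z, e2] = 0] ->
  nontrivial_degeneration lam.
Proof.
move=> n7 L6 span_xy L1z L2e1 L3e2 yz3 L4fg gL xf [xg yf yg ze1 ze2].
have zero6 := zeroL L6.
have zL : z \in L 1 by apply: brL1.
have e1L : e1 \in L 2 by apply: mem_L1.
have e2L : e2 \in L 3 by apply: mem_L1.
have fL : f \in L 4 by apply: mem_L1.
have L3s : (L 3 <= <<[:: e2; f; g]>>)%VS := sub_add_span L3e2 L4fg.
have L2s : (L 2 <= <<[:: e1; e2; f; g]>>)%VS := sub_add_span L2e1 L3s.
have L1s : (L 1 <= <<[:: z; e1; e2; f; g]>>)%VS := sub_add_span L1z L2s.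
have [rho [sigma [tau yz]]] := span3E (subvP L3s _ yz3).
have ye1 : \[y, e1] = rho *: f + (sigma * k) *: g.
  rewrite /e1 ad_y_e1 -/z yz !bracketDr !bracketZr -/f xf xg scaler0 addr0.
  by rewrite scalerA.
have ye2 : \[y, e2] = (rho * k - 1) *: g.
  have : \[z, e1] = \[x, \[y, e1]] - \[y, e2] by rewrite (brJ x y e1) addrK.
  rewrite ze1 ye1 bracketDr !bracketZr xf xg scaler0 addr0 scalerA => gE.
  by rewrite scalerBl scale1r {2}gE subKr.
rewrite addrA in yz.
apply: (@table_filiform7 _ _ _ lie_lam nil_lam x y z e1 e2 f g k rho sigma tau) => //.
- exact: (sub_add_span (X := [:: x; y]) span_xy L1s).
- by split=> //; [apply: (zero6 1 4) | apply: (zero6 1 4)].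
- split; [exact: (zero6 2 3) | exact: (zero6 2 4) | exact: (zero6 2 4) | exact: (zero6 3 4) |].
  exact: (zero6 3 4).
- exact: (zero6 4 4).
Qed.

Lemma filiform7_case x y : n = 7 -> (fullv <= <<[:: x; y]>> + L 1)%VS ->
  (\dim (L 2) <= (\dim (L 3)).+1)%N -> nontrivial_degeneration lam.
Proof.
move=> n7 span0 d23; have [d12 d32 d43 d4] := nonmetabelian_dims.
have [x' [y' [sub1 _ L1z yz3 L2e1]]] :=
  orient (derived_line span0) (layer span0 (derived_line span0)) d23.
have {}span0 : (fullv <= <<[:: x'; y']>> + L 1)%VS.
  by apply: subv_trans span0 _; apply: addvS => //; apply/span_subvP.
move: x' y' span0 L1z yz3 L2e1 {sub1} => {}x {}y span_xy L1z yz3 L2e1.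
pose z := \[x, y]; pose e1 := \[x, z]; pose e2 := \[x, e1]; pose f := \[x, e2].
pose h := \[y, e2]; pose r := \[y, z].
have ye1 : \[y, e1] = \[x, r] by rewrite /e1 ad_y_e1.
have L3e2 : (L 3 <= <<[:: e2]>> + L 4)%VS.
  apply: subv_trans (layer span_xy L2e1) _; rewrite subv_add addvSr andbT.
  apply/span_subvP => w; rewrite !inE => /orP[] /eqP ->.
    by apply: (subvP (addvSl _ _)); mem_span.
  by apply: (subvP (addvSr _ _)); rewrite ad_y_e1 mem_L1.
have L4E : \dim (L 4) = 2.
  have d0 := dim_span_add span_xy; rewrite dim_cV /= in d0.
  have d3 := dim_span_add L3e2; rewrite /= in d3.
  have nat_eq k k1 k2 k3 k4 : (k = 7 -> k <= 2 + k1 -> k1 + 2 <= k -> k1 = k2.+1 -> k2 <= k3.+1 ->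
    k3 < k2 -> k3 <= 1 + k4 -> k4 < k3 -> k4 = 2)%N by clear; lia.
  exact: nat_eq n7 d0 dL1 d12 d23 d32 d3 d43.
have L4s : (L 4 <= <<[:: f; h]>> + L 5)%VS := layer span_xy L3e2.
have zL : z \in L 1 by apply: brL1.
have e1L : e1 \in L 2 by apply: mem_L1.
have e2L : e2 \in L 3 by apply: mem_L1.
have fL : f \in L 4 by apply: mem_L1.
have hL : h \in L 4 by apply: mem_L1.
have xrL : \[x, r] \in L 4 by apply: mem_L1.
have xxrL : \[x, \[x, r]] \in L 5 by apply: mem_L1.
have ze1 : \[z, e1] = \[x, \[x, r]] - h by rewrite ad_z_e1.
have ze2 : \[z, e2] = \[x, h] - \[y, f] by rewrite (brJ x y e2) addrK.
have d5 : (\dim (L 5) <= 1)%N.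
  by have := dL L4nz; rewrite L4E ltnS.
have L6 : L 6 = 0%VS by apply: L_eq0.
have zero6 := zeroL L6.
(* If [L 5 = 0], then [[z, e1] = - h], which together with [f] spans [L 4]. *)
have [L5|L5nz] := eqVneq (L 5) 0%VS.
  have zero5 := zeroL L5.
  have xxr : \[x, \[x, r]] = 0 by apply: (zero5 0 4); rewrite ?memvf.
  apply: (@filiform7_core x y \[z, e1] 0 n7 L6 span_xy L1z L2e1 L3e2 yz3).
  - rewrite L5 addv0 in L4s; apply: subv_trans L4s _; apply/span_subvP => w.
    by rewrite !inE ze1 xxr sub0r => /orP[] /eqP ->; [|rewrite -memvN]; mem_span.
  - by rewrite ze1 xxr sub0r memvN.
  - by rewrite scale0r (zero5 0 4) ?memvf.
  - rewrite -/z -/e1 -/e2 ze1 xxr sub0r !bracketNr.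
    have kL4 w v : v \in L 4 -> \[w, v] = 0 by move=> vL; apply: (zero5 0 4); rewrite ?memvf.
    by rewrite !(kL4 _ h) // (kL4 _ f) // oppr0; split=> //; apply: (zero5 1 3).
have zero2 u : \[x, u] = 0 -> \[y, u] = 0 -> (L 4 <= <<[:: u]>> + L 5)%VS -> False.
  move=> xu yu /(layer span_xy); rewrite /= xu yu; have := L6; rewrite /= => ->.
  rewrite addv0 => L5s; case/negP: L5nz; rewrite -subv0; apply: subv_trans L5s _.
  by apply/span_subvP => w; rewrite !inE orbb memv0.
(* Compared with [ze2], this gives [[y, f] = 2 [x, h]]. *)
have xze1 : \[z, e2] = - \[x, h].
  have := brJ x z e1; rewrite -/e1 -/e2 brxx add0r => <-.
  by rewrite ze1 bracketBr (zero6 0 5 x _ (memvf _) xxrL) ?sub0r.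
have yh : \[y, h] = 0.
  have := brJ y z e1; rewrite ye1 (zero6 3 2 _ _ yz3 e1L) // (zero6 1 4 _ _ zL xrL) // addr0.
  rewrite ze1 bracketBr (zero6 0 5 y _ (memvf _) xxrL) // sub0r => /eqP.
  by rewrite oppr_eq0 => /eqP.
have fL5 : f \notin L 5.
  apply/negP => fL5; apply: (@zero2 h) => //.
    have yf : \[y, f] = 0 by apply: (zero6 0 5); rewrite ?memvf.
    have /eqP := xze1; rewrite ze2 yf subr0 -addr_eq0 -mulr2n -scaler_nat scaler_eq0 pnatr_eq0 /=.
    by move/eqP.
  apply: subv_trans L4s _; rewrite subv_add addvSr andbT; apply/span_subvP => w.
  rewrite !inE => /orP[] /eqP ->; first exact: (subvP (addvSr _ _)).
  by apply: (subvP (addvSl _ _)); mem_span.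
have L4f : (L 4 <= <<[:: f]>> + L 5)%VS.
  apply: span_codim1 => //; first exact: LS.
  by rewrite L4E ltnS lt0n dimv_eq0.
have /span_add1P[c hc] := subvP L4f _ hL.
have hE : h = c *: f + (h - c *: f) by rewrite addrC subrK.
have xh : \[x, h] = c *: \[x, f].
  by rewrite hE bracketDr bracketZr (zero6 0 5 x _ (memvf _) hc) ?addr0.
have yf : \[y, f] = (2 * c) *: \[x, f].
  have := xze1; rewrite ze2 xh => E.
  by rewrite -[LHS](subKr (c *: \[x, f])) E opprK mulrDl mul1r scalerDl.
(* [[y, h] = 0] becomes [2 c^2 [x, f] = 0]; if [[x, f]] vanished, so would [[y, f]], and then [L 5].
   Hence [h], and so [[z, e1]], lies in [L 5]. *)
have c0 : c = 0.
  have := yh; rewrite hE bracketDr bracketZr yf (zero6 0 5 y _ (memvf _) hc) // addr0 scalerA.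
  move/eqP; rewrite scaler_eq0 => /orP[|/eqP xf].
    by rewrite !mulf_eq0 pnatr_eq0 orbb => /eqP.
  exfalso; apply: (@zero2 f) => //.
  by rewrite yf xf scaler0.
rewrite c0 mulr0 scale0r in yf; rewrite c0 scale0r in xh; rewrite c0 scale0r subr0 in hc.
rewrite xh yf subr0 in ze2.
pose g := \[z, e1].
have gL : g \in L 5 by rewrite /g ze1; apply: memvB.
have g0 : g != 0.
  apply/negP => /eqP g0; apply: (ad_z_nonzero L1z) => [v|u v].
    move/(subvP L2e1)/span_add1P=> [a]; set v' := v - _ => vL; have -> : v = a *: e1 + v' by rewrite addrC subrK.
    rewrite bracketDr bracketZr -/g g0 scaler0 add0r.
    have /span_add1P[b wL] := subvP L3e2 _ vL; rewrite -(subrK (b *: e2) v') bracketDr bracketZr.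
    by rewrite ze2 scaler0 addr0; apply: (zero6 1 4).
  move=> /(subvP L2e1)/span_add1P[a uL] /(subvP L2e1)/span_add1P[b vL].
  rewrite -(subrK (a *: e1) u) -(subrK (b *: e1) v) ![_ - _ + _]addrC expand_uv.
  rewrite (zero6 2 3 e1 _ e1L vL) // (zero6 2 3 e1 _ e1L uL) // (zero6 3 3 _ _ uL vL) //.
  by rewrite !scaler0 subrr addr0.
have L5g : (L 5 <= <<[:: g]>>)%VS by apply: line_L.
have := subvP L5g _ (mem_L1 x fL : \[x, f] \in L 5); rewrite span_seq1 => /vlineP[k xf].
apply: (@filiform7_core x y g k n7 L6 span_xy L1z L2e1 L3e2 yz3) => //.
- exact: (sub_add_span L4f L5g).
- exact: (subvP (LS lam 4)).
- by split=> //; apply: (zero6 0 5); rewrite ?memvf.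
Qed.

End NonMetabelianCases.

(** * Conclusion: the number of generators *)

Theorem nilpotent_degeneration (K : numFieldType) (n : nat) (lam : strconst K n) :
  (1 < n <= 7)%N -> is_lie lam -> nilpotent_lie lam -> nontrivial_degeneration lam.
Proof.
move=> n_le7 lie_lam nil_lam; pose L := lower_central lam.
have [[u [v [uL vL uv]]]|ab] :=
  boolp.EM (exists u v, [/\ u \in L 1, v \in L 1 & bracket lam u v != 0]); last first.
  apply: metabelian_degeneration => // u v uL vL; apply/eqP; apply: contraT => uv.
  by case: ab; exists u, v.
have [d12 d32 d43 d4] := nonmetabelian_dims lie_lam nil_lam n_le7 uL vL uv.
have d1 : (\dim (L 1) + 2 <= n)%N by case/andP: n_le7 => n1 _; apply: dim_derived.
have [X szX [spanX _]] := generators_mod (LS lam 0).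
rewrite [\dim (L 0)]dim_cV in szX.
(* The strict descent from [L 1] to a nonzero [L 4] gives [\dim (L 1) >= 4], leaving at most three
   generators. *)
have cases : size X = 2 \/ [/\ size X = 3, n = 7 & (\dim (L 1) <= 4)%N].
  have nat_cases s k k1 k2 k3 k4 : (s = k - k1 -> k1 = k2.+1 -> k3 < k2 -> k4 < k3 -> 0 < k4 ->
    k1 + 2 <= k -> k <= 7 -> s = 2 \/ [/\ s = 3, k = 7 & k1 <= 4])%N.
    clear=> *; have [?|?] : (s = 2 \/ s = 3 /\ k = 7 /\ k1 <= 4)%N by lia.
      by left.
    by right; split; lia.
  by case/andP: n_le7 => _ n7; exact: nat_cases szX d12 d32 d43 d4 d1 n7.
case: cases => [sz2|[sz3 n7 d1']].
  case: X sz2 spanX {szX} => [|x [|y []]] // _ span_xy.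
  have [d23|d23] := leqP (\dim (L 3) + 2) (\dim (L 2)).
    exact: (two_branches lie_lam nil_lam n_le7 uL vL uv span_xy).
  have [n6|n7] : n = 6 \/ n = 7.
    have nat_cases k k1 k2 k3 k4 : (k1 = k2.+1 -> k3 < k2 -> k4 < k3 -> 0 < k4 ->
      k1 + 2 <= k -> k <= 7 -> k = 6 \/ k = 7)%N by clear; lia.
    by case/andP: n_le7 => _ n7; exact: nat_cases d12 d32 d43 d4 d1 n7.
    exact: (filiform6_case lie_lam nil_lam n_le7 uL vL uv n6 span_xy).
  apply: (filiform7_case lie_lam nil_lam n_le7 uL vL uv n7 span_xy).
  by move: d23; rewrite addn2.
case: X sz3 spanX {szX} => [|x [|y [|w []]]] // _ span_xyw.
exact: (three_generators lie_lam nil_lam n_le7 uL vL uv n7 d1' span_xyw).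
Qed.

Local Open Scope complex_scope.

(** [R[i]] is the field of complex numbers. In dimension at most 1 the zero bracket is the only Lie
    bracket, so nothing else degenerates to it; hence [1 < n]. *)
Theorem theorem2 (R : realType) (n : nat) (hn : (1 < n <= 7)%N)
    (lambda : strconst R[i] n) (hlie : is_lie lambda)
    (hnil : nilpotent_lie lambda) :
  exists mu : strconst R[i] n,
    is_lie mu /\ ~ lie_isomorphic mu lambda /\ degenerates mu lambda.
Proof. exact: (@nilpotent_degeneration R[i] n lambda hn hlie hnil). Qed.
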